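(* For every integer $g\ge 2$, the fundamental group $G$ of the closed orientable surface of genus $g$ admits a (nonempty) strongly aperiodic subshift of finite type.
   Context: Let $G$ be a finitely generated group and $\mathcal A$ a finite alphabet. $G$ acts on $\mathcal A^G$ by translation. A subshift of finite type on $G$ is a subset of $\mathcal A^G$ defined by finitely many allowed (equivalently, forbidden) local patterns: there are a finite set $F\subset G$ and a set $\mathcal P\subset\mathcal A^F$ such that the subshift consists of all $x\in\mathcal A^G$ for which, for every $h\in G$, the pattern $f\mapsto x(hf)$ on $F$ lies in $\mathcal P$. It is strongly aperiodic if every element of it has trivial stabilizer in $G$. *)

(* Defs.v *)
From HB Require Import structures.
From Stdlib Require Import Relation_Operators.
From mathcomp Require Import all_boot all_order all_algebra generic_quotient.
From mathcomp Require Import finmap lra.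
From mathcomp Require Import all_classical all_reals all_analysis.
From mathcomp Require Import homotopy.

Set Implicit Arguments.
Unset Strict Implicit.
Unset Printing Implicit Defensive.

Import Order.TTheory GRing.Theory Num.Theory.
Import numFieldTopology.Exports numFieldNormedType.Exports.

Local Open Scope classical_set_scope.
Local Open Scope ring_scope.
Local Open Scope quotient_scope.

Section subshifts.
Context {G : groupType} {A : Type}.
Local Open Scope group_scope.

(* The left translation action of G on A^G. *)
Definition translate (g : G) (x : G -> A) : G -> A := fun h => x (g^-1 * h).

Definition stabilizer (x : G -> A) : set G := [set g | translate g x = x].

Definition strongly_aperiodic (X : set (G -> A)) : Prop :=
  forall x, X x -> stabilizer x = [set 1].

End subshifts.

Section subshifts_of_finite_type.
Context {G : groupType} {A : finType}.
Local Open Scope group_scope.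

Definition local_pattern (F : {fset G}) (x : G -> A) (h : G) : {ffun F -> A} :=
  [ffun f : F => x (h * val f)].

Definition is_sft (X : set (G -> A)) : Prop :=
  exists (F : {fset G}) (P : {set {ffun F -> A}}),
    X = [set x | forall h : G, local_pattern F x h \in P].

End subshifts_of_finite_type.

Definition admits_strongly_aperiodic_sft (G : groupType) : Prop :=
  exists (A : finType) (X : set (G -> A)),
    [/\ is_sft X, X !=set0 & strongly_aperiodic X].

Definition unit_interval (R : realType) : Type :=
  set_type `[0%R : R, 1%R]%classic.

Section unit_interval.
Variable R : realType.

HB.instance Definition _ :=
  Topological.copy (unit_interval R) (set_type `[0%R : R, 1%R]%classic).

(* The retraction of the line onto [0, 1]: clamping lets affine
   reparametrizations be written without range proofs. *)
Definition to_unit (t : R) : unit_interval R.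
Proof.
exists (Num.max 0 (Num.min 1 t)).
by rewrite inE /= in_itv /= le_max lexx /= ge_max ler01 ge_min lexx.
Defined.

Lemma zero_neq_one_unit : to_unit 0 != to_unit 1.
Proof.
apply/eqP => /(congr1 val) /=.
rewrite (min_idPr ler01) (min_idPl (lexx _)) maxxx (max_idPr ler01) => /eqP.
by rewrite eq_sym oner_eq0.
Qed.

HB.instance Definition _ :=
  isBiPointed.Build (unit_interval R) zero_neq_one_unit.

End unit_interval.


Section unit_interval_theory.
Context {R : realType}.
Implicit Types (t : unit_interval R) (a : R).

Lemma unit_val_itv t : 0 <= val t <= 1.
Proof. by have := set_mem (valP t); rewrite /= in_itv. Qed.

Lemma to_unitE a : 0 <= a <= 1 -> val (to_unit a) = a.
Proof. by case/andP=> a0 a1; rewrite /= (min_idPr a1) (max_idPr a0). Qed.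

Lemma to_unitK t : to_unit (val t) = t.
Proof. by apply/val_inj/to_unitE/unit_val_itv. Qed.

Lemma to_unit_ge1 a : 1 <= a -> to_unit a = one.
Proof. by move=> a1; apply/val_inj; rewrite /= (min_idPl a1) minxx. Qed.

Lemma to_unit_le0 a : a <= 0 -> to_unit a = zero.
Proof.
move=> a0; apply/val_inj => /=; rewrite (min_idPr (le_trans a0 ler01)).
by rewrite (max_idPl a0) (min_idPr ler01) maxxx.
Qed.

Lemma val_zero : val (zero : unit_interval R) = 0.
Proof. by rewrite to_unitE // lexx ler01. Qed.

Lemma val_one : val (one : unit_interval R) = 1.
Proof. by rewrite to_unitE // lexx ler01. Qed.

Lemma unit_val_continuous : continuous (val : unit_interval R -> R).
Proof. exact: initial_continuous. Qed.

Lemma max_real_continuous (Z : topologicalType) (f g : Z -> R) :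
  continuous f -> continuous g -> continuous (fun z => Num.max (f z) (g z)).
Proof. by move=> cf cg z; exact: (continuous_max (cf z) (cg z)). Qed.

Lemma min_real_continuous (Z : topologicalType) (f g : Z -> R) :
  continuous f -> continuous g -> continuous (fun z => Num.min (f z) (g z)).
Proof. by move=> cf cg z; exact: (continuous_min (cf z) (cg z)). Qed.

Lemma to_unit_continuous (Z : topologicalType) (f : Z -> R) :
  continuous f -> continuous (fun z => to_unit (f z)).
Proof.
move=> cf; apply: (@continuous_comp_initial _ Z R set_val (fun z => to_unit (f z))).
apply: (max_real_continuous (f := fun=> 0)) => [z|]; first exact: cvg_cst.
by apply: (min_real_continuous (f := fun=> 1)) => [z|//]; exact: cvg_cst.
Qed.

Lemma comp_to_unit_continuous (Z X : topologicalType) (f : Z -> R)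
    (p : unit_interval R -> X) :
  continuous f -> continuous p -> continuous (fun z => p (to_unit (f z))).
Proof.
move=> cf cp z; apply: (@continuous_comp _ _ _ (fun z => to_unit (f z)) p).
  exact: to_unit_continuous.
exact: cp.
Qed.

Lemma mull_continuous (Z : topologicalType) (f : Z -> R) a :
  continuous f -> continuous (fun z => a * f z).
Proof. by move=> cf z; apply: cvgM; [exact: cvg_cst | exact: cf]. Qed.

Lemma subr_continuous (Z : topologicalType) (f : Z -> R) a :
  continuous f -> continuous (fun z => f z - a).
Proof. by move=> cf z; apply: cvgB; [exact: cf | exact: cvg_cst]. Qed.

Lemma subl_continuous (Z : topologicalType) (f : Z -> R) a :
  continuous f -> continuous (fun z => a - f z).
Proof. by move=> cf z; apply: cvgB; [exact: cvg_cst | exact: cf]. Qed.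

Lemma paste_continuous (Z X : topologicalType) (h : Z -> R) (F G : Z -> X) a :
  continuous h -> continuous F -> continuous G ->
  (forall z, h z = a -> F z = G z) ->
  continuous (fun z => if h z <= a then F z else G z).
Proof.
move=> ch cF cG FG; apply/continuous_subspace_setT.
have -> : [set: Z] = [set z | h z <= a] `|` [set z | a <= h z].
  apply/seteqP; split=> // z _ /=.
  by case: (leP (h z) a) => [|/ltW]; [left | right].
apply: withinU_continuous.
- exact: (preimage_closed (in1W ch) (@closed_le _ a)).
- exact: (preimage_closed (in1W ch) (@closed_ge _ a)).
- apply: (@subspace_eq_continuous _ _ _ F); last exact: continuous_subspaceT.
  by move=> z /set_mem /= za; rewrite /from_subspace /= za.
- apply: (@subspace_eq_continuous _ _ _ G); last exact: continuous_subspaceT.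
  move=> z /set_mem /= az; rewrite /from_subspace /=; case: ifPn => // za.
  by apply/esym/FG/eqP; rewrite eq_le za az.
Qed.

End unit_interval_theory.

Section path_homotopy.
Context {R : realType} {X : topologicalType}.
Local Notation I := (unit_interval R).

(* Homotopy relative to the endpoints; the first coordinate of the square is
   the time of the homotopy. *)
Definition path_homotopic (x y : X) (p q : {path I from x to y in X}) : Prop :=
  exists H : I * I -> X,
    [/\ continuous H,
        forall t, H (zero, t) = p t,
        forall t, H (one, t) = q t,
        forall s, H (s, zero) = x &
        forall s, H (s, one) = y].

Section concat.
Variables (x y z : X).
Variables (p : {path I from x to y in X}) (q : {path I from y to z in X}).

Definition path_concat (t : I) : X :=
  if val t <= 2^-1 then p (to_unit (2 * val t))
  else q (to_unit (2 * val t - 1)).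

Let path_concat_continuous : continuous path_concat.
Proof.
apply: paste_continuous; first exact: unit_val_continuous.
- apply: comp_to_unit_continuous; last exact: cts_fun.
  by apply: mull_continuous; exact: unit_val_continuous.
- apply: comp_to_unit_continuous; last exact: cts_fun.
  by apply/subr_continuous/mull_continuous; exact: unit_val_continuous.
- move=> t ->; rewrite divff ?pnatr_eq0 // subrr.
  by rewrite (@to_unit_ge1 _ 1) // (@to_unit_le0 _ 0) // path_one path_zero.
Qed.

Let path_concat_zero : path_concat zero = x.
Proof.
rewrite /path_concat val_zero invr_ge0 ler0n mulr0.
by rewrite to_unit_le0 // path_zero.
Qed.

Let path_concat_one : path_concat one = z.
Proof.
rewrite /path_concat val_one leNgt invf_lt1 ?ltr1n //= mulr1.
by rewrite to_unit_ge1; [exact: path_one | lra].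
Qed.

HB.instance Definition _ :=
  isContinuous.Build _ _ path_concat path_concat_continuous.
HB.instance Definition _ :=
  isPath.Build I X x z path_concat path_concat_zero path_concat_one.

End concat.

Section reverse.
Variables (x y : X) (p : {path I from x to y in X}).

Definition path_reverse (t : I) : X := p (to_unit (1 - val t)).

Let path_reverse_continuous : continuous path_reverse.
Proof.
apply: comp_to_unit_continuous; last exact: cts_fun.
by apply: subl_continuous; exact: unit_val_continuous.
Qed.

Let path_reverse_zero : path_reverse zero = y.
Proof. by rewrite /path_reverse val_zero subr0 to_unit_ge1 // path_one. Qed.

Let path_reverse_one : path_reverse one = x.
Proof. by rewrite /path_reverse val_one subrr to_unit_le0 // path_zero. Qed.

HB.instance Definition _ :=
  isContinuous.Build _ _ path_reverse path_reverse_continuous.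
HB.instance Definition _ :=
  isPath.Build I X y x path_reverse path_reverse_zero path_reverse_one.

End reverse.

Local Notation "p ** q" :=
  (path_concat p q : {path I from _ to _ in X}) (at level 40).
Local Notation "p ~~ q" := (path_homotopic p q) (at level 70).

Lemma path_homotopic_refl x y (p : {path I from x to y in X}) : p ~~ p.
Proof.
exists (fun st => p st.2); split=> //= [st|_|_]; last 2 first.
- exact: path_zero.
- exact: path_one.
by apply: (@continuous_comp _ _ _ snd p); [exact: cvg_snd | exact: cts_fun].
Qed.

Lemma fst_val_continuous : continuous (fun st : I * I => val st.1).
Proof.
move=> st; apply: (@continuous_comp (I * I)%type I R fst val); first exact: cvg_fst.
exact: unit_val_continuous.
Qed.

Lemma snd_val_continuous : continuous (fun st : I * I => val st.2).
Proof.
move=> st; apply: (@continuous_comp (I * I)%type I R snd val); first exact: cvg_snd.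
exact: unit_val_continuous.
Qed.

Lemma square_to_unit_continuous (f g : I * I -> R) (H : I * I -> X) :
  continuous f -> continuous g -> continuous H ->
  continuous (fun st => H (to_unit (f st), to_unit (g st))).
Proof.
move=> cf cg cH st.
apply: (@continuous_comp _ _ _ (fun st => (to_unit (f st), to_unit (g st))) H).
  exact: cvg_pair (to_unit_continuous cf (x := st)) (to_unit_continuous cg (x := st)).
exact: cH.
Qed.

Lemma path_homotopic_sym x y (p q : {path I from x to y in X}) : p ~~ q -> q ~~ p.
Proof.
case=> H [cH Hp Hq H0 H1].
exists (fun st => H (to_unit (1 - val st.1), to_unit (val st.2))).
split=> [|t|t|s|s]; cbn [fst snd].
- apply: square_to_unit_continuous => //; last exact: snd_val_continuous.
  by apply: subl_continuous; exact: fst_val_continuous.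
- by rewrite val_zero subr0 to_unitK to_unit_ge1.
- by rewrite val_one subrr to_unitK to_unit_le0.
- by rewrite to_unitK.
- by rewrite to_unitK.
Qed.

Lemma path_homotopic_trans x y (p q r : {path I from x to y in X}) :
  p ~~ q -> q ~~ r -> p ~~ r.
Proof.
case=> H [cH Hp Hq H0 H1] [K [cK Kq Kr K0 K1]].
exists (fun st => if val st.1 <= 2^-1
  then H (to_unit (2 * val st.1), to_unit (val st.2))
  else K (to_unit (2 * val st.1 - 1), to_unit (val st.2))).
split=> [|t|t|s|s]; cbn [fst snd].
- apply: paste_continuous; first exact: fst_val_continuous.
  + apply: square_to_unit_continuous => //; last exact: snd_val_continuous.
    by apply: mull_continuous; exact: fst_val_continuous.
  + apply: square_to_unit_continuous => //; last exact: snd_val_continuous.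
    by apply/subr_continuous/mull_continuous; exact: fst_val_continuous.
  + move=> st ->; rewrite divff ?pnatr_eq0 // subrr.
    by rewrite (@to_unit_ge1 _ 1) // (@to_unit_le0 _ 0) // Hq Kq.
- by rewrite val_zero invr_ge0 ler0n mulr0 to_unit_le0 // to_unitK.
- rewrite val_one leNgt invf_lt1 ?ltr1n //= mulr1 to_unitK.
  by rewrite to_unit_ge1; [exact: Kr | lra].
- by rewrite to_unitK H0 K0; case: ifP.
- by rewrite to_unitK H1 K1; case: ifP.
Qed.

Lemma path_concat_homotopic x y z (p p' : {path I from x to y in X})
    (q q' : {path I from y to z in X}) :
  p ~~ p' -> q ~~ q' -> (p ** q) ~~ (p' ** q').
Proof.
case=> H [cH Hp Hq H0 H1] [K [cK Kq Kr K0 K1]].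
exists (fun st => if val st.2 <= 2^-1
  then H (to_unit (val st.1), to_unit (2 * val st.2))
  else K (to_unit (val st.1), to_unit (2 * val st.2 - 1))).
split=> [|t|t|s|s]; cbn [fst snd].
- apply: paste_continuous; first exact: snd_val_continuous.
  + apply: square_to_unit_continuous => //; first exact: fst_val_continuous.
    by apply: mull_continuous; exact: snd_val_continuous.
  + apply: square_to_unit_continuous => //; first exact: fst_val_continuous.
    by apply/subr_continuous/mull_continuous; exact: snd_val_continuous.
  + move=> st ->; rewrite divff ?pnatr_eq0 // subrr.
    by rewrite (@to_unit_ge1 _ 1) // (@to_unit_le0 _ 0) // H1 K0.
- by rewrite to_unitK Hp Kq.
- by rewrite to_unitK Hq Kr.
- by rewrite to_unitK val_zero invr_ge0 ler0n mulr0 to_unit_le0.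
- rewrite to_unitK val_one leNgt invf_lt1 ?ltr1n //= mulr1.
  by rewrite to_unit_ge1; [exact: K1 | lra].
Qed.

Lemma path_reverse_homotopic x y (p q : {path I from x to y in X}) :
  p ~~ q -> (path_reverse p : {path I from _ to _ in X}) ~~ path_reverse q.
Proof.
case=> H [cH Hp Hq H0 H1].
exists (fun st => H (to_unit (val st.1), to_unit (1 - val st.2))).
split=> [|t|t|s|s]; cbn [fst snd].
- apply: square_to_unit_continuous => //; first exact: fst_val_continuous.
  by apply: subl_continuous; exact: snd_val_continuous.
- by rewrite to_unitK Hp.
- by rewrite to_unitK Hq.
- by rewrite to_unitK val_zero subr0 to_unit_ge1.
- by rewrite to_unitK val_one subrr to_unit_le0.
Qed.

Lemma path_homotopic_param x y u v (p : {path I from x to y in X})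
    (q r : {path I from u to v in X})
    (f g : R -> R) :
  continuous f -> continuous g -> f 0 = g 0 -> f 1 = g 1 ->
  (forall t : I, q t = p (to_unit (f (val t)))) ->
  (forall t : I, r t = p (to_unit (g (val t)))) ->
  q ~~ r.
Proof.
move=> cf cg fg0 fg1 qE rE.
exists (fun st => p (to_unit
  ((1 - val st.1) * f (val st.2) + val st.1 * g (val st.2)))).
split=> [st|t|t|s|s]; cbn [fst snd].
- move: st; apply: comp_to_unit_continuous; last exact: cts_fun.
  move=> st.
  apply: cvgD; apply: cvgM; [apply: cvgB; first exact: cvg_cst| | |].
  + exact: fst_val_continuous.
  + by apply: continuous_comp; [exact: snd_val_continuous | exact: cf].
  + exact: fst_val_continuous.
  + by apply: continuous_comp; [exact: snd_val_continuous | exact: cg].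
- by rewrite val_zero subr0 mul1r mul0r addr0 qE.
- by rewrite val_one subrr mul1r mul0r add0r rE.
- rewrite val_zero -fg0 -mulrDl subrK mul1r.
  by rewrite -val_zero -qE path_zero.
- rewrite val_one -fg1 -mulrDl subrK mul1r.
  by rewrite -val_one -qE path_one.
Qed.

Lemma path_concat_to_unit x y z (p : {path I from x to y in X})
    (q : {path I from y to z in X}) (a : R) :
  (p ** q) (to_unit a) =
    if a <= 2^-1 then p (to_unit (2 * a)) else q (to_unit (2 * a - 1)).
Proof.
case: (leP a 0) => [a0|a0].
  rewrite (@to_unit_le0 _ a) // path_zero; case: leP => [_|?]; last by exfalso; lra.
  by rewrite to_unit_le0; [rewrite path_zero | lra].
case: (leP a 1) => [a1|a1].
  by rewrite /= /path_concat to_unitE // a1 ltW.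
rewrite (@to_unit_ge1 _ a (ltW a1)) path_one; case: leP => [?|_]; first by exfalso; lra.
by rewrite to_unit_ge1; [rewrite path_one | lra].
Qed.

Lemma path_concatE x y z (p : {path I from x to y in X})
    (q : {path I from y to z in X}) (t : I) : (p ** q) t =
  if val t <= 2^-1 then p (to_unit (2 * val t)) else q (to_unit (2 * val t - 1)).
Proof. by []. Qed.

Lemma path_reverse_to_unit x y (p : {path I from x to y in X}) (a : R) :
  (path_reverse p : {path I from y to x in X}) (to_unit a) = p (to_unit (1 - a)).
Proof.
case: (leP a 0) => [a0|a0].
  rewrite (@to_unit_le0 _ a) // path_zero to_unit_ge1; first by rewrite path_one.
  by lra.
case: (leP a 1) => [a1|a1]; first by rewrite /= /path_reverse to_unitE // a1 ltW.
rewrite (@to_unit_ge1 _ a (ltW a1)) path_one to_unit_le0; first by rewrite path_zero.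
by lra.
Qed.

Definition cst_path (x : X) : {path I from x to x in X} := cst x.

Lemma id_real_continuous : continuous (fun a : R => a).
Proof. by move=> a; exact: cvg_id. Qed.

Lemma path_concatA x y z w (p : {path I from x to y in X})
    (q : {path I from y to z in X}) (r : {path I from z to w in X}) :
  (p ** (q ** r)) ~~ ((p ** q) ** r).
Proof.
apply: path_homotopic_sym.
pose f (a : R) := Num.min (2 * a) (Num.min (a + 4^-1) (2^-1 * a + 2^-1)).
have fE a : f a = if a <= 4^-1 then 2 * a
                  else if a <= 2^-1 then a + 4^-1 else 2^-1 * a + 2^-1.
  rewrite /f !minEle; case: (leP (a + 4^-1) (2^-1 * a + 2^-1)) => ?;
    by do ![case: leP => ?]; lra.
apply: (@path_homotopic_param _ _ _ _ (p ** (q ** r)) _ _ f (fun a => a)).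
- apply: min_real_continuous; first exact/mull_continuous/id_real_continuous.
  apply: min_real_continuous => a; apply: cvgD; try exact: cvg_cst.
    exact: id_real_continuous.
  by apply: mull_continuous; exact: id_real_continuous.
- exact: id_real_continuous.
- by rewrite fE; do ![case: leP => ?]; lra.
- by rewrite fE; do ![case: leP => ?]; lra.
- move=> t; rewrite path_concatE !path_concat_to_unit fE.
  move: (val t) => a; case: (leP a 4^-1) => ?; case: (leP a 2^-1) => ?;
    do ![case: leP => ?]; try (by exfalso; lra);
    by congr (_ (to_unit _)); lra.
- by move=> t; rewrite to_unitK.
Qed.

Lemma path_concat1p x y (p : {path I from x to y in X}) :
  (cst_path x ** p) ~~ p.
Proof.
apply: (@path_homotopic_param _ _ _ _ p _ _
  (fun a => Num.max 0 (2 * a - 1)) (fun a => a)).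
- apply: max_real_continuous; first by move=> a; exact: cvg_cst.
  exact/subr_continuous/mull_continuous/id_real_continuous.
- exact: id_real_continuous.
- by rewrite maxEle /=; case: leP => ?; lra.
- by rewrite maxEle /=; case: leP => ?; lra.
- move=> t; rewrite path_concatE maxEle; move: (val t) => a.
  do ![case: leP => ?]; try (by exfalso; lra).
  + transitivity (p zero); first exact/esym/path_zero.
    by rewrite to_unit_le0 //; lra.
  + transitivity (p zero); first exact/esym/path_zero.
    by rewrite to_unit_le0 //; lra.
  + by [].
- by move=> t; rewrite to_unitK.
Qed.

Lemma path_concatp1 x y (p : {path I from x to y in X}) :
  (p ** cst_path y) ~~ p.
Proof.
apply: (@path_homotopic_param _ _ _ _ p _ _
  (fun a => Num.min 1 (2 * a)) (fun a => a)).
- apply: min_real_continuous; first by move=> a; exact: cvg_cst.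
  exact/mull_continuous/id_real_continuous.
- exact: id_real_continuous.
- by rewrite minEle /=; case: leP => ?; lra.
- by rewrite minEle /=; case: leP => ?; lra.
- move=> t; rewrite path_concatE minEle; move: (val t) => a.
  do ![case: leP => ?]; try (by exfalso; lra).
  + by congr (_ (to_unit _)); lra.
  + by [].
  + transitivity (p one); first exact/esym/path_one.
    by rewrite to_unit_ge1.
- by move=> t; rewrite to_unitK.
Qed.

Lemma path_concatpV x y (p : {path I from x to y in X}) :
  (p ** path_reverse p) ~~ cst_path x.
Proof.
apply: (@path_homotopic_param _ _ _ _ p _ _
  (fun a => Num.min (2 * a) (2 - 2 * a)) (fun=> 0)).
- apply: min_real_continuous; first exact/mull_continuous/id_real_continuous.
  exact/subl_continuous/mull_continuous/id_real_continuous.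
- by move=> a; exact: cvg_cst.
- by rewrite minEle /=; case: leP => ?; lra.
- by rewrite minEle /=; case: leP => ?; lra.
- move=> t; rewrite path_concatE path_reverse_to_unit minEle; move: (val t) => a.
  do ![case: leP => ?]; try (by exfalso; lra);
    by congr (_ (to_unit _)); lra.
- by move=> t; rewrite to_unit_le0 //; exact/esym/path_zero.
Qed.

Lemma path_concatVp x y (p : {path I from x to y in X}) :
  (path_reverse p ** p) ~~ cst_path y.
Proof.
apply: (@path_homotopic_param _ _ _ _ p _ _
  (fun a => Num.max (1 - 2 * a) (2 * a - 1)) (fun=> 1)).
- apply: max_real_continuous.
    exact/subl_continuous/mull_continuous/id_real_continuous.
  exact/subr_continuous/mull_continuous/id_real_continuous.
- by move=> a; exact: cvg_cst.
- by rewrite maxEle /=; case: leP => ?; lra.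
- by rewrite maxEle /=; case: leP => ?; lra.
- move=> t; rewrite path_concatE path_reverse_to_unit maxEle; move: (val t) => a.
  do ![case: leP => ?]; try (by exfalso; lra);
    by congr (_ (to_unit _)); lra.
- by move=> t; rewrite to_unit_ge1 //; exact/esym/path_one.
Qed.

End path_homotopy.

Section fundamental_group.
Variables (R : realType) (X : topologicalType) (x0 : X).
Local Notation loop := {path unit_interval R from x0 to x0 in X}.

Definition loop_homotopic : rel loop := fun p q => `[< path_homotopic p q >].

Lemma loop_homotopic_refl : reflexive loop_homotopic.
Proof. by move=> p; apply/asboolP/path_homotopic_refl. Qed.

Lemma loop_homotopic_sym : symmetric loop_homotopic.
Proof. by move=> p q; apply: asbool_equiv_eq; split=> /path_homotopic_sym. Qed.

Lemma loop_homotopic_trans : transitive loop_homotopic.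
Proof.
move=> q p r /asboolP pq /asboolP qr.
by apply/asboolP/(path_homotopic_trans pq).
Qed.

Canonical loop_homotopic_equiv :=
  EquivRel loop_homotopic loop_homotopic_refl loop_homotopic_sym loop_homotopic_trans.

Definition fundamental_group : Type := {eq_quot loop_homotopic_equiv}.

HB.instance Definition _ :=
  Choice.copy fundamental_group {eq_quot loop_homotopic_equiv}.

Definition loop_class (p : loop) : fundamental_group :=
  \pi_({eq_quot loop_homotopic_equiv}) p.

Lemma loop_classP (p q : loop) : loop_class p = loop_class q <-> path_homotopic p q.
Proof. by split=> [/eqmodP/asboolP | ?]; last exact/eqmodP/asboolP. Qed.

Let rep (a : fundamental_group) : loop :=
  repr (a : {eq_quot loop_homotopic_equiv}).

Let repK a : loop_class (rep a) = a.
Proof. exact: reprK. Qed.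

Let rep_loop_class p : path_homotopic (rep (loop_class p)) p.
Proof. by apply/loop_classP; exact: repK. Qed.

Definition fundamental_group_mul (a b : fundamental_group) : fundamental_group :=
  loop_class (path_concat (rep a) (rep b)).

Definition fundamental_group_one : fundamental_group := loop_class (cst_path x0).

Definition fundamental_group_inv (a : fundamental_group) : fundamental_group :=
  loop_class (path_reverse (rep a)).

Lemma loop_class_concat (p q : loop) :
  fundamental_group_mul (loop_class p) (loop_class q) = loop_class (path_concat p q).
Proof. by apply/loop_classP/path_concat_homotopic; exact: rep_loop_class. Qed.

Lemma loop_class_reverse (p : loop) :
  fundamental_group_inv (loop_class p) = loop_class (path_reverse p).
Proof. by apply/loop_classP/path_reverse_homotopic; exact: rep_loop_class. Qed.

Let mulA : associative fundamental_group_mul.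
Proof.
move=> a b c; rewrite -(repK a) -(repK b) -(repK c) !loop_class_concat.
exact/loop_classP/path_concatA.
Qed.

Let mul1 : left_id fundamental_group_one fundamental_group_mul.
Proof.
by move=> a; rewrite -(repK a) loop_class_concat; exact/loop_classP/path_concat1p.
Qed.

Let mulx1 : right_id fundamental_group_one fundamental_group_mul.
Proof.
by move=> a; rewrite -(repK a) loop_class_concat; exact/loop_classP/path_concatp1.
Qed.

Let mulV : left_inverse fundamental_group_one fundamental_group_inv fundamental_group_mul.
Proof.
move=> a; rewrite -(repK a) loop_class_reverse loop_class_concat.
exact/loop_classP/path_concatVp.
Qed.

Let mulxV : right_inverse fundamental_group_one fundamental_group_inv fundamental_group_mul.
Proof.
move=> a; rewrite -(repK a) loop_class_reverse loop_class_concat.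
exact/loop_classP/path_concatpV.
Qed.

HB.instance Definition _ :=
  isGroup.Build fundamental_group mulA mul1 mulx1 mulV mulxV.

End fundamental_group.

Section surface.
Variables (R : realType) (g : nat).

(* The genus g surface is the quotient of a 4g-gon, realized as the closed unit
   disk with its boundary circle cut into 4g equal arcs. *)
Definition closed_disk : Type :=
  set_type [set z : R * R | z.1 ^+ 2 + z.2 ^+ 2 <= 1].

HB.instance Definition _ :=
  Topological.copy closed_disk
    (set_type [set z : R * R | z.1 ^+ 2 + z.2 ^+ 2 <= 1]).

(* Point of parameter s in [0, 1] on the k-th side, counted and traversed
   counterclockwise from (1, 0). *)
Definition side (k : nat) (s : R) : R * R :=
  let theta := 2 * pi * (k%:R + s) / (4 * g)%:R in (cos theta, sin theta).

(* Sides 4i, 4i+1, 4i+2, 4i+3 are labelled a_i, b_i, a_i^-1, b_i^-1, so that the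
   boundary word is [a_0, b_0] ... [a_(g-1), b_(g-1)]; a side is glued to the one
   with the inverse label by an orientation-reversing identification. *)
Definition side_glued (z w : closed_disk) : Prop :=
  exists (i j : nat) (s : R),
    [/\ (i < g)%N, (j < 2)%N, 0 <= s <= 1,
        val z = side (4 * i + j) s & val w = side (4 * i + j + 2) (1 - s)].

Definition glued : rel closed_disk :=
  fun z w => `[< clos_refl_sym_trans _ side_glued z w >].

Lemma glued_refl : reflexive glued.
Proof. by move=> z; apply/asboolP/rst_refl. Qed.

Lemma glued_sym : symmetric glued.
Proof. by move=> z w; apply: asbool_equiv_eq; split; exact: rst_sym. Qed.

Lemma glued_trans : transitive glued.
Proof.
by move=> w z v /asboolP zw /asboolP wv; apply/asboolP/(rst_trans _ _ _ _ _ zw wv).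
Qed.

Canonical glued_equiv := EquivRel glued glued_refl glued_sym glued_trans.

Definition closed_orientable_surface : Type :=
  quotient_topology {eq_quot glued_equiv}.

HB.instance Definition _ :=
  Topological.copy closed_orientable_surface
    (quotient_topology {eq_quot glued_equiv}).

End surface.

(* Main.v *)
Require Import Defs.
From Stdlib Require Import Relation_Operators.
From Stdlib Require Setoid Morphisms.
From mathcomp Require Import all_boot all_order all_algebra generic_quotient.
From mathcomp Require Import finmap.
From mathcomp Require Import all_classical all_reals all_analysis.
From mathcomp Require Import homotopy.
From mathcomp Require Import zify ring lra.

Set Implicit Arguments.
Unset Strict Implicit.
Unset Printing Implicit Defensive.

Import Order.TTheory GRing.Theory Num.Theory.
Import numFieldTopology.Exports numFieldNormedType.Exports.

Local Open Scope classical_set_scope.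
Local Open Scope ring_scope.
Local Open Scope quotient_scope.

(* The surface is tiled by copies of a 4g-gon, one for each element of its
   fundamental group G, and crossing the sides gives generators s_j of G.  A
   configuration arranges the tiles in rows, each cell p having a row of children
   below it, so that the lengths attached to the cells are multiplied by lam from
   a row to the next, where lam + 1/lam = (4g - 2)^2 - 2.  Each cell also carries
   a positive number of marks, and the marks of the children of a row are, up to
   carries passed along the row, q times those of the row, with q a positive
   integer.  Hence the density of the marks is multiplied by q / lam from a row to
   the next, and a symmetry moving a row to another level would make a power of lam
   an integer, which it is not, lam being a unit other than 1.  A symmetry
   preserving the levels translates some row, and the translation is at least
   halved by passing to the parents; so it fixes a cell, and is trivial.

   Configurations exist on a concrete set V of addresses with bijections satisfying
   the relations of the side crossings: the marks are differences of integer parts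
   of multiples by alpha of the positions along a row, and alpha is multiplied by
   q / lam from a row to the next, where q is one of two consecutive integers,
   chosen so that alpha stays bounded.  They are pulled back to G along a map G -> V
   provided by the lifting of paths to the covering of the surface with fibre V.
   That the s_j generate G follows by cutting a path into pieces lying in open sets
   that contract onto the centre, the midpoints of the sides or the vertices of the
   polygon. *)

(** * Symmetries of self-similar rows *)

(** The factor lam is the dominant eigenvalue of the matrix counting the children of each type,
    where a cell is of one of two types: joined to its parent by an edge, or meeting it only at a
    vertex. This matrix has determinant 1, whence the unit; the lengths are the entries of an
    eigenvector. The pattern of the rows looks alike at all levels, so it gives no reason to exclude
    a symmetry changing the level: the marks are there for that. With a fixed q their density would
    tend to 0 or to infinity along the rows, lam being irrational, whereas a positive and bounded
    number of marks per cell confines it; so q has to vary with the row, and its constancy along a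
    row is a condition on neighbours.

    A local rule reads a configuration only along words in the side crossings. It therefore makes
    sense on any set on which they act with the relations of the surface, and passes to G through an
    equivariant map, injective or not. In place of a description of the universal cover, topology
    has to supply three facts: the relations hold in G, the crossings generate it, and it maps
    equivariantly to every such set. *)

Section orbit_graph.
Variables (R : realType) (H : Type) (r fst par gam : H -> H) (idx len a cr q : H -> nat).
Variables (ell : H -> R) (lam ell0 ell1 : R) (amax crmax : nat).

Hypothesis fst_r : forall p, fst (r p) = iter (len p) r (fst p).
Hypothesis len_gt1 : forall p, (1 < len p)%N.
Hypothesis idx_lt : forall h, (idx h < len (par h))%N.
Hypothesis idxK : forall h, iter (idx h) r (fst (par h)) = h.
Hypothesis par_child : forall p i, (i < len p)%N -> par (iter i r (fst p)) = p.
Hypothesis idx_child : forall p i, (i < len p)%N -> idx (iter i r (fst p)) = i.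

(** Entering a new parent adds 2 to [k'.*2] but resets the index from at least 1 to 0, so the sum
    grows by at most 1 per step. For a symmetry, which preserves indices, the two index terms cancel
    and the translation is halved. *)
Lemma par_idx_iter k h : exists2 k', par (iter k r h) = iter k' r (par h) &
  (idx (iter k r h) + k'.*2 <= idx h + k)%N.
Proof.
elim: k => [|k [k' Ek Hk]]; first by exists 0%N; rewrite //= !addn0.
set h' := iter k r h in Ek Hk *.
have := idx_lt h'; rewrite leq_eqVlt => /orP[/eqP lt|lt].
  have -> : iter k.+1 r h = fst (r (par h')).
    by rewrite iterS -/h' -{1}(idxK h') -iterS lt -fst_r.
  have l0 : (0 < len (r (par h')))%N by apply: ltn_trans (len_gt1 _).
  exists k'.+1; first by rewrite -[fst _]/(iter 0 r (fst _)) par_child // Ek.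
  rewrite -[X in idx X]/(iter 0 r (fst (r (par h')))) idx_child //.
  by have := len_gt1 (par h'); lia.
have E : iter k.+1 r h = iter (idx h').+1 r (fst (par h')).
  by rewrite iterS -/h' -{1}(idxK h').
exists k'; first by rewrite E par_child.
by rewrite E idx_child //; lia.
Qed.

Hypothesis gam_r : forall h, gam (r h) = r (gam h).
Hypothesis gam_fst : forall h, gam (fst h) = fst (gam h).
Hypothesis gam_len : forall h, len (gam h) = len h.
Hypothesis gam_a : forall h, a (gam h) = a h.
Hypothesis gam_ell : forall h, ell (gam h) = ell h.

Lemma gam_iter k h : gam (iter k r h) = iter k r (gam h).
Proof. by elim: k => //= k <-. Qed.

Lemma gam_par_idx h : gam (par h) = par (gam h) /\ idx (gam h) = idx h.
Proof.
have E : gam h = iter (idx h) r (fst (gam (par h))).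
  by rewrite -gam_fst -gam_iter idxK.
have lt : (idx h < len (gam (par h)))%N by rewrite gam_len.
by rewrite E par_child // idx_child.
Qed.

Lemma gam_par h : gam (par h) = par (gam h). Proof. by case: (gam_par_idx h). Qed.

Lemma gam_parn n h : gam (iter n par h) = iter n par (gam h).
Proof. by elim: n => //= n <-; rewrite gam_par. Qed.

(* A translation within a row induces a translation by at most half as many
   cells of the row of the parents. *)
Lemma row_translation_fix k u :
  gam u = iter k r u \/ u = iter k r (gam u) -> exists v, gam v = v.
Proof.
elim/ltn_ind: k u => -[|k] IH u; first by case=> /= E; exists u.
case=> E.
- have [k' Ek Hk] := par_idx_iter k.+1 u; rewrite -E in Ek Hk.
  rewrite (gam_par_idx u).2 in Hk.
  by apply: (IH k' _ (par u)); [lia | left; rewrite gam_par].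
- have [k' Ek Hk] := par_idx_iter k.+1 (gam u); rewrite -E in Ek Hk.
  rewrite (gam_par_idx u).2 in Hk.
  by apply: (IH k' _ (par u)); [lia | right; rewrite gam_par].
Qed.

Hypothesis lam_gt0 : 0 < lam.
Hypothesis lam_pow : forall j Q, (0 < j)%N -> lam ^+ j != Q%:R.
Hypothesis ell0_gt0 : 0 < ell0.
Hypothesis ell_bound : forall h, ell0 <= ell h <= ell1.
Hypothesis a_bound : forall h, (0 < a h <= amax)%N.
Hypothesis cr_bound : forall h, (cr h <= crmax)%N.
Hypothesis q_gt0 : forall h, (0 < q h)%N.
Hypothesis q_r : forall h, q (r h) = q h.
Hypothesis ell_children : forall p,
  \sum_(i < len p) ell (iter i r (fst p)) = lam * ell p.
Hypothesis a_children : forall p,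
  (\sum_(i < len p) a (iter i r (fst p)) + cr p = q p * a p + cr (r p))%N.

Let S u n := (\sum_(i < n) a (iter i r u))%N.
Let L u n : R := \sum_(i < n) ell (iter i r u).
Let descendants p n := (\sum_(i < n) len (iter i r p))%N.

Let ell_gt0 h : 0 < ell h.
Proof. by have /andP[+ _] := ell_bound h; apply: lt_le_trans. Qed.

Let ell1_gt0 (u : H) : 0 < ell1.
Proof. by have /andP[_] := ell_bound u; apply: lt_le_trans. Qed.

Lemma iter_descendants p n : iter (descendants p n) r (fst p) = fst (iter n r p).
Proof.
rewrite /descendants; elim: n => [|n IH]; first by rewrite big_ord0.
by rewrite big_ord_recr /= addnC iterD IH -fst_r.
Qed.

(** The carry leaving a family of children is the one entering the next, so only the two extreme
    carries remain. *)
Lemma S_descendants p n : (S (fst p) (descendants p n) + cr p =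
  q p * S p n + cr (iter n r p))%N.
Proof.
elim: n => [|n IH]; first by rewrite /S /descendants !big_ord0 muln0.
have qn : q (iter n r p) = q p by elim: (n) => //= m <-; rewrite q_r.
rewrite /S /descendants !big_ord_recr /= -/(descendants p n) big_split_ord /=.
under [X in (_ + X + _ = _)%N]eq_bigr do rewrite addnC iterD iter_descendants.
rewrite addnAC [X in (X + _)%N]IH -addnA [X in (_ + X)%N]addnC a_children qn.
by rewrite mulnDr addnA.
Qed.

Lemma L_descendants p n : L (fst p) (descendants p n) = lam * L p n.
Proof.
elim: n => [|n IH]; first by rewrite /L /descendants !big_ord0 mulr0.
rewrite /L /descendants !big_ord_recr /= -/(descendants p n) big_split_ord /=.
under [X in _ + X = _]eq_bigr do rewrite addnC iterD iter_descendants.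
by rewrite ell_children mulrDr; congr (_ + _); exact: IH.
Qed.

(** An upper bound of the asymptotic density of marks per length to the right of [u]. Working with
    the set of all such [d] involves no limit, and [C] absorbs carries, incomplete families and a
    shift of the origin. *)
Definition density_bound (u : H) (d : R) :=
  0 <= d /\ exists C : R, forall n, (S u n)%:R <= d * L u n + C.

Lemma density_bound_r u d : density_bound (r u) d <-> density_bound u d.
Proof.
have Sr n : (S u n.+1 = a u + S (r u) n)%N.
  by rewrite /S big_ord_recl /=; congr (_ + _)%N; apply: eq_bigr => i _; rewrite -iterSr.
have Lr n : L u n.+1 = ell u + L (r u) n.
  by rewrite /L big_ord_recl /=; congr (_ + _); apply: eq_bigr => i _; rewrite -iterSr.
split=> -[d0 [C HC]]; split=> //.
- exists (`|C| + (a u)%:R) => -[|n].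
    by rewrite /S /L !big_ord0 mulr0 add0r addr_ge0.
  rewrite Sr Lr natrD mulrDr; have := HC n; have := ler_norm C.
  by have := mulr_ge0 d0 (ltW (ell_gt0 u)); lra.
- exists (C + d * ell u) => n; have := HC n.+1.
  by rewrite Sr Lr natrD mulrDr; have := ler0n R (a u); lra.
Qed.

Lemma density_bound_iter k u d : density_bound (iter k r u) d <-> density_bound u d.
Proof. by elim: k => //= k <-; exact: density_bound_r. Qed.

Lemma density_bound_gam u d : density_bound (gam u) d <-> density_bound u d.
Proof.
have SE n : S (gam u) n = S u n.
  by apply: eq_bigr => i _; rewrite -gam_iter gam_a.
have LE n : L (gam u) n = L u n.
  by apply: eq_bigr => i _; rewrite -gam_iter gam_ell.
by split=> -[d0 [C HC]]; split=> //; exists C => n; have := HC n; rewrite SE LE.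
Qed.

(** Above, [n] cells; below, their [descendants p n] children, with [q p] times the marks up to two
    carries and exactly [lam] times the length. Towards the lower row, an arbitrary number [m] of
    cells is enclosed between two consecutive values of [descendants p], which costs one parent of
    length at most [ell1]. *)
Lemma density_bound_fst p d :
  density_bound (fst p) (d * (q p)%:R / lam) <-> density_bound p d.
Proof.
have qp : 0 < (q p)%:R :> R by rewrite ltr0n q_gt0.
have SE n : (S (fst p) (descendants p n))%:R + (cr p)%:R =
    (q p)%:R * (S p n)%:R + (cr (iter n r p))%:R :> R.
  by rewrite -natrD S_descendants natrD natrM.
have cE h : (cr h)%:R <= crmax%:R :> R by rewrite ler_nat.
split=> -[d0 [C HC]].
- split.
    by move: d0; rewrite -mulrA pmulr_lge0 ?divr_gt0.
  exists ((C + crmax%:R) / (q p)%:R) => n.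
  rewrite -(ler_pM2l qp) mulrDr [X in _ <= _ + X]mulrC divfK ?gt_eqF //.
  have := HC (descendants p n); rewrite L_descendants.
  rewrite mulrA divfK ?gt_eqF // => HCn.
  have := SE n; have := cE p; have := ler0n R (cr (iter n r p)).
  lra.
- split; first by rewrite divr_ge0 // ?mulr_ge0 // ltW.
  exists ((q p)%:R * C + crmax%:R + d * (q p)%:R * ell1) => m.
  have [n /andP[n1 n2]] : exists n, (descendants p n <= m < descendants p n.+1)%N.
    have dS n : (descendants p n < descendants p n.+1)%N.
      by rewrite /descendants big_ord_recr /= -addn1 leq_add2l ltnW.
    have dn n : (n <= descendants p n)%N.
      by elim: n => // n IH; apply: leq_ltn_trans IH (dS n).
    have := dn m.+1; move: {2}m.+1 => k.
    elim: k => [|k IH Hk]; first by rewrite /descendants big_ord0.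
    have [mk|mk] := leqP (m.+1) (descendants p k); first exact: IH.
    by exists k; rewrite Hk andbT.
  have Smono : (S (fst p) m)%:R <= (S (fst p) (descendants p n.+1))%:R :> R.
    rewrite ler_nat /S -(subnKC (ltnW n2)) big_split_ord /=.
    exact: leq_addr.
  have Lmono : L (fst p) (descendants p n) <= L (fst p) m.
    rewrite -(subnKC n1) {2}/L big_split_ord /= lerDl.
    by apply: sumr_ge0 => i _; exact: ltW.
  rewrite L_descendants in Lmono.
  have := HC n.+1; have := SE n.+1; have := cE (iter n.+1 r p).
  have := ler0n R (cr p).
  have -> : L p n.+1 = L p n + ell (iter n r p) by rewrite /L big_ord_recr.
  have /andP[_ e1] := ell_bound (iter n r p).
  move=> c0 c1 E HCn.
  have H1 := ler_wpM2l (ltW qp) HCn.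
  have H2 : d * (q p)%:R * L p n <= d * (q p)%:R / lam * L (fst p) m.
    by rewrite -!mulrA ler_wpM2l // ler_wpM2l ?(ltW qp) // ler_pdivlMl.
  have H3 := ler_wpM2l (mulr_ge0 d0 (ltW qp)) e1.
  nra.
Qed.

Lemma density_bound_par h d :
  density_bound h (d * (q (par h))%:R / lam) <-> density_bound (par h) d.
Proof.
apply: iff_trans (density_bound_fst _ _).
by rewrite -{1}(idxK h) density_bound_iter.
Qed.

Lemma density_bound_parn n h d :
  density_bound h (d * ((\prod_(i < n) q (iter i.+1 par h))%:R / lam ^+ n)) <->
  density_bound (iter n par h) d.
Proof.
elim: n d => [|n IH] d; first by rewrite big_ord0 expr0 divr1 mulr1.
rewrite iterS -density_bound_par -IH big_ord_recr /= natrM exprSr invfM.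
rewrite (_ : d * _ = d * (q (par (iter n par h)))%:R / lam *
  ((\prod_(i < n) q (par (iter i par h)))%:R / lam ^+ n)) //.
by ring.
Qed.

(** Each cell has at least one mark and length at most [ell1]; the positivity of the marks enters
    here. *)
Lemma density_bound_ge u d : density_bound u d -> ell1^-1 <= d.
Proof.
case=> d0 [C HC]; rewrite leNgt; apply/negP => dl.
have e1 := ell1_gt0 u.
have c0 : 0 < 1 - d * ell1 by rewrite subr_gt0 -ltr_pdivlMr // div1r.
pose n := (Num.truncn (`|C| / (1 - d * ell1))).+1.
have nC : `|C| / (1 - d * ell1) < n%:R by apply: truncnS_gt.
have Sn : n%:R <= (S u n)%:R :> R.
  rewrite ler_nat /S -[X in (X <= _)%N]card_ord -sum1_card; apply: leq_sum => i _.
  by have /andP[] := a_bound (iter i r u).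
have Ln : L u n <= ell1 * n%:R.
  rewrite /L mulr_natr -[X in _ *+ X]card_ord -sumr_const; apply: ler_sum => i _.
  by have /andP[] := ell_bound (iter i r u).
have := HC n; rewrite ltr_pdivrMr // in nC.
have := ler_wpM2l d0 Ln; have := ler_norm C; nra.
Qed.

Lemma density_bound_ex u : density_bound u (amax%:R / ell0).
Proof.
split; first by rewrite divr_ge0 // ltW.
exists 0 => n; rewrite addr0 mulrAC ler_pdivlMr //.
have Sn : (S u n)%:R <= amax%:R * n%:R :> R.
  rewrite -natrM ler_nat /S mulnC -[X in (X * _)%N]card_ord -sum_nat_const.
  by apply: leq_sum => i _; have /andP[] := a_bound (iter i r u).
have Ln : ell0 * n%:R <= L u n.
  rewrite /L mulr_natr -[X in _ *+ X]card_ord -sumr_const; apply: ler_sum => i _.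
  by have /andP[] := ell_bound (iter i r u).
apply: (@le_trans _ _ (amax%:R * n%:R * ell0)); first by rewrite ler_wpM2r // ltW.
by rewrite -mulrA ler_wpM2l // mulrC.
Qed.

(** The set of bounds is nonempty and bounded below by [ell1^-1 > 0]. A factor [k < 1] preserving it
    would, when iterated, bring an element below that level; the case [k > 1] is that of the inverse
    factor. *)
Lemma density_scaling_eq1 u (k : R) : 0 < k ->
  (forall d, density_bound u (d * k) <-> density_bound u d) -> k = 1.
Proof.
wlog k1 : k / k < 1 => [wlg|] k0 Hk.
  have [k1|k1|//] := ltgtP k 1; first exact: wlg.
  apply/eqP; rewrite -invr_eq1; apply/eqP/wlg; rewrite ?invr_gt0 ?invf_lt1 //.
  by move=> d; rewrite -[X in _ <-> density_bound u X](divfK (lt0r_neq0 k0)) Hk.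
have Hn n : density_bound u (amax%:R / ell0 * k ^+ n).
  elim: n => [|n IH]; first by rewrite expr0 mulr1; exact: density_bound_ex.
  by rewrite exprSr mulrA; apply/Hk.
have e1 := ell1_gt0 u.
set c := amax%:R / ell0 in Hn.
have c0 : 0 < c.
  by have := density_bound_ge (Hn 0%N); rewrite expr0 mulr1; apply: lt_le_trans; rewrite invr_gt0.
(* Bernoulli's inequality makes the bounds tend to 0 *)
have bern (x : R) n : 0 <= x -> 1 + n%:R * x <= (1 + x) ^+ n.
  move=> x0; elim: n => [|n IH]; first by rewrite expr0 mul0r addr0.
  have : 0 <= n%:R * x * x by rewrite !mulr_ge0.
  by have := ler_wpM2l (addr_ge0 ler01 x0) IH; rewrite exprS -natr1; lra.
pose x := k^-1 - 1.
have x0 : 0 < x by rewrite subr_gt0 invf_gt1.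
pose n := (Num.truncn (c * ell1 / x)).+1.
have nC : c * ell1 / x < n%:R by apply: truncnS_gt.
rewrite ltr_pdivrMr // in nC.
have := density_bound_ge (Hn n); have := bern x n (ltW x0).
have -> : 1 + x = k^-1 by rewrite /x addrC subrK.
move=> b; have kn := exprn_gt0 n k0.
rewrite -(ler_pM2r e1) mulVf ?gt_eqF // => H1.
have := ler_wpM2r (ltW kn) b.
rewrite exprVn mulVf ?gt_eqF //; nra.
Qed.

(** The two alternatives stand for an integer exponent of [r], for which no inverse is given. *)
Definition same_row u v := exists k, v = iter k r u \/ u = iter k r v.

Lemma density_bound_row u v d : same_row u v -> density_bound u d <-> density_bound v d.
Proof. by case=> k [->|->]; rewrite density_bound_iter. Qed.

(** The bounds at [gam u] are those at [u], and also those at the j-th ancestor, which are the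
    bounds at [u] rescaled by [lam ^+ j / Q], with [Q] the product of the multipliers crossed. Hence
    [lam ^+ j = Q], which is excluded. *)
Lemma gam_row_ancestor_level j u : (0 < j)%N ->
  same_row (gam u) (iter j par u) -> False.
Proof.
move=> j0 ur.
pose Q := (\prod_(i < j) q (iter i.+1 par u))%N.
have Q0 : (0 < Q)%N by apply: prodn_gt0 => i; exact: q_gt0.
have /density_scaling_eq1 : forall d, density_bound u (d * (Q%:R / lam ^+ j)) <-> density_bound u d.
  by move=> d; rewrite density_bound_parn -(density_bound_row _ ur) density_bound_gam.
rewrite divr_gt0 ?exprn_gt0 ?ltr0n // => /(_ isT) /(congr1 (fun x => x * lam ^+ j)).
rewrite mul1r divfK ?expf_neq0 ?gt_eqF // => E.
by have := lam_pow Q j0; rewrite E eqxx.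
Qed.

Lemma gam_row_level j u : (0 < j)%N ->
  same_row u (iter j par (gam u)) -> False.
Proof.
move=> j0 ur.
pose Q := (\prod_(i < j) q (iter i.+1 par (gam u)))%N.
have Q0 : (0 < Q)%N by apply: prodn_gt0 => i; exact: q_gt0.
have /density_scaling_eq1 : forall d,
    density_bound (gam u) (d * (Q%:R / lam ^+ j)) <-> density_bound (gam u) d.
  by move=> d; rewrite density_bound_parn -(density_bound_row _ ur) density_bound_gam.
rewrite divr_gt0 ?exprn_gt0 ?ltr0n // => /(_ isT) /(congr1 (fun x => x * lam ^+ j)).
rewrite mul1r divfK ?expf_neq0 ?gt_eqF // => E.
by have := lam_pow Q j0; rewrite E eqxx.
Qed.

Theorem orbit_graph_symmetry_fix u m n :
  same_row (iter m par u) (iter n par (gam u)) -> exists v, gam v = v.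
Proof.
have [mn|nm|<-] := ltngtP m n => ur.
- exfalso; apply: (@gam_row_level (n - m) (iter m par u)); first by rewrite subn_gt0.
  by rewrite gam_parn -iterD subnK // ltnW.
- exfalso; apply: (@gam_row_ancestor_level (m - n) (iter n par u)); first by rewrite subn_gt0.
  rewrite gam_parn -iterD subnK; last exact: ltnW.
  by case: ur => k [E|E]; exists k; [right|left].
- by case: ur => k Ek; apply: (@row_translation_fix k (iter m par u)); rewrite gam_parn; tauto.
Qed.

End orbit_graph.

(** * Local rules *)

Section surface_action.
Variables (N : nat) (io : 'Z_N -> 'Z_N).
Hypothesis N_gt7 : (7 < N)%N.
Local Notation pos := 'Z_N.
(** A tile left by its side [j] is followed by one entered by the side [io j]. Crossing next the
    side [io j + 1] keeps turning around the same vertex, the one between the sides [j - 1] and [j]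
    of the first tile. *)
Definition next_side (j : pos) := io j + 1.
Local Notation phi := next_side.
Hypothesis ioK : involutive io.
Hypothesis iter_phi : forall j, iter N phi j = j.

Fixpoint walk (V : Type) (act : V -> pos -> V) m j v :=
  if m is m'.+1 then act (walk act m' j v) (iter m' phi j) else v.

Definition surface_action (V : Type) (act : V -> pos -> V) :=
  (forall v j, act (act v j) (io j) = v) /\ (forall v j, walk act N j v = v).

(* A cell carries the position [th] of its right neighbour among its N
   neighbours; the pair (k, m) locating it among its siblings: it is the m-th
   cell to the right of the k-th child from the right joined to the parent by
   an edge; the multiplier (one of q0, q0 + 1) from its row to the next;
   its number of marks; and a carry. *)
Section config.
Variables (q0 M : nat).
Definition cell := (pos * ('I_N * 'I_N) * bool * ('I_M * 'I_M))%type.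

Variables (V : Type) (act : V -> pos -> V) (x : V -> cell).
Definition th v : pos := (x v).1.1.1.
Definition kk v : nat := (x v).1.1.2.1.
Definition mm v : nat := (x v).1.1.2.2.
Definition qq v : nat := (q0 + (x v).1.2)%N.
Definition aa v : nat := (x v).2.1.
Definition cc v : nat := (x v).2.2.

Definition has_up v := mm v == 0%N.
Definition ndown v := (N - 2 - has_up v)%N.
(** Of the N tiles around the vertex between the children [k] and [k - 1], there remain N - 3
    besides the parent and these two. For [k = 1] the right neighbour of the parent and the first
    child of that neighbour also have this vertex, which leaves N - 4. *)
Definition mmax k := (N - 3 - (k == 1%N))%N.
(** The sides of a cell come in the order right ([th]), children from right to left, left, and then,
    if there is one, the side towards the parent ([th - 1]). *)
Definition lpos v := th v - 1 - (has_up v)%:R.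
Definition right v := act v (th v).
Definition left v := act v (lpos v).
Definition up v := act v (th v - 1).
Definition down v k := act v (th v + k%:R).
Definition first_child v := down v (ndown v).
(** There are [ndown v] blocks of N - 2 cells, except that the last block, for [k = 1], is one cell
    short. *)
Definition nchildren v := ((N - 2) * ndown v).-1.

(** In [rule_a] the carry [cc v] belongs to the left end of [v]: it passes between the children of
    [left v] and those of [v]. *)
Record local_rule v : Prop := LocalRule {
  rule_k : (0 < kk v)%N;
  rule_m : (mm v <= mmax (kk v))%N;
  rule_th_right : th (right v) = phi (th v) + (has_up (right v))%:R;
  rule_q_right : qq (right v) = qq v;
  rule_mid : (mm v < mmax (kk v))%N ->
    kk (right v) = kk v /\ mm (right v) = (mm v).+1;
  rule_end : mm v = mmax (kk v) -> mm (right v) = 0%N;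
  rule_th_left : th (left v) = io (lpos v);
  rule_up : has_up v -> io (th v - 1) = th (up v) + (kk v)%:R /\ (kk v <= ndown (up v))%N;
  rule_down : forall k, (0 < k <= ndown v)%N ->
    [/\ mm (down v k) = 0%N, kk (down v k) = k & th (down v k) = phi (th v + k%:R)];
  rule_a : (\sum_(i < nchildren v) aa (iter i right (first_child v)) + cc v
    = qq v * aa v + cc (right v))%N;
  rule_a_gt0 : (0 < aa v)%N }.

End config.

Section orbit_graph_of_config.
Variables (q0 M : nat) (V : Type) (act : V -> pos -> V) (x : V -> cell M).
Hypothesis act_surface : surface_action act.
Hypothesis rules : forall v, local_rule q0 act x v.
Local Notation th := (th x).
Local Notation kk := (kk x).
Local Notation mm := (mm x).
Local Notation qq := (qq q0 x).
Local Notation has_up := (has_up x).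
Local Notation ndown := (ndown x).
Local Notation lpos := (lpos x).
Local Notation right := (right act x).
Local Notation left := (left act x).
Local Notation up := (up act x).
Local Notation down := (down act x).
Local Notation first_child := (first_child act x).
Local Notation nchildren := (nchildren x).

Let actK v j : act (act v j) (io j) = v. Proof. exact: act_surface.1. Qed.

Let NE : N%:R = 0 :> pos. Proof. by apply: pchar_Zp; lia. Qed.

Lemma rightK : cancel right left.
Proof.
move=> v; rewrite {1}/left /lpos (rule_th_right (rules v)).
by rewrite addrAC addrK /phi addrK; exact: actK.
Qed.

Lemma leftK : cancel left right.
Proof. by move=> v; rewrite {1}/right (rule_th_left (rules v)) actK. Qed.

(** A cell without an edge to its parent has its left and right sides adjacent, so moving right
    through such cells is turning around the vertex shared with the parent. *)
Lemma block p k m : (0 < k <= ndown p)%N -> (m <= mmax k)%N ->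
  let c := iter m right (down p k) in
  [/\ kk c = k, mm c = m, th c = iter m.+1 phi (th p + k%:R) &
      c = walk act m.+1 (th p + k%:R) p].
Proof.
move=> Hk; elim: m => [|m IH] Hm /=.
  by have [? ? ?] := rule_down (rules p) Hk.
have [E1 E2 E3 E4] := IH (ltnW Hm).
set c := iter m right (down p k) in E1 E2 E3 E4 *.
have Hc : (mm c < mmax (kk c))%N by rewrite E1 E2.
have [F1 F2] := rule_mid (rules c) Hc.
split; rewrite ?F1 ?F2 ?E2 //.
  by rewrite (rule_th_right (rules c)) /has_up F2 addr0 E3.
by rewrite {1}/right E3 {1}E4.
Qed.

(** Since the walk closes after N steps, its end can be read backwards from [p]: step N - 1 is the
    tile across the side [j - 1], that is the child [k - 1], or [right p] if [k = 1]. In the latter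
    case step N - 2 is the first child of [right p]. *)
Lemma block_end p k : (0 < k <= ndown p)%N ->
  iter (mmax k).+1 right (down p k) =
  if (k == 1)%N then first_child (right p) else down p k.-1.
Proof.
move=> Hk; have [_ _ E3 E4] := block Hk (leqnn _).
rewrite iterS {1}/right E3 {1}E4.
set j := th p + k%:R in E3 E4 *.
have {E3 E4} : act (walk act (mmax k).+1 j p) (iter (mmax k).+1 phi j) = walk act (mmax k).+2 j p by [].
move=> ->.
have k0 : (0 < k)%N by case/andP: Hk.
have NS : (N - 2).+2 = N by lia.
have W : walk act (N - 2).+2 j p = p by rewrite NS; exact: act_surface.2.
have P : iter (N - 2).+2 phi j = j by rewrite NS.
have P1 : io (iter (N - 2).+1 phi j) = j - 1.
  by rewrite -[in RHS]P [in RHS]iterS /phi addrK.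
have W1 : walk act (N - 2).+1 j p = act p (j - 1).
  by rewrite -P1 -[in RHS]W actK.
rewrite /mmax; case: eqP => [k1|k1].
  have -> : (N - 3 - true).+2 = (N - 2)%N by rewrite /=; lia.
  have -> : walk act (N - 2) j p = act (walk act (N-2).+1 j p) (io (iter (N-2) phi j)).
    by rewrite /= actK.
  rewrite W1 /j k1 addrK /first_child /down; congr act.
  have -> : io (iter (N - 2) phi (th p + 1%:R)) = io (th p) - 1.
    by have := congr1 io P1; rewrite ioK /j k1 addrK iterS => <-; rewrite /phi addrK.
  rewrite (rule_th_right (rules p)) /ndown /phi.
  set b := has_up _; rewrite !natrB ?NE; try by case: b => /=; lia.
  by ring.
have -> : (N - 3 - false).+2 = (N - 2).+1 by rewrite /=; lia.
rewrite W1 /j /down; congr act.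
by rewrite -{1}(prednK k0) -natr1 addrA addrK.
Qed.

Lemma down_ndown p d : (d < ndown p)%N ->
  iter ((N - 2) * d) right (first_child p) = down p (ndown p - d).
Proof.
elim: d => [|d IH] Hd; first by rewrite muln0 subn0.
rewrite mulnS iterD IH; last exact: ltnW.
have Hk : (0 < ndown p - d <= ndown p)%N by lia.
have := block_end Hk; rewrite /mmax.
have -> : (ndown p - d == 1)%N = false by apply/eqP; lia.
have -> : (N - 3 - false).+1 = (N - 2)%N by rewrite /=; lia.
by move=> ->; congr down; lia.
Qed.

Lemma ndown_gt1 p : (1 < ndown p)%N.
Proof. by rewrite /ndown; case: has_up => /=; lia. Qed.

Lemma right_first_child p : first_child (right p) = iter (nchildren p) right (first_child p).
Proof.
have D1 := ndown_gt1 p.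
have -> : nchildren p = (N - 3 + (N - 2) * (ndown p).-1)%N.
  rewrite /nchildren; case: (ndown p) D1 => // d _.
  by rewrite mulnS -pred_Sn; move: ((N - 2) * d)%N => e; lia.
rewrite iterD down_ndown; last by lia.
have -> : (ndown p - (ndown p).-1 = 1)%N by lia.
have := @block_end p 1; have -> : (mmax 1).+1 = (N - 3)%N by rewrite /mmax /=; lia.
by move=> ->; rewrite //=; lia.
Qed.

Lemma nchildren_gt1 p : (1 < nchildren p)%N.
Proof.
rewrite /nchildren; have := ndown_gt1 p; move: (ndown p) => d d1.
have := leq_mul (_ : 3 <= N - 2)%N d1; lia.
Qed.

(** Only the leftmost cell of a block shares an edge with the parent, hence the detour to the
    left. *)
Definition parent v := up (iter (mm v) left v).
Definition child_index v := ((N - 2) * (ndown (parent v) - kk v) + mm v)%N.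

Lemma left_mm v m : mm v = m.+1 -> mm (left v) = m /\ kk (left v) = kk v.
Proof.
move=> Em; have r := rules (left v).
have [lt|ge] := ltnP (mm (left v)) (mmax (kk (left v))).
  by have := rule_mid r lt; rewrite leftK Em => -[-> [<-]].
have /(rule_end r) : mm (left v) = mmax (kk (left v)).
  by apply/eqP; rewrite eqn_leq ge (rule_m r).
by rewrite leftK Em.
Qed.

Lemma iter_left_mm v i : (i <= mm v)%N ->
  mm (iter i left v) = (mm v - i)%N /\ kk (iter i left v) = kk v.
Proof.
elim: i => [|i IH] Hi; first by rewrite subn0.
have [E1 E2] := IH (ltnW Hi).
have [] := @left_mm (iter i left v) (mm v - i.+1); first by rewrite E1; lia.
by rewrite -E2.
Qed.

Lemma parentP v : v = iter (mm v) right (down (parent v) (kk v)) /\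
  (kk v <= ndown (parent v))%N.
Proof.
have [] := iter_left_mm (leqnn (mm v)); rewrite subnn /parent.
set c := iter _ _ _ => Em Ek.
have [U D] : io (th c - 1) = th (up c) + (kk v)%:R /\ (kk v <= ndown (up c))%N.
  by rewrite -Ek; apply: (rule_up (rules c)); rewrite /has_up Em.
split=> //; rewrite /down -U /up actK /c.
by elim: (mm v) => // m IH; rewrite iterSr [iter m.+1 left v]iterS leftK -IH.
Qed.

Lemma child_indexP v : iter (child_index v) right (first_child (parent v)) = v.
Proof.
have [E D] := parentP v; rewrite /child_index addnC iterD down_ndown.
  by rewrite subKn // -E.
have k0 := rule_k (rules v); have := ndown_gt1 (parent v); lia.
Qed.

Lemma child_index_lt v : (child_index v < nchildren (parent v))%N.
Proof.
have [E D] := parentP v; rewrite /child_index /nchildren.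
have := rule_m (rules v); have k0 := rule_k (rules v).
rewrite /mmax; move: (ndown _) (kk v) (mm v) D k0 => d k m D k0.
have -> : d = (d - k + k)%N by lia.
rewrite addnK mulnDr; case: eqP => [->|k1]; first by rewrite /=; lia.
rewrite /= subn0 => mN; have := leq_mul (leqnn (N - 2)) (_ : 2 <= k)%N; lia.
Qed.

(** Euclidean division of [i] by N - 2: the quotient counts the blocks from the left, the remainder
    is the place in the block. *)
Lemma child_coords p i : (i < nchildren p)%N ->
  let c := iter i right (first_child p) in
  [/\ parent c = p, child_index c = i & mm c = (i %% (N - 2))%N].
Proof.
move=> Hi c; have D1 := ndown_gt1 p.
have N2 : (0 < N - 2)%N by lia.
pose d := (i %/ (N - 2))%N; pose m := (i %% (N - 2))%N.
have Ei : i = (m + (N - 2) * d)%N by rewrite mulnC addnC -divn_eq.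
have Hm : (m < N - 2)%N by rewrite ltn_mod.
have Hd : (d < ndown p)%N.
  rewrite -(ltn_pmul2l N2); apply: leq_ltn_trans (_ : (N-2)*d <= i)%N _; first by lia.
  by apply: leq_trans Hi _; exact: leq_pred.
set k := (ndown p - d)%N.
have Hk : (0 < k <= ndown p)%N by rewrite /k; lia.
have Hmk : (m <= mmax k)%N.
  rewrite /mmax; case: eqP => [k1|_]; last by rewrite /=; lia.
  have dE : ndown p = d.+1 by move: k1; rewrite /k; lia.
  by move: Hi; rewrite Ei /nchildren dE mulnS /=; lia.
have Ec : c = iter m right (down p k) by rewrite /c Ei iterD down_ndown.
have [E1 E2 E3 E4] := block Hk Hmk; rewrite -Ec in E1 E2 E3 E4.
have P : parent c = p.
  rewrite /parent E2 Ec.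
  have -> : iter m left (iter m right (down p k)) = down p k.
    by elim: (m) => // m' IH; rewrite iterSr iterS rightK.
  by have [_ _ Et] := rule_down (rules p) Hk; rewrite {1}/up Et /phi addrK actK.
split=> //; rewrite /child_index P E1 E2 [RHS]Ei addnC; congr (_ + _ * _)%N.
by rewrite /k; lia.
Qed.

Lemma right_inj : injective right. Proof. exact: can_inj rightK. Qed.

Lemma iter_right_inj k : injective (iter k right).
Proof. by elim: k => // k IH u v /= /right_inj/IH. Qed.

Lemma same_row_sym u v : same_row right u v -> same_row right v u.
Proof. by case=> k E; exists k; tauto. Qed.

Lemma same_row_trans v u w : same_row right u v -> same_row right v w -> same_row right u w.
Proof.
have aux (u' w' : V) k l : iter k right u' = iter l right w' -> same_row right u' w'.
  move=> E; have [kl|/ltnW lk] := leqP k l.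
    exists (l - k)%N; right; apply: (@iter_right_inj k).
    by rewrite -iterD subnKC.
  exists (k - l)%N; left; apply: (@iter_right_inj l).
  by rewrite -iterD subnKC.
case=> k Ek [l El].
case: Ek => Ek; case: El => El.
- by exists (l + k)%N; left; rewrite iterD -Ek.
- by apply: (aux _ _ k l); rewrite -Ek.
- by apply: (aux _ _ l k); rewrite Ek El -!iterD addnC.
- by exists (k + l)%N; right; rewrite iterD -El.
Qed.

Lemma same_row_parent u v : same_row right u v -> same_row right (parent u) (parent v).
Proof.
have P k w : same_row right (parent w) (parent (iter k right w)).
  have [k' E _] := par_idx_iter right_first_child nchildren_gt1 child_index_lt
    child_indexP (fun p i Hi => (let: And3 E _ _ := child_coords Hi in E))
    (fun p i Hi => (let: And3 _ E _ := child_coords Hi in E)) k w.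
  by exists k'; left.
by case=> k [->|->]; [exact: P | apply/same_row_sym/P].
Qed.

Definition related u v := exists m n, same_row right (iter m parent u) (iter n parent v).

Lemma related_trans v u w : related u v -> related v w -> related u w.
Proof.
have P k a b : same_row right a b -> same_row right (iter k parent a) (iter k parent b).
  by elim: k => // k IH /IH /= /same_row_parent.
move=> [m [n H1]] [m' [n' H2]]; exists (m' + m)%N, (n + n')%N.
apply: (@same_row_trans (iter (m' + n) parent v)); first by rewrite !iterD; exact: P.
by rewrite addnC !iterD; exact: P.
Qed.

Lemma parent_down v k : (0 < k <= ndown v)%N -> parent (down v k) = v.
Proof.
move=> Hk; have [Em Ek Et] := rule_down (rules v) Hk.
by rewrite /parent Em /= {1}/up Et /phi addrK actK.
Qed.

Lemma same_row_refl u : same_row right u u. Proof. by exists 0%N; left. Qed.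

(** Crossing a side either stays in the row or passes to a parent or a child. Together with
    transitivity, any two tiles joined by a word have ancestors in a common row, which reduces a
    symmetry to its effect on rows. *)
Lemma related_act v j : related v (act v j).
Proof.
have [i Hi ->] : exists2 i, (i < N)%N & j = th v + i%:R.
  exists (j - th v : 'Z_N).
    have := ltn_ord (j - th v); rewrite [X in (_ < X)%N -> _]Zp_cast //; lia.
  by rewrite natr_Zp addrC subrK.
have [i0|i0] := posnP i.
  by exists 0%N, 0%N; exists 1%N; left; rewrite i0 addr0.
have [iD|Di] := leqP i (ndown v).
  exists 0%N, 1%N; rewrite /= parent_down ?i0 //; exact: same_row_refl.
have [iD|iD] := eqVneq i (ndown v).+1.
  exists 0%N, 0%N; exists 1%N; right; rewrite /= -[LHS]leftK; congr right.
  rewrite /left /lpos; congr act; rewrite iD /ndown.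
  set b := has_up v; have -> : (N - 2 - b).+1 = (N - b - 1)%N by case: (b) => /=; lia.
  by rewrite !natrB ?NE; try (by case: b => /=; lia); ring.
have [up_v iE] : has_up v /\ i = (N - 1)%N.
  by move: Di iD Hi; rewrite /ndown; case: has_up => /=; lia.
exists 1%N, 0%N; rewrite /= /parent (eqP up_v) /= iE natrB ?NE; last by lia.
rewrite sub0r; exact: same_row_refl.
Qed.

Lemma related_foldl v js : related v (foldl act v js).
Proof.
elim: js v => [|j js IH] v; first by exists 0%N, 0%N; exact: same_row_refl.
exact: related_trans (related_act v j) (IH _).
Qed.

(** * Cell lengths and the growth rate *)

Section density.
Variables (R : realType) (lam : R).
Hypothesis lam_gt1 : 1 < lam.
Hypothesis lamE : lam ^+ 2 = ((N - 2) ^ 2 - 2)%:R * lam - 1.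

(** The matrix counting children by type, with edge and without, has rows [N-3, (N-3)^2-1] for a
    cell with an edge to its parent and [N-2, (N-2)(N-3)-1] for the other cells. Its trace is
    [(N-2)^2-2] and its determinant 1, and [(ell_up, ell_mid)] is an eigenvector for [lam]. *)
Definition ell_up : R := (N - 4)%:R * (N - 2)%:R.
Definition ell_mid : R := lam - (N - 3)%:R.
Definition ell_block : R := ell_up + (N - 3)%:R * ell_mid.
Definition cell_length (b : bool) := if b then ell_up else ell_mid.

Lemma cell_length_eigen (b : bool) :
  lam * cell_length b = (N - 2 - b)%:R * ell_block - ell_mid.
Proof.
have n2 : (2 <= N)%N by lia.
have n3 : (3 <= N)%N by lia.
have n4 : (4 <= N)%N by lia.
have n22 : (2 <= (N - 2) ^ 2)%N by have := leq_sqr 2 (N - 2); lia.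
move: lamE; rewrite natrB // natrX expr2 => E.
rewrite natrB; last by case: b => /=; lia.
rewrite /cell_length /ell_block /ell_up /ell_mid !natrB //.
move: E; rewrite !natrB //; move: (N%:R : R) => n E.
by case: b => /=; rewrite ?mulr1n ?mulr0n; lra.
Qed.

(** With T the trace, the quadratic equation gives [lam * (lam - T + 1) = lam - 1 > 0], so
    [lam > T - 1]. *)
Lemma lam_gt_N : (N - 2)%:R < lam.
Proof.
have n3 : (3 <= N)%N by lia.
have : 0 < lam * (lam - ((N - 2) ^ 2 - 2)%:R + 1).
  have := lamE; rewrite expr2; set T := (_%:R); move: T => T E.
  by have := lam_gt1; nra.
rewrite (pmulr_rgt0 _ (lt_trans ltr01 lam_gt1)).
have : (N - 2)%:R + 1 <= ((N - 2) ^ 2 - 2)%:R :> R.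
  by rewrite natr1 ler_nat; have := leq_mul (_ : 3 <= N - 2)%N (leqnn (N - 2)); lia.
lra.
Qed.

Lemma ell_mid_ge1 : 1 <= ell_mid.
Proof.
have : (N - 3)%:R + 1 = (N - 2)%:R :> R by rewrite natr1; congr _%:R; lia.
by have := lam_gt_N; rewrite /ell_mid; lra.
Qed.

(* The conjugate of lam ^ j is its inverse, so lam ^ j is an algebraic unit. *)
Lemma lam_pow_not_nat j Q : (0 < j)%N -> lam ^+ j != Q%:R.
Proof.
move=> j0; have lam0 : 0 < lam by apply: lt_trans lam_gt1.
have tr : forall i, exists t t' : int,
    lam ^+ i + lam^-1 ^+ i = t%:~R /\ lam ^+ i.+1 + lam^-1 ^+ i.+1 = t'%:~R.
  have := lamE; set T := ((N - 2) ^ 2 - 2)%N => lE.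
  have E : lam + lam^-1 = T%:R.
    apply: (mulIf (lt0r_neq0 lam0)); rewrite mulrDl mulVf ?gt_eqF // -expr2 lE.
    by ring.
  elim=> [|i [t [t' [Et Et']]]].
    by exists 2, (Posz T); rewrite !expr0 !expr1 E; split.
  exists t', (Posz T * t' - t); split=> //.
  rewrite rmorphB rmorphM /= -Et -Et' -[(Posz T)%:~R]/(T%:R) -E !exprS.
  by field; rewrite gt_eqF.
apply/eqP => E; have [t [_ [Et _]]] := tr j.
have lj : 1 < lam ^+ j by rewrite exprn_egt1 // gt_eqF.
have Q1 : (1 < Q)%N by rewrite -(ltr_nat R) -E.
have Et' : (t - Posz Q)%:~R = lam ^- j.
  by rewrite rmorphB /= -Et -[(Posz Q)%:~R]/(Q%:R) -E exprVn addrAC subrr add0r.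
have : 0 < lam ^- j < 1 by rewrite invr_gt0 exprn_gt0 // invf_lt1 // exprn_gt0.
by rewrite -Et' ltr0z ltrz1; lia.
Qed.

(** The types of the children have period N - 2 along the row. Complete blocks would give one cell
    more, of type [ell_mid], which is the term subtracted in [cell_length_eigen]. *)
Lemma cell_length_children p :
  \sum_(i < nchildren p) cell_length (has_up (iter i right (first_child p))) =
  lam * cell_length (has_up p).
Proof.
pose f i := cell_length (i %% (N - 2) == 0)%N.
transitivity (\sum_(i < nchildren p) f i).
  by apply: eq_bigr => i _; have [_ _ E] := child_coords (ltn_ord i); rewrite /has_up E.
have block_sum d : \sum_(i < (N - 2) * d) f i = d%:R * ell_block.
  elim: d => [|d IH]; first by rewrite muln0 big_ord0 mul0r.
  rewrite mulnS addnC big_split_ord /= IH -natr1 mulrDl mul1r; congr (_ + _).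
  have N2 : (N - 2 = (N - 3).+1)%N by lia.
  rewrite /f N2 big_ord_recl /= addn0 modnMr /=; congr (_ + _).
  rewrite mulr_natl -[X in _ *+ X]card_ord -sumr_const; apply: eq_bigr => i _.
  rewrite /bump /= add1n mulnC modnMDl modn_small ?ltnS //.
have D1 := ndown_gt1 p.
rewrite cell_length_eigen -block_sum.
have E : ((N - 2) * (N - 2 - has_up p) = (nchildren p).+1)%N.
  by rewrite /nchildren prednK // muln_gt0; move: D1; rewrite /ndown; lia.
rewrite E big_ord_recr /= /f; have /negbTE -> : (nchildren p %% (N - 2) != 0)%N.
  apply/negP => /eqP m0.
  have : ((N - 2) * (N - 2 - has_up p) %% (N - 2) = (nchildren p).+1 %% (N - 2))%N.
    by rewrite E.
  rewrite modnMr -addn1 -modnDml m0 modn_small; lia.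
by rewrite addrK.
Qed.

Hypothesis q0_gt0 : (0 < q0)%N.

Theorem config_symmetry_fix (gam : V -> V) u js :
  (forall v j, gam (act v j) = act (gam v) j) -> (forall v, x (gam v) = x v) ->
  gam u = foldl act u js -> exists v, gam v = v.
Proof.
move=> gam_act gam_x gu.
have gr v : gam (right v) = right (gam v) by rewrite /right gam_act /th gam_x.
have gf v : gam (first_child v) = first_child (gam v).
  by rewrite /first_child /down gam_act /ndown /has_up /th /mm gam_x.
have gl v : nchildren (gam v) = nchildren v.
  by rewrite /nchildren /ndown /has_up /mm gam_x.
have lam0 : 0 < lam by apply: lt_trans lam_gt1.
have up0 : 0 < ell_up by rewrite mulr_gt0 // ltr0n; lia.
have mid0 : 0 < ell_mid by apply: lt_le_trans ltr01 ell_mid_ge1.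
have [m [n]] := related_foldl u js; rewrite -gu.
apply: (@orbit_graph_symmetry_fix R V right first_child parent gam child_index
  nchildren (aa x) (cc x) qq (fun v => cell_length (has_up v)) lam
  (Num.min ell_up ell_mid) (Num.max ell_up ell_mid) M M) => //.
- exact: right_first_child.
- exact: nchildren_gt1.
- exact: child_index_lt.
- exact: child_indexP.
- by move=> p i Hi; have [] := child_coords Hi.
- by move=> p i Hi; have [] := child_coords Hi.
- by move=> h; rewrite /aa gam_x.
- by move=> h; rewrite /has_up /mm gam_x.
- exact: lam_pow_not_nat.
- by rewrite lt_min up0.
- by move=> h; case: has_up; rewrite /= ge_min le_max lexx ?orbT.
- by move=> h; rewrite (rule_a_gt0 (rules h)) ltnW // /aa ltn_ord.
- by move=> h; rewrite ltnW // /cc ltn_ord.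
- by move=> h; rewrite addn_gt0 q0_gt0.
- by move=> h; exact: rule_q_right (rules h).
- exact: cell_length_children.
- by move=> p; exact: rule_a (rules p).
Qed.

End density.

End orbit_graph_of_config.
End surface_action.

(** * Locality of the rules, and the subshift they define *)

Section locality.
Variables (N : nat) (io : 'Z_N -> 'Z_N) (q0 M : nat).
Hypothesis N_gt7 : (7 < N)%N.

(** A rule evaluates the configuration only on tiles reached from [v] by words, and [e] preserves
    words; tiles identified by [e] simply carry the same cell. *)
Lemma local_rule_pullback (V V' : Type) (act : V -> 'Z_N -> V) (act' : V' -> 'Z_N -> V')
    (e : V -> V') (x : V' -> cell N M) v :
  (forall v j, e (act v j) = act' (e v) j) ->
  local_rule io q0 act' x (e v) -> local_rule io q0 act (x \o e) v.
Proof.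
move=> eE.
have eR w : e (right act (x \o e) w) = right act' x (e w) by rewrite eE.
have eF w : e (first_child act (x \o e) w) = first_child act' x (e w) by rewrite eE.
have eI i w : e (iter i (right act (x \o e)) w) = iter i (right act' x) (e w).
  by elim: i => //= i <-; rewrite eR.
have P w : (x \o e) w = x (e w) by [].
case=> r1 r2 r3 r4 r5 r6 r7 r8 r9 r10 r11; split=> //.
- by rewrite /th /has_up /mm !P eR.
- by rewrite /qq P eR.
- by move=> lt; rewrite /kk /mm !P eR; exact: r5.
- by move=> E; rewrite /mm P eR; exact: r6.
- by rewrite /th /left P eE.
- by move=> u; have := r8 u; rewrite /ndown /has_up /th /kk /mm /up !P eE.
- by move=> k Hk; have := r9 k Hk; rewrite /kk /mm /th /down !P eE.
- have -> : cc (x \o e) (right act (x \o e) v) = cc x (right act' x (e v)).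
    by rewrite /cc P eR.
  rewrite -[RHS]/(qq q0 x (e v) * aa x (e v) + cc x (right act' x (e v)))%N -r10.
  congr (_ + _)%N.
  by apply: eq_bigr => i _; rewrite /aa P eI eF.
Qed.

(** The words that a rule reads depend on the configuration itself, so the neighbours computed from
    [x] and from [y] have to be identified before the values are compared. The longest words lead to
    the children and have at most [nchildren <= N * N] letters. *)
Lemma local_rule_local (V : Type) (act : V -> 'Z_N -> V) (x y : V -> cell N M) v :
  (forall js, (size js <= N * N)%N -> x (foldl act v js) = y (foldl act v js)) ->
  local_rule io q0 act x v -> local_rule io q0 act y v.
Proof.
move=> xy.
have x0 : x v = y v by apply: (xy [::]).
have NN : (64 <= N * N)%N by have := leq_mul N_gt7 N_gt7.
have x1 j : x (act v j) = y (act v j) by apply: (xy [:: j]); apply: leq_trans NN.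
have R1 : right act y v = right act x v by rewrite /right /th x0.
have L1 : left act y v = left act x v by rewrite /left /lpos /has_up /mm /th x0.
have U1 : up act y v = up act x v by rewrite /up /th x0.
have D1 k : down act y v k = down act x v k by rewrite /down /th x0.
have nd : ndown y v = ndown x v by rewrite /ndown /has_up /mm x0.
have F1 : first_child act y v = first_child act x v by rewrite /first_child nd D1.
have RI i : (i < nchildren y v)%N ->
    iter i (right act y) (first_child act y v) = iter i (right act x) (first_child act x v) /\
    exists2 js, size js = i.+1 & iter i (right act x) (first_child act x v) = foldl act v js.
  elim: i => [|i IH] Hi.
    by rewrite F1; split=> //; exists [:: th x v + (ndown x v)%:R].
  have [E [js sj Ej]] := IH (ltnW Hi); split.
    rewrite !iterS E; move: Ej; set w := iter _ _ _ => Ej.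
    suff xw : x w = y w by rewrite /right /th xw.
    rewrite Ej xy // sj.
    have : (nchildren y v <= N * N)%N.
      by rewrite /nchildren (leq_trans (leq_pred _)) // leq_mul // /ndown; lia.
    lia.
  exists (rcons js (th x (iter i (right act x) (first_child act x v)))).
    by rewrite size_rcons sj.
  by rewrite iterS foldl_rcons -Ej.
case=> r1 r2 r3 r4 r5 r6 r7 r8 r9 r10 r11; split=> //.
- by rewrite /kk -x0.
- by rewrite /kk /mm -x0.
- by rewrite R1 /th /has_up /mm -x0 -x1; exact: r3.
- by rewrite R1 /qq -x0 -x1; exact: r4.
- by rewrite R1 /kk /mm -x0 -x1; exact: r5.
- by rewrite R1 /kk /mm -x0 -x1; exact: r6.
- by rewrite L1 /lpos /has_up /mm /th -x0 -x1; exact: r7.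
- by rewrite U1 /ndown /has_up /mm /th /kk -x0 -x1; exact: r8.
- move=> k; rewrite nd => Hk; have := r9 k Hk.
  by rewrite D1 /kk /mm /th -x0 -x1.
- rewrite R1 /cc /aa /qq -x0 -x1.
  have -> : nchildren y v = nchildren x v by rewrite /nchildren nd.
  rewrite -[RHS]r10; congr (_ + _)%N; apply: eq_bigr => i _.
  have [|-> [js sj Ej]] := RI i; first by rewrite /nchildren nd ltn_ord.
  rewrite /aa Ej xy // sj.
  have : (nchildren x v <= N * N)%N.
    by rewrite /nchildren (leq_trans (leq_pred _)) // leq_mul // /ndown; lia.
  by have := ltn_ord i; lia.
- by rewrite /aa -x0.
Qed.

End locality.

Section sft_of_local_rules.
Variables (N : nat) (io : 'Z_N -> 'Z_N) (q0 M : nat).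
Hypothesis N_gt7 : (7 < N)%N.
Hypothesis ioK : involutive io.
Hypothesis iter_phi : forall j, iter N (next_side io) j = j.
Variables (G : groupType) (s : 'Z_N -> G).
Let act (g : G) j := (g * s j)%g.
Hypothesis act_surface : surface_action io act.
Hypothesis act_gen : forall g, exists js, g = foldl act 1%g js.

Fixpoint word_ball n : {fset G} :=
  if n is n'.+1 then (word_ball n' `|` [fset act g j | g in word_ball n', j in 'Z_N])%fset
  else [fset 1%g]%fset.

Lemma mem_word_ball n js : (size js <= n)%N -> foldl act 1%g js \in word_ball n.
Proof.
elim: n js => [|n IH] js; first by rewrite leqn0 size_eq0 => /eqP ->; rewrite inE.
rewrite leq_eqVlt ltnS in_fsetU => /orP[/eqP|/IH -> //].
case/lastP: js => // js j; rewrite size_rcons => -[sj].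
apply/orP; right; rewrite foldl_rcons; apply/imfset2P.
by exists (foldl act 1%g js); [apply: IH; rewrite sj | exists j].
Qed.

Variables (R : realType) (lam : R).
Hypothesis lam_gt1 : 1 < lam.
Hypothesis lamE : lam ^+ 2 = ((N - 2) ^ 2 - 2)%:R * lam - 1.
Hypothesis q0_gt0 : (0 < q0)%N.

Theorem strongly_aperiodic_sft_of_local_rules (x0 : G -> cell N M) :
  (forall h, local_rule io q0 act x0 h) -> admits_strongly_aperiodic_sft G.
Proof.
move=> Hx0.
pose X : set (G -> cell N M) := [set x | forall h, local_rule io q0 act x h].
exists (cell N M), X; split; last 2 first.
- by exists x0.
- move=> x Xx; apply/seteqP; split=> g /=; last first.
    by move=> ->; apply/funext => h; rewrite /translate invg1 mul1g.
  (* By [gx], [x] is invariant under left multiplication by [g^-1], which commutes with [act], a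
     right multiplication. A fixed point of this translation forces [g = 1]. *)
  move=> gx; have [js Ejs] := act_gen g^-1%g.
  have [|||v] := @config_symmetry_fix N io N_gt7 ioK iter_phi q0 M G act x
    act_surface Xx R lam lam_gt1 lamE q0_gt0 (fun h => g^-1 * h)%g 1%g js.
  + by move=> v j; rewrite /act mulgA.
  + by move=> v; rewrite -[in RHS]gx.
  + by rewrite mulg1.
  + move=> E; apply/invg_inj; rewrite invg1.
    by rewrite -[LHS](mulgK v) E mulgV.
- pose F := word_ball (N * N).
  (* A pattern is allowed if some extension of it satisfies the rule at 1; by locality every
     extension then does. *)
  pose P : {set {ffun F -> cell N M}} := [set p : {ffun F -> cell N M} | `[< exists z : G -> cell N M,
    local_rule io q0 act z 1%g /\ forall f : F, z (val f) = p f >]]%SET.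
  exists F, P; apply/seteqP; split=> x /= Hx h.
    rewrite inE; apply/asboolP; exists (fun g => x (h * g)%g); split.
      apply: (@local_rule_pullback _ _ _ _ G G act act (fun g => h * g)%g x 1%g).
        by move=> v j; rewrite /act mulgA.
      by rewrite mulg1.
    by move=> f; rewrite ffunE.
  have := Hx h; rewrite inE => /asboolP[z [z1 zE]].
  have : local_rule io q0 act (x \o (fun g => h * g)%g) 1%g.
    apply: local_rule_local z1 => // js Hjs.
    by have := zE [` mem_word_ball Hjs]%fset; rewrite ffunE.
  rewrite -(mulVg h) => /(@local_rule_pullback _ _ _ _ G G act act (fun g => h^-1 * g)%g _ h).
  have -> : ((x \o (fun g => (h * g)%g)) \o (fun g => (h^-1 * g)%g)) = x.
    by apply/funext => g /=; rewrite mulgA mulgV mul1g.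
  by apply=> v j; rewrite /act mulgA.
Qed.

End sft_of_local_rules.

(** * A configuration on addresses *)

Section floor.
Variable R : realType.
Implicit Types y s b : R.

Lemma floorD_gt y s : 1 <= s -> 0 < Num.floor (y + s) - Num.floor y.
Proof.
move=> s1; have : Num.floor y + 1 <= Num.floor (y + s).
  by rewrite floor_ge_int rmorphD /= lerD // floor_le.
by rewrite subr_gt0 lezD1.
Qed.

Lemma floorD_lt y s b : s <= b -> Num.floor (y + s) - Num.floor y < (Num.truncn b).+2%:Z.
Proof.
move=> sb; rewrite -(ltr_int R) rmorphB /=.
have b1 := truncnS_gt b; have y1 := floorD1_gt y; have ys := floor_le (y + s).
rewrite rmorphD /= in y1; rewrite -[_.+2%:Z%:~R]/(_.+2%:R : R) -natr1; lra.
Qed.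

(** This difference will be the carry at the abscissa [y]. *)
Lemma floorM_nat (q : nat) y :
  0 <= Num.floor (q%:R * y) - q%:Z * Num.floor y <= q%:Z.
Proof.
rewrite subr_ge0 lerBlDr -[X in _ <= X + _]mulr1 addrC -mulrDr; apply/andP; split.
  by rewrite floor_ge_int rmorphM /= ler_wpM2l // floor_le.
rewrite -(ler_int R) (le_trans (floor_le _)) // rmorphM /= ler_wpM2l // ltW //.
exact: floorD1_gt.
Qed.

End floor.

(** * Rows of addresses *)

Section addresses.
Variable N : nat.
Hypothesis N_gt7 : (7 < N)%N.
Local Notation mmax := (mmax N).

(* The sequence of coordinates of a cell, its parent, its grandparent, ...,
   without its tail of constant coordinates (2, 1). *)
Definition address := seq (nat * nat).
Implicit Types (t : address) (c : nat * nat).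

(** The default [(2, 1)] is neither the first nor the last place among the children, so a carry to
    the parent never enters the constant tail: left and right moves are defined everywhere by
    recursion on a finite list. *)
Definition ahead t := head (2, 1)%N t.
Definition atail t : address := behead t.
Definition acons c t : address :=
  if (t == [::]) && (c == (2, 1)%N) then [::] else c :: t.
Definition aup t := (ahead t).2 == 0%N.
Definition adown t := (N - 2 - aup t)%N.
Definition coords_ok c t := [&& (0 < c.1)%N, (c.1 <= adown t)%N & (c.2 <= mmax c.1)%N].

Fixpoint address_ok t :=
  if t is c :: t' then
    [&& address_ok t', coords_ok c t' & ~~ ((t' == [::]) && (c == (2, 1)%N))]
  else true.

Lemma acons_ok c t : address_ok t -> coords_ok c t -> address_ok (acons c t).
Proof. by move=> ot oc; rewrite /acons; case: ifPn => //= -> ; rewrite ot oc. Qed.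

Lemma ahead_acons c t : ahead (acons c t) = c.
Proof. by rewrite /acons; case: ifP => // /andP[_ /eqP ->]. Qed.

Lemma atail_acons c t : atail (acons c t) = t.
Proof. by rewrite /acons; case: ifP => // /andP[/eqP ->]. Qed.

Lemma acons_eta t : address_ok t -> acons (ahead t) (atail t) = t.
Proof.
by case: t => // c t /= /and3P[_ _]; rewrite /acons => /negbTE ->.
Qed.

Lemma address_ind (P : address -> Prop) : P [::] ->
  (forall c t, address_ok t -> coords_ok c t -> P t -> P (acons c t)) ->
  forall t, address_ok t -> P t.
Proof.
move=> P0 Pc; elim=> // c t IH ok; rewrite -(acons_eta ok).
by case/and3P: ok => ot oc _; apply: Pc => //; exact: IH.
Qed.

Lemma atail_ok t : address_ok t -> address_ok (atail t).
Proof. by case: t => // c t /= /and3P[]. Qed.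

Lemma ahead_ok t : address_ok t -> coords_ok (ahead t) (atail t).
Proof.
case: t => [_|c t /= /and3P[] //].
by rewrite /coords_ok /adown /aup /mmax /=; lia.
Qed.

Definition last_coords c := (c.1 == 1)%N && (c.2 == mmax 1).
Definition next_coords c := if (c.2 < mmax c.1)%N then (c.1, c.2.+1) else (c.1.-1, 0%N).
Definition prev_coords c := if (0 < c.2)%N then (c.1, c.2.-1) else (c.1.+1, mmax c.1.+1).

(** A successor with carry, as in a numeration system: after a last child comes the first child of
    the next parent. *)
Fixpoint aright t : address :=
  if t is c :: t' then
    if last_coords c then acons (adown (aright t'), 0%N) (aright t')
    else acons (next_coords c) t'
  else [:: (2, 2)%N].

Fixpoint aleft t : address :=
  if t is c :: t' then
    if c == (adown t', 0%N) then acons (1%N, mmax 1) (aleft t')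
    else acons (prev_coords c) t'
  else [:: (2, 0)%N].

Lemma adown_gt1 t : (1 < adown t <= N)%N.
Proof. by rewrite /adown; case: aup => /=; lia. Qed.

Lemma adown_range t : (0 < adown t <= adown t)%N.
Proof. by rewrite leqnn andbT ltnW //; case/andP: (adown_gt1 t). Qed.

Lemma aright_acons c t : address_ok t -> coords_ok c t ->
  aright (acons c t) = if last_coords c then acons (adown (aright t), 0%N) (aright t)
                       else acons (next_coords c) t.
Proof.
move=> ot oc; rewrite {1}/acons; case: ifP => // /andP[/eqP -> /eqP ->].
by rewrite /last_coords /= /next_coords /mmax /=; case: ifP => //; lia.
Qed.

Lemma aleft_acons c t : address_ok t -> coords_ok c t ->
  aleft (acons c t) = if c == (adown t, 0%N) then acons (1%N, mmax 1) (aleft t)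
                      else acons (prev_coords c) t.
Proof.
move=> ot oc; rewrite {1}/acons; case: ifP => // /andP[/eqP -> /eqP ->] //.
by rewrite xpair_eqE andbF.
Qed.

Lemma first_coords_ok t : coords_ok (adown t, 0%N) t.
Proof. by rewrite /coords_ok /= leqnn; have := adown_gt1 t; lia. Qed.

Lemma last_coords_ok t : coords_ok (1%N, mmax 1) t.
Proof. by rewrite /coords_ok /= leqnn; have := adown_gt1 t; lia. Qed.

Lemma next_coords_ok c t : coords_ok c t -> ~~ last_coords c -> coords_ok (next_coords c) t.
Proof.
case: c => k m; rewrite /coords_ok /last_coords /next_coords /=.
move=> /and3P[k0 kD mk]; case: ifPn => /= [lt|]; first by rewrite k0 kD.
rewrite -leqNgt leq0n andbT => ge; have {ge mk} -> : m = mmax k by apply/eqP; rewrite eqn_leq mk.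
by case: eqP => [->|]; rewrite ?eqxx //; lia.
Qed.

Lemma prev_coords_ok c t : coords_ok c t -> c != (adown t, 0%N) -> coords_ok (prev_coords c) t.
Proof.
case: c => k m; rewrite /coords_ok /prev_coords xpair_eqE /=.
move=> /and3P[k0 kD mk]; case: ifPn => /= [lt _|]; first by rewrite k0 kD; lia.
by rewrite -eqn0Ngt => /eqP ->; rewrite eqxx leqnn; lia.
Qed.

Lemma aright_ok t : address_ok t -> address_ok (aright t).
Proof.
elim/address_ind=> [|c {}t ot oc IH].
  by rewrite /= /coords_ok /adown /aup /mmax /=; lia.
rewrite aright_acons //; case: ifPn => lc; apply: acons_ok => //.
  exact: first_coords_ok.
exact: next_coords_ok.
Qed.

Lemma aleft_ok t : address_ok t -> address_ok (aleft t).
Proof.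
elim/address_ind=> [|c {}t ot oc IH].
  by rewrite /= /coords_ok /adown /aup /mmax /=; lia.
rewrite aleft_acons //; case: ifPn => lc; apply: acons_ok => //.
  exact: last_coords_ok.
exact: prev_coords_ok.
Qed.

Lemma arightK t : address_ok t -> aleft (aright t) = t.
Proof.
elim/address_ind=> [|c {}t ot oc IH].
  by rewrite /= xpair_eqE andbF /prev_coords.
rewrite aright_acons //; case: ifPn => lc.
  rewrite aleft_acons ?aright_ok ?first_coords_ok // eqxx IH; congr acons.
  by case: c lc {oc} => k m /= /andP[/eqP /= -> /eqP /= ->].
have ok := next_coords_ok oc lc.
case: c lc oc ok => k m; rewrite /last_coords /next_coords /= => lc oc ok.
case: ifPn ok => [lt|ge] ok; rewrite aleft_acons // xpair_eqE ?andbF //= /prev_coords //=.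
move: oc lc ge; rewrite /coords_ok /= => /and3P[k0 kD mk] lc ge.
have mE : m = mmax k by lia.
have -> : (k.-1 == adown t) = false by apply/eqP; lia.
by rewrite /= prednK // -mE.
Qed.

Lemma aleftK t : address_ok t -> aright (aleft t) = t.
Proof.
elim/address_ind=> [|c {}t ot oc IH].
  by rewrite /= /last_coords /next_coords /= /mmax /=; case: ifP => //; lia.
rewrite aleft_acons //; case: ifPn => lc.
  by rewrite aright_acons ?aleft_ok ?last_coords_ok // /last_coords /= eqxx IH (eqP lc).
have ok := prev_coords_ok oc lc; rewrite aright_acons //.
case: c lc oc ok => k m; rewrite xpair_eqE /coords_ok /prev_coords /last_coords /next_coords /=.
move=> lc /and3P[k0 kD mk]; case: ifPn => /= [m0 _|m0 _].
  have -> : (k == 1%N) && (m.-1 == mmax 1) = false.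
    by apply/negP => /andP[/eqP E /eqP E']; move: mk E'; rewrite E /mmax /=; lia.
  have -> : (m.-1 < mmax k)%N = true by lia.
  by rewrite prednK.
have -> : (k.+1 == 1%N) = false by apply/eqP; lia.
by rewrite ltnn /=; congr (acons (_, _)); lia.
Qed.

Lemma aright_block t k m : address_ok t -> (0 < k <= adown t)%N -> (m <= mmax k)%N ->
  iter m aright (acons (k, 0%N) t) = acons (k, m) t.
Proof.
move=> ot Hk; elim: m => // m IH Hm; rewrite iterS IH; last exact: ltnW.
rewrite aright_acons //; last by rewrite /coords_ok /=; lia.
rewrite /last_coords /next_coords /= Hm.
by case: ifP => // /andP[/eqP k1 /eqP mE]; move: Hm; rewrite k1 mE ltnn.
Qed.

Lemma aright_block_end t k : address_ok t -> (0 < k <= adown t)%N ->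
  iter (mmax k).+1 aright (acons (k, 0%N) t) =
  if (k == 1)%N then acons (adown (aright t), 0%N) (aright t) else acons (k.-1, 0%N) t.
Proof.
move=> ot Hk; rewrite iterS aright_block // aright_acons //; last first.
  by rewrite /coords_ok /= leqnn; lia.
by rewrite /last_coords /next_coords /= ltnn; case: eqP => [->|//]; rewrite eqxx.
Qed.

Lemma aright_children t : address_ok t ->
  iter ((N - 2) * adown t).-1 aright (acons (adown t, 0%N) t) =
  acons (adown (aright t), 0%N) (aright t).
Proof.
move=> ot; have D1 := adown_gt1 t.
have step d : (d < adown t)%N ->
    iter ((N - 2) * d) aright (acons (adown t, 0%N) t) = acons ((adown t - d)%N, 0%N) t.
  elim: d => [|d IH] Hd; first by rewrite muln0 subn0.
  rewrite mulnS iterD IH; last exact: ltnW.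
  have Hk : (0 < adown t - d <= adown t)%N by lia.
  have nk : ((adown t - d)%N == 1%N) = false by apply/eqP; lia.
  have := aright_block_end ot Hk; rewrite nk.
  have -> : (mmax (adown t - d)%N).+1 = (N - 2)%N by rewrite /mmax nk /=; lia.
  by move=> ->; congr (acons (_, _)); lia.
have -> : ((N - 2) * adown t).-1 = (N - 3 + (N - 2) * (adown t).-1)%N.
  case: (adown t) D1 => // d _.
  by rewrite mulnS -pred_Sn; move: ((N - 2) * d)%N => e; lia.
rewrite iterD step; last by lia.
have -> : (adown t - (adown t).-1 = 1)%N by lia.
have := @aright_block_end t 1 ot; have -> : (mmax 1).+1 = (N - 3)%N by rewrite /mmax /=; lia.
by move=> -> //=; lia.
Qed.

(** * Positions, densities, and the configuration they define *)

Section positions.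
Variables (R : realType) (lam : R).
Hypothesis lam_gt1 : 1 < lam.
Hypothesis lamE : lam ^+ 2 = ((N - 2) ^ 2 - 2)%:R * lam - 1.
Local Notation ell_mid := (ell_mid N lam).
Local Notation ell_block := (ell_block N lam).

(** The length of the siblings to the right of a cell. The cell missing in the last block is
    accounted for by N - 4 in place of N - 3. *)
Definition siblings_length c : R := c.1.-1%:R * ell_block + ((N - 4)%:R - c.2%:R) * ell_mid.

(* The right end of a cell, on a line where the row below is scaled by lam. *)
Fixpoint apos t : R :=
  if t is c :: t' then lam * apos t' - siblings_length c
  else siblings_length (2, 1)%N / (lam - 1).

Definition alen t := cell_length N lam (aup t).

(** The empty address is its own child [(2, 1)]; the base value of [apos] is the fixed point of the
    recursion for these coordinates, so the recursion survives the normalization in [acons]. *)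
Lemma apos_acons c t : apos (acons c t) = lam * apos t - siblings_length c.
Proof.
rewrite /acons; case: ifP => // /andP[/eqP -> /eqP ->] /=.
have l1 : lam - 1 != 0 by rewrite gt_eqF // subr_gt0.
by move: (siblings_length _) => s; field.
Qed.

Lemma alen_acons c t : alen (acons c t) = cell_length N lam (c.2 == 0%N).
Proof. by rewrite /alen /aup ahead_acons. Qed.

Lemma apos_first t :
  apos (acons (adown t, 0%N) t) - alen (acons (adown t, 0%N) t) = lam * (apos t - alen t).
Proof.
rewrite apos_acons alen_acons /= [in RHS]mulrBr /alen cell_length_eigen //.
rewrite /siblings_length /= /cell_length.
have D1 : (0 < adown t)%N by have := adown_gt1 t; lia.
have -> : (adown t).-1%:R = (adown t)%:R - 1 :> R by rewrite -[in RHS](prednK D1) -natr1 addrK.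
have -> : (N - 4)%:R = (N - 3)%:R - 1 :> R.
  by apply/eqP; rewrite eq_sym subr_eq natr1; apply/eqP; congr _%:R; lia.
by rewrite /adown /ell_block; ring.
Qed.

(** Inside a family the lengths of the remaining siblings differ by one cell; at the end of a family
    the equality is inherited from the parents by scaling. *)
Lemma apos_aright t : address_ok t -> apos (aright t) - alen (aright t) = apos t.
Proof.
elim/address_ind=> [|c {}t ot oc IH].
  have -> : aright [::] = acons (2, 2)%N [::] by [].
  have E : apos [::] = lam * apos [::] - siblings_length (2, 1)%N.
    exact: apos_acons (2, 1)%N [::].
  rewrite apos_acons alen_acons [RHS]E; move: (apos _) => e.
  by rewrite /siblings_length /cell_length /=; ring.
rewrite aright_acons //; case: ifPn => lc.
  rewrite apos_first IH apos_acons; case/andP: lc => /eqP k1 /eqP m1.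
  rewrite /siblings_length k1 m1 mul0r add0r /mmax /=.
  have -> : (N - 3 - 1 = N - 4)%N by lia.
  by rewrite subrr mul0r subr0.
rewrite !apos_acons alen_acons /next_coords /siblings_length /cell_length.
case: c oc lc => k m; rewrite /coords_ok /last_coords /= => /and3P[k0 kD mk] lc.
case: ifPn => [lt|ge] /=; first by rewrite -natr1; ring.
have mE : m = mmax k by lia.
have k1 : (1 < k)%N.
  by rewrite ltn_neqAle k0 andbT; apply/eqP => k1; move: lc; rewrite mE -k1 !eqxx.
rewrite mE /mmax; have -> : (k == 1%N) = false by apply/eqP; lia.
have -> : k.-1%:R = k.-2%:R + 1 :> R by rewrite natr1; congr _%:R; lia.
have -> : (N - 3 - false)%:R = (N - 4)%:R + 1 :> R by rewrite natr1; congr _%:R; rewrite /=; lia.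
rewrite /ell_block.
have -> : (N - 3)%:R = (N - 4)%:R + 1 :> R by rewrite natr1; congr _%:R; lia.
by ring.
Qed.

Variables (io : 'Z_N -> 'Z_N) (q0 : nat).
Hypothesis ioK : involutive io.
Hypothesis iter_phi : forall j, iter N (next_side io) j = j.
Hypothesis q0_gt0 : (0 < q0)%N.
Hypothesis q0_lam : q0%:R <= lam < q0.+1%:R.
Local Notation phi := (next_side io).

(* Mark densities live in [1, (q0 + 1) / q0), on which multiplication by
   (q0 + 1) / lam or by q0 / lam, according to the position, is a bijection. *)
Definition multiplier (al : R) : nat := (q0 + (al < lam / q0%:R)%R)%N.
Definition density_below (al : R) := al * (multiplier al)%:R / lam.
Definition density_above (be : R) :=
  if be < q0.+1%:R / lam then be * lam / q0%:R else be * lam / q0.+1%:R.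
Definition density_ok (al : R) := 1 <= al < q0.+1%:R / q0%:R.

Let lam0 : 0 < lam. Proof. exact: lt_trans lam_gt1. Qed.
Let q00 : 0 < q0%:R :> R. Proof. by rewrite ltr0n. Qed.
Let q01 : 0 < q0.+1%:R :> R. Proof. by rewrite ltr0n. Qed.

Lemma density_below_ok al : density_ok al -> density_ok (density_below al).
Proof.
case/andP: q0_lam => ql lq /andP[a1 a2]; rewrite /density_below /multiplier /density_ok.
have [lt|ge] := ltP al (lam / q0%:R).
  rewrite addn1 ler_pdivlMr // mul1r ltr_pdivrMr //; apply/andP; split.
    by rewrite (le_trans (ltW lq)) // ler_peMl // ltW.
  have -> : q0.+1%:R / q0%:R * lam = lam / q0%:R * q0.+1%:R by rewrite mulrC mulrA mulrAC.
  by rewrite ltr_pM2r.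
rewrite addn0 ler_pdivlMr // mul1r -ler_pdivrMr // ge /=.
rewrite ltr_pdivrMr //; move: a2; rewrite ltr_pdivlMr // => a2.
apply: (lt_le_trans a2); rewrite mulrAC ler_pdivlMr // ler_pM2l //.
Qed.

Lemma density_above_ok be : density_ok be -> density_ok (density_above be).
Proof.
case/andP: q0_lam => ql lq /andP[a1 a2]; rewrite /density_above /density_ok.
case: ifPn => [lt|].
  rewrite ler_pdivlMr // mul1r ltr_pM2r ?invr_gt0 // -ltr_pdivlMr // lt andbT.
  by rewrite (le_trans ql) // ler_peMl // ltW.
rewrite -leNgt => ge; rewrite ler_pdivlMr // mul1r -ler_pdivrMr // ge /=.
rewrite ltr_pdivrMr //; apply: (@lt_trans _ _ (q0.+1%:R / q0%:R * lam)); first by rewrite ltr_pM2r.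
by rewrite ltr_pM2l ?divr_gt0.
Qed.

Lemma density_belowK al : density_ok al -> density_above (density_below al) = al.
Proof.
case/andP: q0_lam => ql lq /andP[a1 a2]; rewrite /density_below /multiplier /density_above.
have [lt|ge] := ltP al (lam / q0%:R).
  rewrite addn1 ltr_pdivrMr // divfK ?gt_eqF // gtr_pMl // ltNge a1 /=.
  by rewrite divfK ?gt_eqF // mulfK ?gt_eqF.
rewrite addn0 ltr_pM2r ?invr_gt0 // -ltr_pdivlMr // a2.
by rewrite divfK ?gt_eqF // mulfK ?gt_eqF.
Qed.

Lemma density_aboveK be : density_ok be -> density_below (density_above be) = be.
Proof.
case/andP: q0_lam => ql lq /andP[a1 a2]; rewrite /density_below /multiplier /density_above.
case: ifPn => [lt|].
  rewrite ltr_pM2r ?invr_gt0 // gtr_pMl // ltNge a1 /= addn0.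
  by rewrite divfK ?gt_eqF // mulfK ?gt_eqF.
rewrite -leNgt => ge.
have -> : be * lam / q0.+1%:R < lam / q0%:R.
  rewrite mulrAC mulrC ltr_pM2l // ltr_pdivrMr // mulrC //.
by rewrite addn1 divfK ?gt_eqF // mulfK ?gt_eqF.
Qed.

(** The address leaves free how the labels of the sides are placed relative to the row, which the
    component in ['Z_N] records; the real component is the density of the row. *)
Definition mcell := (R * 'Z_N * address)%type.
Implicit Types v : mcell.
Definition mright v : mcell := (v.1.1, phi v.1.2 + (aup (aright v.2))%:R, aright v.2).
Definition mlpos v := v.1.2 - 1 - (aup v.2)%:R.
Definition mleft v : mcell := (v.1.1, io (mlpos v), aleft v.2).
Definition mdown v k : mcell :=
  (density_below v.1.1, phi (v.1.2 + k%:R), acons (k, 0%N) v.2).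
Definition mup v : mcell :=
  (density_above v.1.1, io (v.1.2 - 1) - (ahead v.2).1%:R, atail v.2).
Definition mact v j : mcell :=
  let i := nat_of_ord (j - v.1.2) in
  if i == 0%N then mright v else
  if (i <= adown v.2)%N then mdown v i else
  if i == (adown v.2).+1 then mleft v else mup v.

Definition mok v := density_ok v.1.1 && address_ok v.2.

Let NE : N%:R = 0 :> 'Z_N. Proof. by apply: pchar_Zp; lia. Qed.

Lemma nat_of_Zp k : (k < N)%N -> nat_of_ord (k%:R : 'Z_N) = k.
Proof. by move=> kN; rewrite val_Zp_nat ?modn_small //; lia. Qed.

Lemma mact_th v : mact v v.1.2 = mright v.
Proof. by rewrite /mact subrr. Qed.

Lemma mact_down v k : (0 < k <= adown v.2)%N -> mact v (v.1.2 + k%:R) = mdown v k.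
Proof.
move=> Hk; rewrite /mact addrAC subrr add0r nat_of_Zp; last first.
  by move: Hk; rewrite /adown; lia.
by case/andP: Hk => k0 ->; rewrite eqn0Ngt k0.
Qed.

Lemma adownE t : (adown t)%:R = - 2%:R - (aup t)%:R :> 'Z_N.
Proof.
have E : (adown t + (2 + aup t) = N)%N by rewrite /adown; case: aup => /=; lia.
have := congr1 (fun n => n%:R : 'Z_N) E; rewrite NE !natrD => /eqP.
by rewrite addr_eq0 => /eqP ->; rewrite opprD.
Qed.

Lemma mlposE v : mlpos v = v.1.2 + (adown v.2).+1%:R.
Proof. by rewrite /mlpos -natr1 adownE; ring. Qed.

Lemma mact_lpos v : mact v (mlpos v) = mleft v.
Proof.
rewrite mlposE /mact addrAC subrr add0r nat_of_Zp; last first.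
  by rewrite /adown; case: aup => /=; lia.
by rewrite /= ltnn eqxx.
Qed.

Lemma mact_up v : aup v.2 -> mact v (v.1.2 - 1) = mup v.
Proof.
move=> u; have -> : v.1.2 - 1 = v.1.2 + (adown v.2).+2%:R.
  by rewrite -[(adown v.2).+2]add1n natrD addrCA -mlposE /mlpos u /=; ring.
rewrite /mact addrAC subrr add0r nat_of_Zp; last first.
  by rewrite /adown u /=; lia.
by rewrite /= leqNgt ltnS leqnSn /= eqn_leq ltnn.
Qed.

Variant mact_spec v : 'Z_N -> mcell -> Prop :=
| MactRight : mact_spec v v.1.2 (mright v)
| MactDown k of (0 < k <= adown v.2)%N : mact_spec v (v.1.2 + k%:R) (mdown v k)
| MactLeft : mact_spec v (mlpos v) (mleft v)
| MactUp of aup v.2 : mact_spec v (v.1.2 - 1) (mup v).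

Lemma mactP v j : mact_spec v j (mact v j).
Proof.
have [i Hi ->] : exists2 i, (i < N)%N & j = v.1.2 + i%:R.
  exists (j - v.1.2 : 'Z_N).
    have := ltn_ord (j - v.1.2); rewrite [X in (_ < X)%N -> _]Zp_cast //; lia.
  by rewrite natr_Zp addrC subrK.
have [->|i0] := posnP i; first by rewrite addr0 mact_th; constructor.
have [iD|Di] := leqP i (adown v.2).
  by rewrite mact_down ?i0 //; constructor; rewrite i0.
have [->|iD] := eqVneq i (adown v.2).+1.
  by rewrite -mlposE mact_lpos; exact: MactLeft.
have [u ->] : aup v.2 /\ i = (N - 1)%N.
  by move: Di iD Hi; rewrite /adown; case: aup => /=; lia.
have -> : v.1.2 + (N - 1)%:R = v.1.2 - 1.
  by rewrite natrB ?NE ?add0r ?sub0r //; lia.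
by rewrite (mact_up u); exact: MactUp.
Qed.

Lemma mact_ok v j : mok v -> mok (mact v j).
Proof.
case/andP=> da oa; rewrite /mok; case: mactP => [|k Hk||u] /=.
- by rewrite da aright_ok.
- rewrite density_below_ok // acons_ok // /coords_ok /=; lia.
- by rewrite da aleft_ok.
- by rewrite density_above_ok // atail_ok.
Qed.

Lemma mactK v j : mok v -> mact (mact v j) (io j) = v.
Proof.
case: v => [[al t] ad] /andP[/= da oa].
case: (mactP (al, t, ad) j) => [|k /= Hk||/= u].
- rewrite [in io _]/=; have -> : io t = mlpos (mright (al, t, ad)).
    by rewrite /mlpos /mright /= /phi; ring.
  rewrite mact_lpos /mleft /= arightK //; congr (_, _, _).
  by rewrite /mlpos /= /phi -[X in io X](_ : io t = _) ?ioK //; ring.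
- rewrite [in io _]/=; have -> : io (t + k%:R) = (mdown (al, t, ad) k).1.2 - 1 by rewrite /= /phi addrK.
  rewrite mact_up; last by rewrite /= /aup ahead_acons.
  rewrite /mup /= density_belowK // atail_acons ahead_acons /= /phi !addrK ioK addrK //.
- rewrite -[io _]/(mleft (al, t, ad)).1.2 mact_th /mright /= aleftK //.
  by congr (_, _, _); rewrite /phi ioK /mlpos /=; ring.
- rewrite [in io _]/=; have -> : io (t - 1) = (mup (al, t, ad)).1.2 + (ahead ad).1%:R by rewrite /= subrK.
  have /and3P[k0 kD _] := ahead_ok oa.
  rewrite mact_down ?k0 // /mdown /= density_aboveK // subrK /phi ioK subrK.
  congr (_, _, _); rewrite -[RHS]acons_eta //; congr acons.
  by move: u; rewrite /aup; case: (ahead ad) => k m /= /eqP ->.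
Qed.

Lemma walkSr m j v : walk io mact m.+1 j v = walk io mact m (phi j) (mact v j).
Proof. by elim: m => //= m ->; rewrite -iterSr. Qed.

Lemma walk_ok m j v : mok v -> mok (walk io mact m j v).
Proof. by move=> ov; elim: m => //= m IH; exact: mact_ok. Qed.

(** Closing up around a vertex may be checked from the next tile around it. This reduces every
    vertex to one on the lower side of some tile, where the walk is explicit. *)
Lemma closed_step j v : mok v ->
  walk io mact N (phi j) (mact v j) = mact v j -> walk io mact N j v = v.
Proof.
move=> ov; rewrite -walkSr /= iter_phi => E.
by rewrite -[LHS](mactK j) ?walk_ok // E mactK.
Qed.

Lemma walk_block v k m : mok v -> (0 < k <= adown v.2)%N -> (m <= mmax k)%N ->
  walk io mact m.+1 (v.1.2 + k%:R) v =
  (density_below v.1.1, iter m.+1 phi (v.1.2 + k%:R), acons (k, m) v.2).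
Proof.
move=> ov Hk; have oa : address_ok v.2 by case/andP: ov.
elim: m => [|m IH] Hm; first by rewrite /= mact_down.
rewrite -[LHS]/(mact (walk io mact m.+1 _ v) _) IH; last exact: ltnW.
set w := (_, _, _); rewrite -[iter m.+1 _ _]/w.1.2 mact_th /mright /=.
have -> : aright (acons (k, m) v.2) = acons (k, m.+1) v.2.
  by rewrite -(aright_block oa Hk Hm) iterS aright_block // ltnW.
by rewrite /aup ahead_acons /= addr0.
Qed.

Lemma walk_block_end v k : mok v -> (0 < k <= adown v.2)%N ->
  walk io mact (mmax k).+2 (v.1.2 + k%:R) v =
  (density_below v.1.1, iter (mmax k).+2 phi (v.1.2 + k%:R) + 1,
   if (k == 1)%N then acons (adown (aright v.2), 0%N) (aright v.2) else acons (k.-1, 0%N) v.2).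
Proof.
move=> ov Hk; have oa : address_ok v.2 by case/andP: ov.
rewrite -[LHS]/(mact (walk io mact (mmax k).+1 _ v) _) walk_block //.
set w := (_, _, _); rewrite -[iter (mmax k).+1 _ _]/w.1.2 mact_th /mright /=.
have -> : aright (acons (k, mmax k) v.2) =
    if (k == 1)%N then acons (adown (aright v.2), 0%N) (aright v.2) else acons (k.-1, 0%N) v.2.
  by rewrite -aright_block_end // iterS aright_block.
by case: eqP => _; rewrite /aup ahead_acons.
Qed.

Let NS : (N - 2).+2 = N. Proof. by lia. Qed.
Let walkN : walk io mact N = walk io mact (N - 2).+2. Proof. by rewrite NS. Qed.

Lemma iter_phi_pred j : io (iter (N - 1) phi j) = j - 1.
Proof.
have P : iter (N - 2).+2 phi j = j by rewrite NS.
have -> : (N - 1 = (N - 2).+1)%N by lia.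
by rewrite -[in RHS]P [in RHS]iterS /phi addrK.
Qed.

Lemma closed_down v k : mok v -> (1 < k <= adown v.2)%N ->
  walk io mact N (v.1.2 + k%:R) v = v.
Proof.
move=> ov /andP[k1 kD]; have Hk : (0 < k <= adown v.2)%N by rewrite ltnW.
rewrite walkN; have := walk_block_end ov Hk.
have -> : (k == 1)%N = false by apply/eqP; lia.
have -> : (mmax k).+2 = (N - 2).+1.
  by rewrite /mmax; have -> : (k == 1)%N = false by [apply/eqP; lia]; rewrite /=; lia.
move=> E; rewrite -[LHS]/(mact (walk io mact (N - 2).+1 _ v) _) E.
set w := (_, _, _).
have -> : iter (N - 2).+1 phi (v.1.2 + k%:R) = w.1.2 - 1 by rewrite /w /= addrK.
rewrite mact_up; last by rewrite /w /= /aup ahead_acons.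
rewrite /mup /w /= addrK ahead_acons atail_acons -iterS.
have -> : (N - 2).+1 = (N - 1)%N by lia.
rewrite iter_phi_pred density_belowK; last by case/andP: ov.
have -> : k%:R = k.-1%:R + 1 :> 'Z_N by rewrite natr1; congr _%:R; lia.
have -> : v.1.2 + (k.-1%:R + 1) - 1 - k.-1%:R = v.1.2 by ring.
by case: (v) => [[]].
Qed.

(** The walk runs through the last block of [v] to the first child of the right neighbour, goes up
    to that neighbour, and returns left to [v]. *)
Lemma closed_down1 v : mok v -> walk io mact N (v.1.2 + 1) v = v.
Proof.
move=> ov; have D1 := adown_gt1 v.2.
have Hk : (0 < 1 <= adown v.2)%N by lia.
have := walk_block_end ov Hk; have -> : (mmax 1).+2 = (N - 2)%N by rewrite /mmax /=; lia.
rewrite walkN /= => E; rewrite -[LHS]/(mact (mact (walk io mact (N - 2) _ v) _) _) E.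
set w := (_, _, _).
have wE : iter (N - 2) phi (v.1.2 + 1) = w.1.2 - 1 by rewrite /w /= addrK.
rewrite wE mact_up; last by rewrite /w /= /aup ahead_acons.
have P1 : iter (N - 2).+1 phi (v.1.2 + 1) = io v.1.2.
  by rewrite -[LHS]ioK; have -> : (N - 2).+1 = (N - 1)%N by [lia]; rewrite iter_phi_pred addrK.
have P2 : io (iter (N - 2) phi (v.1.2 + 1)) = io v.1.2 - 1.
  by rewrite -P1 iterS {2}/phi addrK.
have -> : mup w = mact v v.1.2.
  rewrite mact_th /mup /w /= addrK ahead_acons atail_acons P2 density_belowK; last by case/andP: ov.
  by congr (_, _, _); rewrite adownE /phi; ring.
by rewrite -wE -iterS P1 mactK.
Qed.

Lemma closed_left v : mok v -> walk io mact N (mlpos v) v = v.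
Proof.
move=> ov; apply: closed_step => //; rewrite mact_lpos.
have ol : mok (mleft v) by rewrite -mact_lpos mact_ok.
by have := closed_down1 ol; rewrite {1}/mleft.
Qed.

(** Seen from the parent, the vertex lies between its children [k + 1] and [k], or between its left
    side and its leftmost child. *)
Lemma closed_up v : mok v -> aup v.2 -> walk io mact N (v.1.2 - 1) v = v.
Proof.
move=> ov u; apply: closed_step => //; rewrite mact_up //.
have ou : mok (mup v) by rewrite -mact_up // mact_ok.
have [/andP[_ oa]] := (ov, I); have /and3P[k0 kD _] := ahead_ok oa.
have -> : phi (v.1.2 - 1) = (mup v).1.2 + (ahead v.2).1.+1%:R.
  by rewrite /mup /= /phi -natr1 addrA subrK.
move: kD; rewrite leq_eqVlt => /orP[/eqP kD|kD].
  by rewrite [in _.+1%:R]kD -mlposE closed_left.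
by rewrite closed_down // ltnS k0.
Qed.

(** Turning this way follows the upper border of the row up to the first cell joined to its parent
    by an edge; the induction is on the number of cells left in the block. *)
Lemma closed_right v : mok v -> walk io mact N v.1.2 v = v.
Proof.
have [n] := ubnP (mmax (ahead v.2).1 - (ahead v.2).2)%N.
elim: n v => // n IH v Hn ov; apply: closed_step => //; rewrite mact_th.
have orv : mok (mright v) by rewrite -mact_th mact_ok.
have [u|nu] := boolP (aup (aright v.2)).
  have -> : phi v.1.2 = (mright v).1.2 - 1 by rewrite /mright /= u addrK.
  exact: closed_up.
have -> : phi v.1.2 = (mright v).1.2 by rewrite /mright /= (negbTE nu) addr0.
apply: IH => //; have /andP[_ oa] := ov; move: nu Hn.
have := aright_acons (atail_ok oa) (ahead_ok oa); rewrite acons_eta // => E.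
rewrite /mright /= /aup E; case: ifP => _; first by rewrite ahead_acons.
rewrite ahead_acons /next_coords; case: ifP => //= lt _; lia.
Qed.

Lemma mact_closed v j : mok v -> walk io mact N j v = v.
Proof.
move=> ov; have E : j = v.1.2 + (j - v.1.2) by rewrite addrC subrK.
case: (mactP v j) => [|k Hk||u]; first exact: closed_right.
- have [k1|k1] := eqVneq k 1%N; first by rewrite k1; exact: closed_down1.
  by apply: closed_down => //; lia.
- exact: closed_left.
- exact: closed_up.
Qed.

Definition line_pos v : R := v.1.1 * apos v.2.
Definition line_start v : R := v.1.1 * (apos v.2 - alen v.2).
(** The number of integers in the half-open interval occupied by the cell when its row is scaled by
    the density: a Beatty sequence with respect to the lengths. *)
Definition marks v := absz (Num.floor (line_pos v) - Num.floor (line_start v))%R.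
(** Abscissas are multiplied exactly by the multiplier from a row to the next; the carry is the
    defect of their integer parts at the left end. *)
Definition carry v := absz (Num.floor ((multiplier v.1.1)%:R * line_start v) -
  (multiplier v.1.1)%:Z * Num.floor (line_start v))%R.

Let ell_mid1 : 1 <= ell_mid. Proof. exact: ell_mid_ge1. Qed.
Let ell_up1 : 1 <= ell_up N R.
Proof. by rewrite /ell_up -natrM (ler_nat _ 1) muln_gt0; lia. Qed.

Lemma alen_bound t : 1 <= alen t <= ell_up N R + ell_mid.
Proof.
have m1 := ell_mid1; have u1 := ell_up1.
by rewrite /alen /cell_length; case: aup; apply/andP; split; lra.
Qed.

Lemma line_startD v : line_pos v = line_start v + v.1.1 * alen v.2.
Proof. by rewrite /line_pos /line_start; ring. Qed.

Lemma marksE v : mok v ->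
  (marks v)%:Z = Num.floor (line_pos v) - Num.floor (line_start v) /\ (0 < marks v)%N.
Proof.
case/andP=> /andP[a1 _] _; have /andP[l1 _] := alen_bound v.2.
have s1 : 1 <= v.1.1 * alen v.2 by rewrite -[1]mulr1 ler_pM.
have := floorD_gt (line_start v) s1; rewrite -line_startD /marks => m0.
by rewrite -ltz_nat gtz0_abs.
Qed.

(** Densities are below [(q0 + 1) / q0 <= 2] and lengths at most [ell_up + ell_mid], so [b] bounds
    the scaled lengths. The single bound [truncn b + q0 + 5] then serves for the marks, less than
    [truncn b + 2], and for the carries, at most [q0 + 1]. *)
Let b := 2 * (ell_up N R + ell_mid).

Lemma marks_bound v : mok v -> (marks v < Num.truncn b + q0 + 5)%N.
Proof.
move=> ov; have [E _] := marksE ov.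
case/andP: ov => /andP[a1 a2] _; have /andP[l1 l2] := alen_bound v.2.
have a3 : v.1.1 <= 2.
  rewrite (le_trans (ltW a2)) // ler_pdivrMr // -natrM ler_nat mul2n -addnn -addn1.
  by rewrite leq_add2l.
have s2 : v.1.1 * alen v.2 <= b by apply: ler_pM => //; exact: le_trans ler01 _.
have := floorD_lt (line_start v) s2; rewrite -line_startD -E ltz_nat => /leq_trans.
by apply; rewrite -addn2 -addnA leq_add2l addnC.
Qed.

Lemma carryE v :
  (carry v)%:Z = Num.floor ((multiplier v.1.1)%:R * line_start v) -
    (multiplier v.1.1)%:Z * Num.floor (line_start v) /\
  (carry v < Num.truncn b + q0 + 5)%N.
Proof.
have /andP[c0 c1] := floorM_nat (multiplier v.1.1) (line_start v).
have E := gez0_abs c0; split=> //; move: c1; rewrite -E lez_nat => c1.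
apply: (leq_ltn_trans c1); rewrite /multiplier -addnA ltn_addl // ltn_add2l.
by case: (_ < _).
Qed.

Let M := (Num.truncn b + q0 + 5)%N.
Let N0 : (0 < N)%N. Proof. by lia. Qed.
Let M0 : (0 < M)%N. Proof. by rewrite /M addn_gt0 orbT. Qed.

(** The reductions modulo N and M only make the function total: on valid cells the values are
    already smaller. *)
Definition mcell_info v : cell N M :=
  (v.1.2, (Ordinal (ltn_pmod (ahead v.2).1 N0), Ordinal (ltn_pmod (ahead v.2).2 N0)),
   v.1.1 < lam / q0%:R,
   (Ordinal (ltn_pmod (marks v) M0), Ordinal (ltn_pmod (carry v) M0))).

Lemma info_k v : mok v -> kk mcell_info v = (ahead v.2).1.
Proof.
case/andP=> _ /ahead_ok/and3P[_ kD _]; rewrite /kk /= modn_small //.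
by move: kD; rewrite /adown; lia.
Qed.

Lemma info_m v : mok v -> mm mcell_info v = (ahead v.2).2.
Proof.
case/andP=> _ /ahead_ok/and3P[_ _ mD]; rewrite /mm /= modn_small //.
by move: mD; rewrite /mmax; lia.
Qed.

Lemma info_up v : mok v -> has_up mcell_info v = aup v.2.
Proof. by move=> ov; rewrite /has_up info_m. Qed.

Lemma info_down v : mok v -> ndown mcell_info v = adown v.2.
Proof. by move=> ov; rewrite /ndown info_up. Qed.

Lemma info_a v : mok v -> aa mcell_info v = marks v.
Proof. by move=> ov; rewrite /aa /= modn_small // marks_bound. Qed.

Lemma info_c v : cc mcell_info v = carry v.
Proof. by rewrite /cc /= modn_small //; have [] := carryE v. Qed.

Lemma mright_start v : mok v -> line_start (mright v) = line_pos v.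
Proof. by case/andP=> _ oa; rewrite /line_start /= apos_aright. Qed.

Lemma marks_telescope n v : mok v ->
  (\sum_(i < n) marks (iter i mright v))%:Z =
  Num.floor (line_start (iter n mright v)) - Num.floor (line_start v).
Proof.
move=> ov; elim: n => [|n IH]; first by rewrite big_ord0 subrr.
have on : mok (iter n mright v).
  by elim: (n) => //= m; rewrite -mact_th; exact: mact_ok.
rewrite big_ord_recr PoszD IH iterS mright_start //.
by have [-> _] := marksE on; ring.
Qed.

Lemma iter_mright n v : exists th, iter n mright v = (v.1.1, th, iter n aright v.2).
Proof.
elim: n => [|n [th /= ->]]; first by exists v.1.2; case: v => [[]].
by eexists; rewrite /mright /=.
Qed.

(** The marks telescope to differences of integer parts. The children of [v] occupy the interval of
    [v] multiplied by the multiplier, and the two carries compare [floor (q y)] with [q * floor y]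
    at its two ends. *)
Lemma model_rule_a v : mok v ->
  (\sum_(i < ((N - 2) * adown v.2).-1) marks (iter i mright (mdown v (adown v.2))) + carry v
   = multiplier v.1.1 * marks v + carry (mright v))%N.
Proof.
move=> ov; have /andP[da oa] := ov; have D1 := adown_gt1 v.2.
have od : mok (mdown v (adown v.2)) by rewrite -mact_down ?mact_ok ?adown_range.
apply/eqP; rewrite -eqz_nat !PoszD PoszM marks_telescope //.
have [Ec _] := carryE v; have [Ecr _] := carryE (mright v); have [Em _] := marksE ov.
rewrite {}Ec {}Ecr {}Em mright_start //.
have below_start w t : w.1.1 = density_below v.1.1 ->
    w.2 = acons (adown t, 0%N) t ->
    line_start w = (multiplier v.1.1)%:R * (v.1.1 * (apos t - alen t)).
  move=> E1 E2; rewrite /line_start E1 E2 apos_first /density_below.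
  by rewrite mulrA divfK ?gt_eqF // mulrAC mulrA mulrC mulrA.
set n := _.-1; have [th Eth] := iter_mright n (mdown v (adown v.2)).
rewrite (below_start (iter n _ _) (aright v.2)) ?Eth ?aright_children //.
rewrite (below_start (mdown v (adown v.2)) v.2) // apos_aright //.
rewrite -/(line_start v) -/(line_pos v).
by apply/eqP; ring.
Qed.

Lemma model_local_rule v : mok v -> local_rule io q0 mact mcell_info v.
Proof.
move=> ov; have /andP[da oa] := ov; have /and3P[k0 kD mk] := ahead_ok oa.
have rE w : right mact mcell_info w = mright w by rewrite /right mact_th.
have or : mok (mright v) by rewrite -mact_th mact_ok.
have lE : lpos mcell_info v = mlpos v by rewrite /lpos info_up.
have ar := aright_acons (atail_ok oa) (ahead_ok oa); rewrite acons_eta // in ar.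
have dE k : down mact mcell_info v k = mact v (v.1.2 + k%:R) by [].
split.
- by rewrite info_k.
- by rewrite info_k // info_m.
- by rewrite rE info_up.
- by rewrite rE.
- rewrite rE !info_k // !info_m // /mright /= ar => lt.
  have -> : last_coords (ahead v.2) = false.
    by apply/negP => /andP[/eqP E1 /eqP E2]; move: lt; rewrite E1 E2 ltnn.
  by rewrite ahead_acons /next_coords lt.
- rewrite rE info_k // !info_m // /mright /= ar => E.
  case: ifP => _; rewrite ahead_acons // /next_coords E ltnn //.
- by rewrite /left lE mact_lpos.
- rewrite info_up // => u; rewrite /up mact_up //.
  have ou : mok (mup v) by rewrite -mact_up // mact_ok.
  by rewrite info_k // info_down //= subrK.
- move=> k; rewrite info_down // => Hk; rewrite dE mact_down //.
  have od : mok (mdown v k) by rewrite -mact_down // mact_ok.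
  by rewrite info_k // info_m //= ahead_acons.
- rewrite rE !info_c (info_a ov) -model_rule_a //; congr (_ + _)%N.
  rewrite /nchildren /first_child info_down // dE mact_down ?adown_range //.
  apply: eq_bigr => i _; rewrite info_a //; last first.
    have od : mok (mdown v (adown v.2)).
      by rewrite -mact_down ?mact_ok ?adown_range.
    by elim: (nat_of_ord i) => //= m IH; rewrite rE -mact_th mact_ok.
  by congr marks; elim: (nat_of_ord i) => //= m <-; rewrite rE.
- by rewrite info_a //; have [] := marksE ov.
Qed.

Theorem model_config : exists (V : Type) (act : V -> 'Z_N -> V) (x : V -> cell N M) (v0 : V),
  surface_action io act /\ forall u : V, local_rule io q0 act x u.
Proof.
pose V := {v : mcell | mok v}.
pose act (u : V) j : V := exist _ (mact (val u) j) (mact_ok j (valP u)).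
have ok0 : mok (1, 0, [::]).
  by rewrite /mok /density_ok lexx /= ltr_pdivlMr // mul1r ltr_nat ltnSn.
exists V, act, (mcell_info \o val), (exist mok _ ok0); split; first split=> u j.
- by apply: val_inj; rewrite /= mactK // (valP u).
- apply: val_inj; rewrite -[RHS](mact_closed j (valP u)).
  have walk_val n : val (walk io act n j u) = walk io mact n j (val u).
    by elim: n => //= n <-.
  exact: walk_val.
- move=> u; apply: (local_rule_pullback (act' := mact)) => //.
  exact: model_local_rule (valP u).
Qed.

End positions.
End addresses.

(** The larger root of [X^2 - T X + 1], real since [T >= 34]. *)
Lemma growth_rate_ex (R : realType) (N : nat) : (7 < N)%N ->
  exists2 lam : R, 1 < lam & lam ^+ 2 = ((N - 2) ^ 2 - 2)%:R * lam - 1.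
Proof.
move=> N7; have T34 : (34 <= (N - 2) ^ 2 - 2)%N.
  by have : (6 ^ 2 <= (N - 2) ^ 2)%N by [rewrite leq_sqr; lia]; lia.
have T34R : 34 <= ((N - 2) ^ 2 - 2)%:R :> R by rewrite (ler_nat R 34).
move: (((N - 2) ^ 2 - 2)%:R : R) T34R => T T34R.
have d0 : 0 <= T ^+ 2 - 4.
  have -> : T ^+ 2 - 4 = (T - 2) * (T + 2) by ring.
  by apply: mulr_ge0; lra.
have s0 := sqrtr_ge0 (T ^+ 2 - 4); have s2 := sqr_sqrtr d0.
exists ((T + Num.sqrt (T ^+ 2 - 4)) / 2); first by lra.
move: s2; move: (Num.sqrt _) => d d2.
have -> : ((T + d) / 2) ^+ 2 = (T ^+ 2 + T * d *+ 2 + d ^+ 2) / 4 by field.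
by rewrite d2; field.
Qed.

(** * From generators and relations to the subshift *)

Section surface_presentation.
Variables (R : realType) (N : nat) (io : 'Z_N -> 'Z_N).
Hypothesis N_gt7 : (7 < N)%N.
Hypothesis ioK : involutive io.
Hypothesis iter_phi : forall j, iter N (next_side io) j = j.
Variables (G : groupType) (s : 'Z_N -> G).
Let act (g : G) j := (g * s j)%g.
Hypothesis s_io : forall j, (s j * s (io j) = 1)%g.
Hypothesis s_walk : forall j, walk io act N j 1%g = 1%g.
Hypothesis s_gen : forall g, exists js, g = foldl act 1%g js.
(** The form in which the completeness of the relations enters: G maps to every inhabited set of
    tiles on which they hold. *)
Hypothesis monodromy : forall (V : Type) (actV : V -> 'Z_N -> V), V ->
  surface_action io actV -> exists e : G -> V, forall g j, e (g * s j)%g = actV (e g) j.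

Theorem strongly_aperiodic_sft_of_presentation : admits_strongly_aperiodic_sft G.
Proof.
have act_surface : surface_action io act.
  split=> v j; first by rewrite /act -mulgA s_io mulg1.
  have W n : walk io act n j v = (v * walk io act n j 1)%g.
    by elim: n => [|n IH] /=; rewrite ?mulg1 // /act IH -mulgA.
  by rewrite W s_walk mulg1.
have [lam lam1 lamE] := growth_rate_ex R N_gt7.
have lq : (Num.truncn lam)%:R <= lam < (Num.truncn lam).+1%:R.
  by rewrite truncn_itv // ltW // (lt_trans ltr01).
have q0 : (0 < Num.truncn lam)%N by rewrite truncn_gt0 ltW.
have [V [actV [x [v0 [sV rV]]]]] := model_config N_gt7 lam1 lamE ioK iter_phi q0 lq.
have [e eE] := monodromy v0 sV.
apply: (strongly_aperiodic_sft_of_local_rules N_gt7 ioK iter_phi act_surface s_gen lam1 lamE q0 (x0 := x \o e)).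
by move=> h; apply: local_rule_pullback.
Qed.

End surface_presentation.

(** * Paths and their lifts *)

Lemma continuous_compose (A B D : topologicalType) (f : A -> B) (g : B -> D) :
  continuous f -> continuous g -> continuous (fun t => g (f t)).
Proof. by move=> cf cg t; apply: (@continuous_comp _ _ _ f g); [exact: cf | exact: cg]. Qed.

Lemma continuous_pair (A B D : topologicalType) (f : A -> B) (g : A -> D) :
  continuous f -> continuous g -> continuous (fun t => (f t, g t)).
Proof. by move=> cf cg t; exact: cvg_pair (cf t) (cg t). Qed.

Lemma continuous_cst (A B : topologicalType) (b : B) : continuous (fun _ : A => b).
Proof. by move=> t; exact: cvg_cst. Qed.

Lemma continuous_idfun (A : topologicalType) : continuous (fun t : A => t).
Proof. by move=> t; exact: cvg_id. Qed.

Section path_calculus.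
Context {R : realType} {X : topologicalType}.
Local Notation I := (unit_interval R).
Local Notation path x y := {path I from x to y in X}.

Definition pcat x y z (p : path x y) (p' : path y z) : path x z := path_concat p p'.
Definition prev x y (p : path x y) : path y x := path_reverse p.

Lemma real_path_continuous (f : R -> X) : continuous f ->
  continuous (fun t : I => f (val t)).
Proof.
move=> cf t; apply: (@continuous_comp _ _ _ (val : I -> R) f).
  exact: unit_val_continuous.
exact: cf.
Qed.

Section of_real.
Variables (f : R -> X) (cf : continuous f) (x y : X) (f0 : f 0 = x) (f1 : f 1 = y).
Let g (t : I) := f (val t).
Let g0 : g zero = x. Proof. by rewrite /g val_zero. Qed.
Let g1 : g one = y. Proof. by rewrite /g val_one. Qed.
Definition real_path : path x y := mk_path (real_path_continuous cf) g0 g1.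
Lemma real_pathE t : real_path t = f (val t). Proof. by []. Qed.
End of_real.

Lemma path_homotopic_ext x y (p p' : path x y) : p =1 p' -> path_homotopic p p'.
Proof. by move/path_eqP => ->; exact: path_homotopic_refl. Qed.

Hint Extern 0 (path_homotopic _ _) => exact: path_homotopic_refl : core.

#[global] Instance path_homotopic_equiv x y : RelationClasses.Equivalence (@path_homotopic R X x y).
Proof.
split=> [p|p p'|p p' p'']; [exact: path_homotopic_refl | exact: path_homotopic_sym |
  exact: path_homotopic_trans].
Qed.

#[global] Instance pcat_proper x y z : Morphisms.Proper
  (Morphisms.respectful (@path_homotopic R X x y)
    (Morphisms.respectful (@path_homotopic R X y z) (@path_homotopic R X x z))) (@pcat x y z).
Proof. by move=> p p' pp' r r' rr'; exact: path_concat_homotopic. Qed.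

#[global] Instance prev_proper x y : Morphisms.Proper
  (Morphisms.respectful (@path_homotopic R X x y) (@path_homotopic R X y x)) (@prev x y).
Proof. by move=> p p' pp'; exact: path_reverse_homotopic. Qed.

Local Notation "p ~~ p'" := (path_homotopic p p') (at level 70).

Lemma pcatA x y z w (p : path x y) (p' : path y z) (p'' : path z w) :
  pcat (pcat p p') p'' ~~ pcat p (pcat p' p'').
Proof. by symmetry; exact: path_concatA. Qed.

Lemma pcat1p x y (p : path x y) : pcat (cst_path x) p ~~ p.
Proof. exact: path_concat1p. Qed.

Lemma pcatp1 x y (p : path x y) : pcat p (cst_path y) ~~ p.
Proof. exact: path_concatp1. Qed.

Lemma pcatpV x y (p : path x y) : pcat p (prev p) ~~ cst_path x.
Proof. exact: path_concatpV. Qed.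

Lemma pcatVp x y (p : path x y) : pcat (prev p) p ~~ cst_path y.
Proof. exact: path_concatVp. Qed.

Lemma pcatKV x y z (p : path x y) (p' : path x z) : pcat p (pcat (prev p) p') ~~ p'.
Proof. by rewrite -pcatA pcatpV pcat1p. Qed.

Lemma pcatVK x y z (p : path y x) (p' : path x z) : pcat (prev p) (pcat p p') ~~ p'.
Proof. by rewrite -pcatA pcatVp pcat1p. Qed.

Lemma prev_cat x y z (p : path x y) (p' : path y z) :
  prev (pcat p p') ~~ pcat (prev p') (prev p).
Proof.
transitivity (pcat (prev (pcat p p')) (pcat (pcat p p') (pcat (prev p') (prev p)))).
  by rewrite pcatA pcatKV pcatpV pcatp1.
by rewrite pcatVK.
Qed.

(** The curve [(f, g)] runs along the other three sides of the square at the speeds of the nested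
    concatenation (a half, a quarter, a quarter); the straight-line homotopy in the plane of
    parameters joins it to the side [(0, t)]. *)
Lemma path_square (H : R * R -> X) (x y u v : X) (p : path x y) (a : path x u)
    (p' : path u v) (b : path y v) : continuous H ->
  (forall t : I, p t = H (0, val t)) -> (forall t : I, a t = H (val t, 0)) ->
  (forall t : I, p' t = H (1, val t)) -> (forall t : I, b t = H (val t, 1)) ->
  p ~~ pcat a (pcat p' (prev b)).
Proof.
move=> cH pE aE p'E bE.
pose f (t : R) := Num.min (2 * t) (Num.min 1 (4 - 4 * t)).
pose g (t : R) := Num.max 0 (Num.min (4 * t - 2) 1).
have cf : continuous f.
  apply: min_real_continuous; first exact/mull_continuous/id_real_continuous.
  apply: min_real_continuous; first by move=> t; exact: cvg_cst.
  exact/subl_continuous/mull_continuous/id_real_continuous.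
have cg : continuous g.
  apply: max_real_continuous; first by move=> t; exact: cvg_cst.
  apply: min_real_continuous; last by move=> t; exact: cvg_cst.
  exact/subr_continuous/mull_continuous/id_real_continuous.
exists (fun st => H (val st.1 * f (val st.2),
  (1 - val st.1) * val st.2 + val st.1 * g (val st.2))).
have f_l t : t <= 2^-1 -> f t = 2 * t.
  by move=> th; apply/min_idPl; rewrite le_min; apply/andP; split; lra.
have f_m t : 2^-1 <= t <= 3 / 4 -> f t = 1.
  move=> th; rewrite /f; have -> : Num.min 1 (4 - 4 * t) = 1 by apply/min_idPl; lra.
  by apply/min_idPr; lra.
have f_r t : 3 / 4 <= t -> f t = 4 - 4 * t.
  move=> th; rewrite /f; have -> : Num.min 1 (4 - 4 * t) = 4 - 4 * t by apply/min_idPr; lra.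
  by apply/min_idPr; lra.
have g_l t : t <= 2^-1 -> g t = 0.
  by move=> th; apply/max_idPl; rewrite ge_min; apply/orP; left; lra.
have g_m t : 2^-1 <= t <= 3 / 4 -> g t = 4 * t - 2.
  move=> th; rewrite /g; have -> : Num.min (4 * t - 2) 1 = 4 * t - 2 by apply/min_idPl; lra.
  by apply/max_idPr; lra.
have g_r t : 3 / 4 <= t -> g t = 1.
  move=> th; rewrite /g; have -> : Num.min (4 * t - 2) 1 = 1 by apply/min_idPr; lra.
  by apply/max_idPr; lra.
have x0 := path_zero (s := p); have y1 := path_one (s := p).
split=> [st|t|t|s|s]; cbn [fst snd].
- apply: (@continuous_comp _ _ _ (fun st : I * I => (val st.1 * f (val st.2),
    (1 - val st.1) * val st.2 + val st.1 * g (val st.2))) H); last exact: cH.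
  have cc h : continuous h -> continuous (fun st : I * I => h (val st.2) : R).
    move=> ch z; apply: (@continuous_comp _ _ _ (fun st : I * I => val st.2) h); last exact: ch.
    exact: snd_val_continuous.
  have A : continuous (fun st : I * I => val st.1 * f (val st.2)).
    by move=> z; apply: cvgM; [exact: fst_val_continuous | exact: cc].
  have B : continuous (fun st : I * I => (1 - val st.1) * val st.2 + val st.1 * g (val st.2)).
    move=> z; apply: cvgD; apply: cvgM; try exact: fst_val_continuous.
    + exact: subl_continuous fst_val_continuous z.
    + exact: snd_val_continuous.
    + exact: cc.
  exact: cvg_pair (A st) (B st).
- by rewrite val_zero !mul0r subr0 mul1r addr0 pE.
- rewrite val_one subrr mul0r add0r !mul1r.
  have /andP[t0 t1] := unit_val_itv t.
  rewrite [RHS]path_concatE; case: ifPn => th.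
    by rewrite aE to_unitE ?f_l ?g_l //; lra.
  rewrite -ltNge in th; rewrite path_concat_to_unit; case: ifPn => th'.
    rewrite p'E to_unitE; last by lra.
    by rewrite f_m ?g_m; [congr (H (_, _)); lra | lra | lra].
  rewrite -ltNge in th'; rewrite path_reverse_to_unit bE to_unitE; last by lra.
  by rewrite f_r ?g_r; [congr (H (_, _)); lra | lra | lra].
- have f0 : f 0 = 0 by rewrite f_l ?mulr0 //; lra.
  have g0 : g 0 = 0 by rewrite g_l //; lra.
  by rewrite val_zero f0 g0 !mulr0 addr0 -[in RHS]x0 pE val_zero.
- have f1 : f 1 = 0 by rewrite f_r ?mulr1 ?subrr //; lra.
  have g1 : g 1 = 1 by rewrite g_r //; lra.
  by rewrite val_one f1 g1 mulr0 !mulr1 subrK -[in RHS]y1 pE val_one.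
Qed.

End path_calculus.
Notation "p ~~ p'" := (path_homotopic p p') (at level 70).

(** * Locally constant properties of a real parameter *)

Section locally_constant.
Variable R : realType.
Implicit Types (Phi : R -> Prop) (a b t : R).

(** The property and its negation define open sets, and the line is connected. This takes the place
    of subdivisions of paths in all the lifting arguments. *)
Lemma locally_constant_line Phi : (forall t, \forall t' \near t, Phi t' <-> Phi t) ->
  forall a b, Phi a -> Phi b.
Proof.
move=> loc a b Pa.
have cR : connected [set: R] by apply/connected_intervalP => x y z.
suff E : (Phi : set R) = setT by have : [set: R] b by []; rewrite -E.
have oP : open (Phi : set R).
  rewrite openE => t Pt; have := loc t; apply: filterS => t' H; exact/H.
have oNP : open (~` (Phi : set R)).
  rewrite openE => t Pt; have := loc t; apply: filterS => t' H Pt'; exact/Pt/H.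
apply: cR; first by exists a.
- by exists (Phi : set R) => //; rewrite setTI.
- by exists (Phi : set R); [rewrite -openC|rewrite setTI].
Qed.

Lemma clamp_continuous a b : continuous (fun t : R => Num.max a (Num.min b t)).
Proof.
apply: max_real_continuous; first by move=> t; exact: cvg_cst.
by apply: min_real_continuous; [move=> t; exact: cvg_cst | exact: id_real_continuous].
Qed.

Lemma clamp_id a b t : a <= t <= b -> Num.max a (Num.min b t) = t.
Proof. by case/andP=> ? ?; rewrite (min_idPr _) // (max_idPr _). Qed.

Lemma clamp_itv a b t : a <= b -> a <= Num.max a (Num.min b t) <= b.
Proof. by move=> ab; rewrite le_max lexx ge_max ab ge_min lexx. Qed.

Lemma locally_constant_itv Phi a b :
  (forall t, a <= t <= b -> \forall t' \near t, a <= t' <= b -> (Phi t' <-> Phi t)) ->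
  forall t t', a <= t <= b -> a <= t' <= b -> Phi t -> Phi t'.
Proof.
move=> loc t t' Ht Ht'; have ab : a <= b by case/andP: Ht; exact: le_trans.
rewrite -(clamp_id Ht) -(clamp_id Ht').
apply: (@locally_constant_line (fun t => Phi (Num.max a (Num.min b t)))) => u.
pose k v := Num.max a (Num.min b v).
have H : \forall u' \near u, a <= k u' <= b -> (Phi (k u') <-> Phi (k u)).
  exact: @clamp_continuous a b u _ (loc _ (clamp_itv u ab)).
by apply: filterS H => u'; apply; exact: clamp_itv.
Qed.

End locally_constant.

(* The covering is given by a set E without topology: over an open set U c, the
   function lab c sends a point of E to its sheet. *)
Section monodromy.
Context {R : realType} {X : topologicalType} {E V C : Type}.
Variables (pr : E -> X) (U : C -> set X) (lab : C -> E -> V).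
Hypothesis U_open : forall c y, U c y -> nbhs y (U c).
Hypothesis U_cover : forall y, exists c, U c y.
Hypothesis lab_surj : forall c y v, U c y -> exists2 e, pr e = y & lab c e = v.
Hypothesis lab_loc : forall c d y, U c y -> U d y -> exists2 W, nbhs y W &
  forall e e', W (pr e) -> W (pr e') -> lab c e = lab c e' -> lab d e = lab d e'.
Implicit Types (p : R -> X) (f : R -> E).

(** Elements of [E] are only representatives; this is equality of the points of the covering for
    which they stand. *)
Definition sheet_eq e e' := pr e = pr e' /\ forall c, U c (pr e) -> lab c e = lab c e'.

Lemma sheet_eq1 c e e' : pr e = pr e' -> U c (pr e) -> lab c e = lab c e' -> sheet_eq e e'.
Proof.
move=> ee' Uc L; split=> // d Ud.
have [W /nbhs_singleton We HW] := lab_loc Uc Ud.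
by apply: HW => //; rewrite -ee'.
Qed.

Lemma sheet_eq_refl e : sheet_eq e e. Proof. by []. Qed.

Lemma sheet_eq_sym e e' : sheet_eq e e' -> sheet_eq e' e.
Proof. by case=> E1 E2; split=> // c; rewrite -E1 => /E2. Qed.

Lemma sheet_eq_trans e' e e'' : sheet_eq e e' -> sheet_eq e' e'' -> sheet_eq e e''.
Proof.
case=> E1 E2 [F1 F2]; split=> [|c Uc]; first by rewrite E1.
by rewrite E2 // F2 // -E1.
Qed.

(** Continuity of the lift is expressed by its sheet being locally constant in each chart. *)
Definition is_lift p f := (forall t, pr (f t) = p t) /\
  forall c t, U c (p t) -> \forall t' \near t, lab c (f t') = lab c (f t).

Lemma lift_comp p f (h : R -> R) : continuous h -> is_lift p f -> is_lift (p \o h) (f \o h).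
Proof.
move=> ch [pf lf]; split=> [t|c t Uc]; first exact: pf.
exact: ch t _ (lf c (h t) Uc).
Qed.

Lemma lift_const_itv p f c a b : is_lift p f ->
  (forall t, a <= t <= b -> U c (p t)) ->
  forall t t', a <= t <= b -> a <= t' <= b -> lab c (f t') = lab c (f t).
Proof.
move=> [pf lf] pU t t' Ht Ht'.
apply: (@locally_constant_itv R (fun u => lab c (f u) = lab c (f t)) a b _ t t') => // u Hu.
have := lf c u (pU u Hu); apply: filterS => u' -> _; by [].
Qed.

Lemma near_chart p t c : continuous p -> U c (p t) -> \forall t' \near t, U c (p t').
Proof. by move=> cp Uc; exact: cp t _ (U_open Uc). Qed.

Lemma lift_unique p f f' a b : continuous p -> is_lift p f -> is_lift p f' ->
  sheet_eq (f a) (f' a) -> sheet_eq (f b) (f' b).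
Proof.
move=> cp [pf lf] [pf' lf'].
apply: (@locally_constant_line R (fun t => sheet_eq (f t) (f' t))) => t.
have [c Uc] := U_cover (p t).
apply: filterS3 (near_chart cp Uc) (lf c t Uc) (lf' c t Uc) => t' Ut' E1 E2; split=> -[F1 F2].
- by apply: (@sheet_eq1 c); rewrite ?pf ?pf' // -E1 -E2 F2 // pf.
- by apply: (@sheet_eq1 c); rewrite ?pf ?pf' // E1 E2 F2 // pf.
Qed.

(** The chart [c] contains the path from a time before [b] on, and the new piece stays in the sheet
    of [f b]; so the label in [c] is constant across the junction. *)
Lemma lift_patch p p0 f a b c e : continuous p -> a < b -> is_lift p0 f ->
  (forall t, t <= b -> p0 t = p t) -> (forall t, a < t -> U c (p t)) ->
  (forall t, pr (e t) = p t) -> (forall t, b < t -> lab c (e t) = lab c (f b)) ->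
  is_lift p (fun t => if t <= b then f t else e t).
Proof.
move=> cp ab lf p0p pU pe Le; set f' := fun t => _.
have labE t : a < t -> lab c (f' t) = lab c (f b).
  move=> at_; rewrite /f'; case: ifPn => [tb|]; last by rewrite -ltNge; exact: Le.
  apply: (lift_const_itv (a := t) (b := b) lf); rewrite ?tb ?lexx //.
  by move=> u /andP[tu ub]; rewrite p0p //; apply/pU/(lt_le_trans at_).
have pf' t : pr (f' t) = p t.
  by rewrite /f'; case: ifP => // tb; rewrite -p0p //; case: lf.
split=> // d t Ud; have [at_|ta] := ltP a t.
  have [W Wt HW] := lab_loc (pU t at_) Ud.
  have Wp : \forall t' \near t, W (p t') by exact: cp t _ Wt.
  apply: filterS2 Wp (lt_nbhsr at_) => t' Wt' at'.
  by apply: HW; rewrite ?pf' ?labE //; exact: nbhs_singleton.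
have tb : t < b by apply: le_lt_trans ab.
case: lf => pf lf; rewrite -p0p ?(ltW tb) // in Ud.
apply: filterS2 (lf d t Ud) (lt_nbhsl tb) => t' E' /ltW t'b.
by rewrite /f' t'b (ltW tb) E'.
Qed.

(** For the path stopped at time [b], being liftable is locally constant in [b]: near any time the
    path stays in one chart, where it can be followed in a constant sheet or cut back. *)
Lemma lift_exists p e : continuous p -> pr e = p 0 ->
  (forall t, p t = p (Num.max 0 (Num.min 1 t))) ->
  exists2 f, is_lift p f & f 0 = e.
Proof.
move=> cp e0 p01.
pose cut b t := p (Num.max 0 (Num.min b t)).
pose liftable b := exists2 f, is_lift (cut b) f & f 0 = e.
have ccut b : continuous (cut b).
  by apply: continuous_compose cp; exact: clamp_continuous.
suff [f lf f0] : liftable 1.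
  by exists f => //; case: lf => pf lf; split=> [t|c t]; rewrite ?pf p01 //; exact: lf.
have l0 : liftable 0.
  have cut0 t : cut 0 t = p 0.
    by rewrite /cut; congr p; apply/max_idPl; rewrite ge_min lexx.
  exists (fun=> e) => //; split=> [t|c t _]; first by rewrite cut0.
  by near=> t'.
have I0 : 0 <= (0 : R) <= 1 by rewrite lexx ler01.
have I1 : 0 <= (1 : R) <= 1 by rewrite lexx ler01.
apply: (@locally_constant_itv R liftable 0 1 _ 0 1 I0 I1 l0) => b0 Hb0.
have [c Uc] := U_cover (p b0).
have [d /= d0 pd] : exists2 d : R, 0 < d & forall t, `|t - b0| < d -> U c (p t).
  have /nbhs_ballP[d /= d0 Hd] := near_chart cp Uc; exists d => // t td; apply: Hd.
  by rewrite /ball /= distrC.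
suff ext b b' : 0 <= b -> 0 <= b' -> `|b - b0| < d -> `|b' - b0| < d -> liftable b -> liftable b'.
  have : \forall t' \near b0, `|t' - b0| < d.
    by apply/nbhs_ballP; exists d => // t'; rewrite /ball /= distrC.
  apply: filterS => t' Ht' /andP[t0 t1]; case/andP: Hb0 => b00 b01.
  by split; apply: ext => //; rewrite subrr normr0.
move=> b0' b'0 Hb Hb' [f lf f0].
have inb t : b0 - d < t -> U c (cut b' t) .
  move=> bt; rewrite /cut; apply: pd.
  move: Hb'; rewrite !ltr_distl => /andP[h1 h2].
  rewrite lt_max lt_min h1 bt orbT /=; rewrite gt_max gt_min h2 /= andbT.
  by apply: le_lt_trans h2.
(* The points are taken in the sheet of [f b] where the chart is available, and arbitrarily over the
   path elsewhere. *)
have [ev Hev] : {ev : R -> E | forall t, pr (ev t) = cut b' t /\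
    (b0 - d < t -> lab c (ev t) = lab c (f b))}.
  have H t : exists x, pr x = cut b' t /\ (b0 - d < t -> lab c x = lab c (f b)).
    have [bt|tb] := ltP (b0 - d) t.
      by have [x px lx] := @lab_surj c _ (lab c (f b)) (inb t bt); exists x.
    have [c' Uc'] := U_cover (cut b' t).
    by have [x px _] := @lab_surj c' _ (lab c (f b)) Uc'; exists x; split=> //.
  by exists (fun t => proj1_sig (cid (H t))) => t; exact: proj2_sig (cid (H t)).
have [bb'|bb'] := leP b' b.
  exists (f \o Num.min b'); last by rewrite /= (min_idPr b'0).
  have -> : cut b' = cut b \o Num.min b'.
    by apply/funext => t /=; rewrite /cut minA (min_idPr bb').
  apply: lift_comp => //; apply: min_real_continuous; first by move=> t; exact: cvg_cst.
  exact: id_real_continuous.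
have dt : b0 - d < b by move: Hb; rewrite ltr_distl => /andP[].
exists (fun t => if t <= b then f t else ev t); last by rewrite b0'.
apply: (lift_patch (p := cut b') (p0 := cut b) (c := c) _ dt lf) => //.
- move=> t tb; rewrite /cut (min_idPr tb) (min_idPr _) // ltW //.
  exact: le_lt_trans bb'.
- by move=> t; case: (Hev t).
- by move=> t bt; apply: (Hev t).2; exact: lt_trans bt.
Unshelve. all: by end_near.
Qed.

(** That the label at time [t] does not depend on the path near [s0] is a locally constant property
    of [t], by a product neighbourhood sent into one chart. At [t = 1], where all paths end at [y],
    it gives local constancy in the homotopy parameter. *)
Lemma lift_homotopy (H : R * R -> X) (x y : X) (f : R -> R -> E) (e : E) :
  continuous H ->
  (forall s, H (s, 0) = x) -> (forall s, H (s, 1) = y) ->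
  (forall s, is_lift (fun t => H (s, t)) (f s)) -> (forall s, f s 0 = e) ->
  forall s s', sheet_eq (f s 1) (f s' 1).
Proof.
move=> cH Hx Hy lf fe s s'.
have cHs s0 : continuous (fun t => H (s0, t)).
  apply: continuous_compose cH.
  by apply: continuous_pair; [exact: continuous_cst | exact: continuous_idfun].
have cHt t : continuous (fun s0 => H (s0, t)).
  apply: continuous_compose cH.
  by apply: continuous_pair; [exact: continuous_idfun | exact: continuous_cst].
suff loc s0 : \forall u \near s0, sheet_eq (f s0 1) (f u 1).
  apply: (@locally_constant_line R (fun u => sheet_eq (f s 1) (f u 1)) _ s s') => [s0|].
    apply: filterS (loc s0) => u Hu; split=> E1; apply: sheet_eq_trans E1 _ => //.
    exact: sheet_eq_sym.
  exact: sheet_eq_refl.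
suff [c [Uc E1]] : exists c, U c (H (s0, 1)) /\ \forall u \near s0, lab c (f u 1) = lab c (f s0 1).
  apply: filterS E1 => u E1; apply: (@sheet_eq1 c); rewrite ?(lf _).1 ?Hy //.
  by rewrite -(Hy s0).
pose Phi t := forall c, U c (H (s0, t)) -> \forall u \near s0, lab c (f u t) = lab c (f s0 t).
suff P1 : Phi 1.
  by have [c Uc] := U_cover (H (s0, 1)); exists c; split=> //; exact: P1.
have P0 : Phi 0 by move=> c _; near=> u; rewrite !fe.
apply: (@locally_constant_line R Phi _ 0 1) => // t0.
have [c Uc] := U_cover (H (s0, t0)).
have [[A B] /= [sA tB] AB] : nbhs (s0, t0) (H @^-1` U c) by exact: cH (U_open Uc).
have [d /= d0 Bd] : exists2 d : R, 0 < d & forall t, t0 - d <= t <= t0 + d -> B t.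
  have /nbhs_ballP[d /= d0 Bd] := tB; exists (d / 2); first by rewrite divr_gt0.
  by move=> t /andP[h1 h2]; apply: Bd; rewrite /ball /= ltr_norml; apply/andP; split; lra.
have const u t t' : A u -> t0 - d <= t <= t0 + d -> t0 - d <= t' <= t0 + d ->
    lab c (f u t') = lab c (f u t).
  move=> Au; apply: (lift_const_itv (lf u)) => v Hv.
  by apply: (AB (u, v)); split=> //; exact: Bd.
have step t1 t2 : t0 - d <= t1 <= t0 + d -> t0 - d <= t2 <= t0 + d -> Phi t1 -> Phi t2.
  move=> H1 H2 Phi1 c' Uc'.
  have As0 : A s0 by exact: nbhs_singleton.
  have U1 : U c (H (s0, t1)) by apply: (AB (s0, t1)); split=> //; exact: Bd.
  have U2 : U c (H (s0, t2)) by apply: (AB (s0, t2)); split=> //; exact: Bd.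
  have [W Ws HW] := lab_loc U2 Uc'.
  have Wn : \forall u \near s0, W (H (u, t2)) by exact: cHt Ws.
  apply: filterS3 Wn sA (Phi1 c U1) => u Wu Au E1.
  apply: HW; rewrite ?(lf _).1 //; first exact: nbhs_singleton.
  by rewrite (const u t1) // E1 (const s0 t1 t2).
have near_t0 : \forall t \near t0, t0 - d <= t <= t0 + d.
  apply/nbhs_ballP; exists d => // t; rewrite /ball /= ltr_norml => /andP[h1 h2].
  by apply/andP; split; lra.
apply: filterS near_t0 => t Ht.
have Ht0 : t0 - d <= t0 <= t0 + d by apply/andP; split; lra.
by split; exact: step.
Unshelve. all: by end_near.
Qed.

Local Notation I := (unit_interval R).
Local Notation path x y := {path I from x to y in X}.

Definition transports x y (p : path x y) (e e' : E) :=
  exists f, [/\ is_lift (fun t => p (to_unit t)) f, sheet_eq (f 0) e & sheet_eq (f 1) e'].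

Lemma to_unit_clamp (t : R) : to_unit (Num.max 0 (Num.min 1 t)) = to_unit t.
Proof. by rewrite -[RHS]to_unitK. Qed.

Lemma extended_path_continuous x y (p : path x y) : continuous (fun t => p (to_unit t)).
Proof. by apply: comp_to_unit_continuous; [exact: id_real_continuous | exact: cts_fun]. Qed.

Lemma path_to_unit0 x y (p : path x y) : p (to_unit 0) = x.
Proof. by rewrite to_unit_le0 // path_zero. Qed.

Lemma path_to_unit1 x y (p : path x y) : p (to_unit 1) = y.
Proof. by rewrite to_unit_ge1 // path_one. Qed.

Lemma transports_ex x y (p : path x y) e : pr e = x -> exists e', transports p e e'.
Proof.
move=> ex; have [||f lf fe] := @lift_exists (fun t => p (to_unit t)) e (@extended_path_continuous _ _ p).
- by rewrite path_to_unit0.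
- by move=> t; rewrite to_unit_clamp.
by exists (f 1), f; rewrite fe; split=> //; exact: sheet_eq_refl.
Qed.

Lemma transports_pr x y (p : path x y) e e' : transports p e e' -> pr e = x /\ pr e' = y.
Proof.
by case=> f [[pf _] [<- _] [<- _]]; rewrite !pf path_to_unit0 path_to_unit1.
Qed.

(** The intermediate paths are lifted from [e] independently of each other; uniqueness supplies the
    coherence and identifies the two extreme lifts with the given ones. *)
Lemma transports_homotopic x y (p p' : path x y) e e1 e2 : path_homotopic p p' ->
  transports p e e1 -> transports p' e e2 -> sheet_eq e1 e2.
Proof.
case=> H [cH Hp Hp' Hx Hy] T1 T2; have [ex _] := transports_pr T1.
case: T1 T2 => f1 [l1 f10 f11] [f2 [l2 f20 f21]].
pose H' (st : R * R) := H (to_unit st.1, to_unit st.2).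
have cH' : continuous H'.
  apply: continuous_compose cH; apply: continuous_pair; apply: to_unit_continuous => st.
    exact: cvg_fst.
  exact: cvg_snd.
have cHs s : continuous (fun t => H' (s, t)).
  apply: continuous_compose cH'.
  by apply: continuous_pair; [exact: continuous_cst | exact: continuous_idfun].
have lifts s : exists f, is_lift (fun t => H' (s, t)) f /\ f 0 = e.
  have [||f lf fe] := @lift_exists (fun t => H' (s, t)) e (cHs s).
  - by rewrite /H' /= (@to_unit_le0 _ 0) // Hx.
  - by move=> t; rewrite /H' /= to_unit_clamp.
  by exists f.
pose f s := proj1_sig (cid (lifts s)).
have fP s : is_lift (fun t => H' (s, t)) (f s) /\ f s 0 = e := proj2_sig (cid (lifts s)).
have ends : sheet_eq (f 0 1) (f 1 1).
  apply: (@lift_homotopy H' x y f e) => // s; try by case: (fP s).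
  - by rewrite /H' /= (@to_unit_le0 _ 0) // Hx.
  - by rewrite /H' /= (@to_unit_ge1 _ 1) // Hy.
have u1 : sheet_eq (f1 1) (f 0 1).
  apply: (@lift_unique (fun t => p (to_unit t)) f1 (f 0) 0 1) => //.
  - exact: extended_path_continuous.
  - case: (fP 0) => lf _; congr is_lift: lf; apply/funext => t.
    by rewrite /H' /= (@to_unit_le0 _ 0) // Hp.
  - by rewrite (fP 0).2.
have u2 : sheet_eq (f2 1) (f 1 1).
  apply: (@lift_unique (fun t => p' (to_unit t)) f2 (f 1) 0 1) => //.
  - exact: extended_path_continuous.
  - case: (fP 1) => lf _; congr is_lift: lf; apply/funext => t.
    by rewrite /H' /= (@to_unit_ge1 _ 1) // Hp'.
  - by rewrite (fP 1).2.
apply: (sheet_eq_trans (sheet_eq_sym f11)); apply: (sheet_eq_trans u1).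
apply: (sheet_eq_trans ends); apply: (sheet_eq_trans (sheet_eq_sym u2)).
exact: f21.
Qed.

Lemma transports_sheet x y (p : path x y) e1 e2 e1' e2' :
  sheet_eq e1 e1' -> sheet_eq e2 e2' -> transports p e1 e2 -> transports p e1' e2'.
Proof.
move=> E1 E2 [f [lf f0 f1]]; exists f; split=> //; exact: sheet_eq_trans E1 || exact: sheet_eq_trans E2.
Qed.

Lemma transports_cat x y z (p : path x y) (p' : path y z) e1 e2 e3 :
  transports p e1 e2 -> transports p' e2 e3 -> transports (pcat p p') e1 e3.
Proof.
case=> f [lf f0 f1] [f' [lf' f'0 f'1]].
have j : sheet_eq (f 1) (f' 0) by apply: sheet_eq_trans f1 (sheet_eq_sym f'0).
exists (fun t => if t <= 2^-1 then f (2 * t) else f' (2 * t - 1)); split; last first.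
- by rewrite leNgt invf_lt1 // ltr1n /= mulr1 (_ : 2 - 1 = 1) //; lra.
- by rewrite invr_ge0 ler0n mulr0.
have h1 : continuous (fun t : R => 2 * t) by exact: mull_continuous id_real_continuous.
have h2 : continuous (fun t : R => 2 * t - 1) by exact: subr_continuous h1.
have [q1 l1] := lift_comp h1 lf; have [q2 l2] := lift_comp h2 lf'.
split=> [t|c t]; rewrite path_concat_to_unit; first by case: ifP => _; [exact: q1 | exact: q2].
case: ltgtP => [th|th|->] Uc.
- by apply: filterS2 (l1 c t Uc) (lt_nbhsl th) => t' E1 /ltW ->; exact: E1.
- apply: filterS2 (l2 c t Uc) (lt_nbhsr th) => t' E1; rewrite ltNge => /negbTE ->; exact: E1.
- have e1' : 2 * 2^-1 = 1 :> R by rewrite divff.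
  have Uc1 : U c (((fun t => p (to_unit t)) \o (fun t => 2 * t)) 2^-1) by [].
  have Uc2 : U c (((fun t => p' (to_unit t)) \o (fun t => 2 * t - 1)) 2^-1).
    by move: Uc; rewrite /= e1' subrr path_to_unit0 path_to_unit1.
  apply: filterS2 (l1 c _ Uc1) (l2 c _ Uc2) => t' /= E1 E2; case: ifP => _; rewrite ?E1 ?E2 //.
  rewrite e1' subrr; apply/esym; case: j => _; apply.
  by case: lf => -> _; move: Uc; rewrite /= e1'.
Qed.

Lemma transports_rev x y (p : path x y) e e' : transports p e e' -> transports (prev p) e' e.
Proof.
case=> f [lf f0 f1]; exists (fun t => f (1 - t)); rewrite subr0 subrr; split=> //.
have -> : (fun t => prev p (to_unit t)) = (fun t => p (to_unit t)) \o (fun t => 1 - t).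
  by apply/funext => t; rewrite /prev path_reverse_to_unit.
by apply: lift_comp lf; exact: subl_continuous id_real_continuous.
Qed.

End monodromy.

(** * The surface in polar coordinates *)

Section trigonometry.
Variable R : realType.
Implicit Types a b x y : R.

Lemma cos_eq1 x : 0 <= x <= pi *+ 2 -> cos x = 1 -> x = 0 \/ x = pi *+ 2.
Proof.
have p0 := pi_ge0 R; move=> /andP[x0 x1] cx; have [xp|xp] := leP x pi.
  left; apply: cos_inj; rewrite ?in_itv /= ?x0 ?xp ?lexx ?p0 //.
  by rewrite cos0.
right; have : pi *+ 2 - x = 0.
  apply: cos_inj; rewrite ?in_itv /= ?lexx ?p0 //.
    by rewrite subr_ge0 x1 mulr2n; lra.
  by rewrite cos0 -cosN opprB -cx -[in RHS](subrK (pi *+ 2) x) cosD2pi.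
by move/eqP; rewrite subr_eq0 => /eqP.
Qed.

Lemma angle_inj a b : 0 <= a <= pi *+ 2 -> 0 <= b <= pi *+ 2 ->
  cos a = cos b -> sin a = sin b ->
  a = b \/ (a = 0 /\ b = pi *+ 2) \/ (a = pi *+ 2 /\ b = 0).
Proof.
move=> Ha Hb; wlog ab : a b Ha Hb / a <= b => [wlg|] cE sE.
  have [ab|ba] := leP a b; first exact: wlg.
  by case: (wlg b a Hb Ha (ltW ba) (esym cE) (esym sE)) => [->|[[-> ->]|[-> ->]]]; tauto.
have c1 : cos (b - a) = 1 by rewrite cosB cE sE -!expr2 cos2Dsin2.
case/andP: Ha Hb => a0 a1 /andP[b0 b1].
have [|E|E] := cos_eq1 _ c1; first by apply/andP; split; lra.
  by left; lra.
by right; left; split; lra.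
Qed.

Lemma angle_exists x y : x ^+ 2 + y ^+ 2 = 1 ->
  exists2 a, 0 <= a <= pi *+ 2 & cos a = x /\ sin a = y.
Proof.
move=> xy; have x1 : -1 <= x <= 1.
  by rewrite -ler_norml -(@ler_pXn2r _ 2) ?nnegrE // expr1n real_normK ?num_real //; have := sqr_ge0 y; lra.
have s1 : sin (acos x) = `|y|.
  by rewrite sin_acos // -sqrtr_sqr; congr Num.sqrt; lra.
have p0 := pi_ge0 R; have a0 := acos_ge0 x1; have a1 := acos_lepi x1.
have [y0|y0] := leP 0 y.
  exists (acos x); first by rewrite a0 mulr2n /=; lra.
  by rewrite acosK ?in_itv //= s1 ger0_norm.
exists (pi *+ 2 - acos x); first by rewrite mulr2n; apply/andP; split; lra.
rewrite addrC cosD2pi sinD2pi cosN sinN acosK ?in_itv //= s1 ltr0_norm //.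
by rewrite opprK.
Qed.

End trigonometry.

Section separation.
Variables (R : realType).

Lemma hausdorff_of_functions (Y : topologicalType) :
  (forall y y' : Y, y != y' -> exists2 h : Y -> R, continuous h & h y != h y') ->
  hausdorff_space Y.
Proof.
move=> sep; rewrite open_hausdorff => y y' /sep[h ch hy].
have := @norm_hausdorff R R; rewrite open_hausdorff => /(_ _ _ hy)[[A B] /= [Ay By]].
case=> oA oB /eqP AB; exists (h @^-1` A, h @^-1` B) => /=.
  by rewrite !inE /= in Ay By *.
split; [exact: open_comp (in1W ch) oA | exact: open_comp (in1W ch) oB |].
by apply/eqP; rewrite -preimage_setI AB preimage_set0.
Qed.

End separation.

Section polar_coordinates.
Variables (R : realType) (g : nat).
Hypothesis g_gt0 : (0 < g)%N.
Local Notation N := (4 * g)%N.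
Local Notation D := (closed_disk R).
Local Notation X := (closed_orientable_surface R g).
Implicit Types (w a b : R * R) (r s u : R).

Definition clamp01 r : R := Num.max 0 (Num.min 1 r).
Definition angle s : R := 2 * pi * s / N%:R.
(** The second coordinate counts sides: the vertices are the integers and the side [k] is the
    interval from [k] to [k + 1] at radius 1. The radius is clamped to make the map total. *)
Definition polar w : R * R :=
  (clamp01 w.1 * cos (angle w.2), clamp01 w.1 * sin (angle w.2)).

Lemma clamp01_itv r : 0 <= clamp01 r <= 1.
Proof. by rewrite /clamp01 le_max lexx ge_max ler01 ge_min lexx. Qed.

Lemma clamp01_id r : 0 <= r <= 1 -> clamp01 r = r.
Proof. by case/andP=> ? ?; rewrite /clamp01 (min_idPr _) // (max_idPr _). Qed.

Lemma polar_norm w : (polar w).1 ^+ 2 + (polar w).2 ^+ 2 = clamp01 w.1 ^+ 2.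
Proof. by rewrite /= !exprMn -mulrDr cos2Dsin2 mulr1. Qed.

Lemma polar_disk w : [set z : R * R | z.1 ^+ 2 + z.2 ^+ 2 <= 1] (polar w).
Proof. by rewrite /= -/(polar w) polar_norm; case/andP: (clamp01_itv w.1) => ? ?; rewrite expr_le1. Qed.

Definition disk_pt w : D := exist _ (polar w) (mem_set (polar_disk w)).

Definition surf w : X := \pi_({eq_quot (glued_equiv R g)}) (disk_pt w).

Lemma clamp01_continuous : continuous clamp01.
Proof.
apply: max_real_continuous; first exact: continuous_cst.
by apply: min_real_continuous; [exact: continuous_cst | exact: continuous_idfun].
Qed.

Lemma angle_continuous : continuous angle.
Proof.
move=> s; apply: cvgM; last exact: cvg_cst.
by apply: cvgM; [exact: cvg_cst | exact: cvg_id].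
Qed.

Lemma polar_continuous : continuous polar.
Proof.
have c1 : continuous (fun w => clamp01 w.1).
  by apply: continuous_compose clamp01_continuous => w; exact: cvg_fst.
have c2 : continuous (fun w => angle w.2).
  by apply: continuous_compose angle_continuous => w; exact: cvg_snd.
apply: continuous_pair => w; apply: cvgM; try exact: c1.
  by apply: (continuous_compose c2); exact: continuous_cos.
by apply: (continuous_compose c2); exact: continuous_sin.
Qed.

Lemma disk_pt_continuous : continuous disk_pt.
Proof.
apply: (@continuous_comp_initial _ (R * R)%type (R * R)%type set_val disk_pt).
exact: polar_continuous.
Qed.

Lemma surf_continuous : continuous surf.
Proof.
apply: continuous_compose disk_pt_continuous _.
exact: (@pi_continuous D {eq_quot (glued_equiv R g)}).
Qed.

Definition rect w := (0 <= w.1 <= 1) && (0 <= w.2 <= N%:R).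

Lemma N_gt0 : 0 < N%:R :> R. Proof. by rewrite ltr0n muln_gt0. Qed.

Lemma angle_itv s : 0 <= s <= N%:R -> 0 <= angle s <= pi *+ 2.
Proof.
have p0 := pi_ge0 R; case/andP=> s0 s1; rewrite /angle.
have -> : pi *+ 2 = 2 * pi :> R by rewrite mulr_natl.
apply/andP; split.
  by rewrite divr_ge0 ?mulr_ge0.
by rewrite ler_pdivrMr ?N_gt0 // ler_wpM2l // mulr_ge0.
Qed.

Lemma angle_inv s t : angle s = angle t -> s = t.
Proof.
move/(congr1 (fun x => x * N%:R / (2 * pi))).
have p0 : 2 * pi != 0 :> R by rewrite mulf_neq0 // gt_eqF // pi_gt0.
by rewrite /angle !divfK ?gt_eqF ?N_gt0 // ![2 * pi * _]mulrC !mulfK.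
Qed.

Lemma angle0 : angle 0 = 0. Proof. by rewrite /angle mulr0 mul0r. Qed.
Lemma angleN : angle N%:R = pi *+ 2.
Proof. by rewrite /angle mulfK ?gt_eqF ?N_gt0 // mulr_natl. Qed.

Lemma disk_pt_eq a b : rect a -> rect b -> disk_pt a = disk_pt b ->
  a.1 = b.1 /\ [\/ a.1 = 0, a.2 = b.2, (a.2 = 0 /\ b.2 = N%:R) | (a.2 = N%:R /\ b.2 = 0)].
Proof.
move=> /andP[a1 a2] /andP[b1 b2] /(congr1 val) /= E.
have E1 : a.1 = b.1.
  have := congr1 (fun z => z.1 ^+ 2 + z.2 ^+ 2) E; rewrite !polar_norm !clamp01_id //.
  case/andP: a1 b1 => a10 _ /andP[b10 _] /eqP; rewrite eqrXn2 // => /eqP //.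
split=> //; move: E; rewrite /polar !clamp01_id // -E1.
have [->|a0] := eqVneq a.1 0; first by constructor 1.
case=> /(mulfI a0) E2 /(mulfI a0) E3.
case: (angle_inj (angle_itv a2) (angle_itv b2) E2 E3) => [/angle_inv|[[]|[]]].
- by constructor 2.
- by move=> *; constructor 3; split; apply: angle_inv; rewrite ?angleN ?angle0.
- by move=> *; constructor 4; split; apply: angle_inv; rewrite ?angleN ?angle0.
Qed.

Lemma disk_pt_surj (z : D) : exists2 w, rect w & disk_pt w = z.
Proof.
have zD : (val z).1 ^+ 2 + (val z).2 ^+ 2 <= 1 by have := set_mem (valP z).
case: z zD => -[x y] /= zP zD; set d := x ^+ 2 + y ^+ 2 in zD.
have d0 : 0 <= d by rewrite addr_ge0 ?sqr_ge0.
pose r := Num.sqrt d; have r0 : 0 <= r := sqrtr_ge0 d.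
have r2 : r ^+ 2 = d := sqr_sqrtr d0.
have r1 : r <= 1 by rewrite -(@ler_pXn2r _ 2) ?nnegrE // expr1n r2.
have [r00|r00] := eqVneq r 0.
  exists (0, 0); first by rewrite /rect /= lexx ler01 ltW ?N_gt0.
  apply/val_inj => /=; rewrite /polar /= clamp01_id ?lexx ?ler01 // !mul0r.
  have : x ^+ 2 + y ^+ 2 = 0 by rewrite -/d -r2 r00 expr0n.
  move/eqP; rewrite paddr_eq0 ?sqr_ge0 // !sqrf_eq0 => /andP[/eqP -> /eqP ->] //.
have xy1 : (x / r) ^+ 2 + (y / r) ^+ 2 = 1.
  by rewrite !expr_div_n -mulrDl -/d -r2 divff // expf_neq0.
have [t Ht [ct st]] := angle_exists xy1.
have p0 : 0 < 2 * pi :> R by rewrite mulr_gt0 // pi_gt0.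
exists (r, t * N%:R / (2 * pi)).
  rewrite /rect /= r0 r1 /=; case/andP: Ht => t0 t1; apply/andP; split.
    by apply: divr_ge0; [exact: mulr_ge0 | exact: ltW].
  by rewrite ler_pdivrMr // mulrC ler_wpM2l // mulr_natl.
apply/val_inj; rewrite /= /polar /= clamp01_id ?r0 //.
have -> : angle (t * N%:R / (2 * pi)) = t.
  by rewrite /angle [2 * pi * _]mulrC divfK ?gt_eqF // mulfK // gt_eqF // N_gt0.
by rewrite ct st ![r * _]mulrC !divfK.
Qed.

Lemma surf_surj (y : X) : exists2 w, rect w & surf w = y.
Proof.
have [w Kw E] := disk_pt_surj (repr (y : {eq_quot (glued_equiv R g)})).
by exists w => //; rewrite /surf E; exact: reprK.
Qed.

Definition glued_side k := if (k %% 4 < 2)%N then (k + 2)%N else (k - 2)%N.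

Lemma glued_sideK k : glued_side (glued_side k) = k.
Proof.
clear g_gt0 g.
rewrite /glued_side; have [lt|ge] := ltnP (k %% 4) 2.
  have -> : ((k + 2) %% 4 < 2)%N = false by lia.
  by rewrite addnK.
have -> : ((k - 2) %% 4 < 2)%N by lia.
by lia.
Qed.

Lemma glued_side_lt k : (k < N)%N -> (glued_side k < N)%N.
Proof. by clear g_gt0; rewrite /glued_side; case: ifP; lia. Qed.

Lemma polar_side (k : nat) s : polar (1, k%:R + s) = side g k s.
Proof. by rewrite /polar /= clamp01_id ?ler01 ?lexx // !mul1r. Qed.

Lemma surf_side k u : (k < N)%N -> 0 <= u <= 1 ->
  surf (1, k%:R + u) = surf (1, (glued_side k)%:R + 1 - u).
Proof.
have aux k' u' : (k' < N)%N -> (k' %% 4 < 2)%N -> 0 <= u' <= 1 ->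
    surf (1, k'%:R + u') = surf (1, (k' + 2)%:R + (1 - u')).
  move=> kN k4 Hu; apply/eqmodP/asboolP/rst_step.
  exists (k' %/ 4)%N, (k' %% 4)%N, u'; rewrite mulnC -divn_eq; split=> //=.
  - by lia.
  - exact: polar_side.
  - exact: polar_side.
move=> kN Hu; rewrite /glued_side; case: ifPn => k4; first by rewrite aux // addrA.
rewrite -leqNgt in k4; have := aux (k - 2)%N (1 - u); rewrite subnK; last by lia.
rewrite subKr -addrA => <- //; [by lia | by lia |].
by case/andP: Hu => ? ?; apply/andP; split; lra.
Qed.

Lemma surf0 s s' : surf (0, s) = surf (0, s').
Proof.
by congr (\pi_({eq_quot _}) _); apply/val_inj; rewrite /= /polar /= clamp01_id ?lexx ?ler01 // !mul0r.
Qed.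

Lemma surfN r : surf (r, 0) = surf (r, N%:R).
Proof.
congr (\pi_({eq_quot _}) _); apply/val_inj; rewrite /= /polar /= angle0 angleN.
by rewrite cos2pi sin2pi cos0 sin0.
Qed.

(** The vertex [k] is glued to [glued_side k + 1]; the chain [4i, 4i+3, 4i+2, 4i+1, 4i+4] then joins
    all the vertices. *)
Lemma surf_vertex j : (j <= N)%N -> surf (1, j%:R) = surf (1, 0).
Proof.
have e0 k : (k < N)%N -> surf (1, k%:R) = surf (1, (glued_side k).+1%:R).
  by move=> kN; have := surf_side kN (_ : 0 <= 0 <= 1); rewrite addr0 subr0 natr1 => -> //; rewrite lexx ler01.
have step i : (i < g)%N -> [/\ surf (1, (4 * i)%:R) = surf (1, (4 * i + 3)%:R),
    surf (1, (4 * i + 1)%:R) = surf (1, (4 * i.+1)%:R),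
    surf (1, (4 * i + 2)%:R) = surf (1, (4 * i + 1)%:R) &
    surf (1, (4 * i + 3)%:R) = surf (1, (4 * i + 2)%:R)].
  by move=> ig; split; rewrite e0 /glued_side; try lia;
    congr (surf (1, _%:R)); case: ifP; lia.
have four i : (i <= g)%N -> surf (1, (4 * i)%:R) = surf (1, 0).
  elim: i => [|i IH] ig; first by rewrite muln0.
  by have [E1 E2 E3 E4] := step i ig; rewrite -E2 -E3 -E4 -E1 IH // ltnW.
rewrite leq_eqVlt => /orP[/eqP ->|jN]; first exact: four.
have ig : (j %/ 4 < g)%N by lia.
have [E1 E2 E3 E4] := step _ ig; have F := four (j %/ 4).+1 ig.
have [r rj ->] : exists2 r, (r < 4)%N & j = (4 * (j %/ 4) + r)%N by exists (j %% 4)%N; lia.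
case: r rj => [|[|[|[|//]]]] _; rewrite ?addn0 ?E4 ?E3 ?E2 //.
by apply: four; lia.
Qed.

Lemma surf_invariant (Y : Type) (f : R * R -> Y) :
  (forall s s', f (0, s) = f (0, s')) -> (forall r, f (r, 0) = f (r, N%:R)) ->
  (forall k u, (k < N)%N -> 0 <= u <= 1 ->
     f (1, k%:R + u) = f (1, (glued_side k)%:R + 1 - u)) ->
  forall a b, rect a -> rect b -> surf a = surf b -> f a = f b.
Proof.
move=> f0 fN fside.
have fD a b : rect a -> rect b -> disk_pt a = disk_pt b -> f a = f b.
  case: a b => [r s] [r' s'] Ka Kb /(disk_pt_eq Ka Kb)[/= <- []] => [->|->|[-> ->]|[-> ->]] //.
pose rep (z : D) := s2val (cid2 (disk_pt_surj z)).
have repK z : rect (rep z) := s2valP (cid2 (disk_pt_surj z)).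
have repE z : disk_pt (rep z) = z := s2valP' (cid2 (disk_pt_surj z)).
have frep w : rect w -> f (rep (disk_pt w)) = f w by move=> Kw; exact: fD.
suff clos (z w : D) : clos_refl_sym_trans _ (side_glued g) z w -> f (rep z) = f (rep w).
  move=> a b Ka Kb /eqmodP/asboolP/clos; rewrite !frep //.
elim=> [{}z {}w|//|? ? _ -> //|? ? ? _ -> _ -> //] [i [j [s [ig j2 Hs zE wE]]]].
have K1 k u : (k < N)%N -> 0 <= u <= 1 -> rect (1, k%:R + u).
  move=> kN /andP[u0 u1]; rewrite /rect /= ler01 lexx addr_ge0 //=.
  by apply: (@le_trans _ _ (k.+1%:R)); [rewrite -natr1 lerD2l | rewrite ler_nat].
have -> : z = disk_pt (1, (4 * i + j)%:R + s) by apply/val_inj; rewrite zE -polar_side.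
have -> : w = disk_pt (1, (4 * i + j + 2)%:R + (1 - s)) by apply/val_inj; rewrite wE -polar_side.
case/andP: (Hs) => s0 s1; rewrite !frep; last first.
- by apply: K1; [lia | rewrite Hs].
- by apply: K1; [lia | apply/andP; split; lra].
rewrite fside //; last by lia.
by rewrite /glued_side; have -> : ((4 * i + j) %% 4 < 2)%N by [lia]; rewrite addrA.
Qed.

Lemma disk_hausdorff : hausdorff_space D.
Proof.
have cval : continuous (val : D -> R * R) by exact: initial_continuous.
apply: (@hausdorff_of_functions R) => z z' zz'.
have [E1|E1] := eqVneq (val z).1 (val z').1; last first.
  by exists (fun z => (val z).1) => //; apply: continuous_compose cval _ => w; exact: cvg_fst.
exists (fun z => (val z).2).
  by apply: continuous_compose cval _ => w; exact: cvg_snd.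
apply: contra zz' => /eqP E2; apply/eqP/val_inj.
by rewrite (surjective_pairing (val z)) E1 E2 -surjective_pairing.
Qed.

Lemma rect_compact : compact (rect : set (R * R)).
Proof.
have -> : (rect : set (R * R)) = `[0, 1] `*` `[0, N%:R].
  by apply/seteqP; split=> w; rewrite /setX /= !in_itv /= => /andP.
by apply: compact_setX; exact: segment_compact.
Qed.

(** Polar coordinates cannot be chosen continuously, so continuity comes from compactness: the
    preimage of a closed set is the image of a closed part of the rectangle, hence closed in the
    Hausdorff disk. *)
Lemma surf_descend (f : R * R -> R) : continuous f ->
  (forall s s', f (0, s) = f (0, s')) -> (forall r, f (r, 0) = f (r, N%:R)) ->
  (forall k u, (k < N)%N -> 0 <= u <= 1 ->
     f (1, k%:R + u) = f (1, (glued_side k)%:R + 1 - u)) ->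
  exists2 h : X -> R, continuous h & forall w, rect w -> h (surf w) = f w.
Proof.
move=> cf f0 fN fside; have inv := surf_invariant f0 fN fside.
pose rep (y : X) := s2val (cid2 (surf_surj y)).
have repK y : rect (rep y) := s2valP (cid2 (surf_surj y)).
have repE y : surf (rep y) = y := s2valP' (cid2 (surf_surj y)).
have hE w : rect w -> f (rep (surf w)) = f w by move=> Kw; exact: inv.
exists (fun y => f (rep y)) => //.
apply/(@quotient_continuous D {eq_quot (glued_equiv R g)} R)/continuous_closedP => A cA.
set B := _ @^-1` A.
have -> : B = disk_pt @` ((rect : set _) `&` (f @^-1` A)).
  apply/seteqP; split=> [z Bz|z [w [Kw Aw] <-]].
    have [w Kw wz] := disk_pt_surj z; exists w => //; split=> //=.
    by rewrite -hE // /surf wz.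
  by rewrite /B /= hE.
apply: compact_closed; first exact: disk_hausdorff.
apply: continuous_compact; first exact: continuous_subspaceT disk_pt_continuous.
apply: compact_closedI; first exact: rect_compact.
by move/continuous_closedP: cf; apply.
Qed.

Definition tent (k : nat) s : R := Num.max 0 ((s - k%:R) * (k%:R + 1 - s)).

Lemma tentE k k' u : 0 <= u <= 1 ->
  tent k (k'%:R + u) = if k' == k then u * (1 - u) else 0.
Proof.
case/andP=> u0 u1; rewrite /tent; have [->|kk'] := eqVneq k' k.
  rewrite addrAC subrr add0r opprD addrACA subrr add0r; apply/max_idPr.
  by rewrite mulr_ge0 // subr_ge0.
apply/max_idPl; case: (ltngtP k' k) kk' => // lt _.
  have : k'%:R + 1 <= k%:R :> R by rewrite natr1 ler_nat.
  by move=> H; rewrite mulr_le0_ge0 //; lra.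
have : k%:R + 1 <= k'%:R :> R by rewrite natr1 ler_nat.
by move=> H; rewrite mulr_ge0_le0 //; lra.
Qed.

Lemma tent_nat k (j : nat) : tent k j%:R = 0.
Proof. by rewrite -[j%:R]addr0 tentE ?lexx ?ler01 // mul0r if_same. Qed.

Lemma tent_continuous k : continuous (tent k).
Proof.
apply: max_real_continuous; first exact: continuous_cst.
move=> s; apply: cvgM.
  by apply: cvgB; [exact: cvg_id | exact: cvg_cst].
by apply: cvgB; [exact: cvg_cst | exact: cvg_id].
Qed.

Definition invariant_fun (f : R * R -> R) := [/\ continuous f,
  forall s s', f (0, s) = f (0, s'), forall r, f (r, 0) = f (r, N%:R) &
  forall k u, (k < N)%N -> 0 <= u <= 1 ->
     f (1, k%:R + u) = f (1, (glued_side k)%:R + 1 - u)].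

(** For glued sides [k] and [k + 2], [pair_tent] is [u (1 - u)] on both, and the quotient of
    [pair_slope] by it is [u], measured in opposite directions on the two sides. Together they
    determine a point in the interior of the glued side. *)
Definition pair_tent k w := w.1 * (tent k w.2 + tent (k + 2) w.2).
Definition pair_slope k w :=
  w.1 * ((w.2 - k%:R) * tent k w.2 + ((k + 2)%:R + 1 - w.2) * tent (k + 2) w.2).

Let fst_cont : continuous (fun w : R * R => w.1). Proof. by move=> w; exact: cvg_fst. Qed.
Let snd_cont : continuous (fun w : R * R => w.2). Proof. by move=> w; exact: cvg_snd. Qed.
Let tent_cont k : continuous (fun w : R * R => tent k w.2).
Proof. by apply: continuous_compose snd_cont _; exact: tent_continuous. Qed.

Lemma pair_tentE k k' u : 0 <= u <= 1 ->
  pair_tent k (1, k'%:R + u) = if (k' == k) || (k' == k + 2)%N then u * (1 - u) else 0.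
Proof.
move=> Hu; rewrite /pair_tent /= mul1r !tentE //.
case: (eqVneq k' k) => [->|_] /=; last by rewrite add0r.
by have -> : (k == k + 2)%N = false by [apply/eqP; lia]; rewrite addr0.
Qed.

Lemma pair_slopeE k k' u : 0 <= u <= 1 ->
  pair_slope k (1, k'%:R + u) = if k' == k then u * (u * (1 - u))
    else if (k' == k + 2)%N then (1 - u) * (u * (1 - u)) else 0.
Proof.
move=> Hu; rewrite /pair_slope /= mul1r !tentE //.
case: (eqVneq k' k) => [->|_] /=.
  have -> : (k == k + 2)%N = false by apply/eqP; lia.
  by rewrite mulr0 addr0 addrAC subrr add0r.
by rewrite mulr0 add0r; case: eqP => [->|_]; [ring | rewrite mulr0].
Qed.

Lemma glued_side_pair k k' : (k %% 4 < 2)%N ->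
  ((glued_side k' == k) = (k' == k + 2)%N) * ((glued_side k' == k + 2)%N = (k' == k)).
Proof.
clear g_gt0 g; move=> k4; have gk : glued_side k = (k + 2)%N by rewrite /glued_side k4.
split; first by apply/eqP/eqP => [E|->]; [rewrite -gk -E glued_sideK | rewrite -gk glued_sideK].
by rewrite -gk; apply/eqP/eqP => [E|->//]; rewrite -(glued_sideK k') E glued_sideK.
Qed.

Lemma pair_tent_invariant k : (k %% 4 < 2)%N -> invariant_fun (pair_tent k).
Proof.
move=> k4; split=> [w|s s'|r|k' u k'N Hu].
- by apply: cvgM; [exact: fst_cont | apply: cvgD; exact: tent_cont].
- by rewrite /pair_tent !mul0r.
- by rewrite /pair_tent /= -[0]/(0%:R) !tent_nat.
have Hu' : 0 <= 1 - u <= 1 by case/andP: Hu => ? ?; apply/andP; split; lra.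
rewrite -addrA !pair_tentE // !(glued_side_pair k' k4) orbC subKr.
by rewrite [(1 - u) * u]mulrC.
Qed.

Lemma pair_slope_invariant k : (k %% 4 < 2)%N -> invariant_fun (pair_slope k).
Proof.
move=> k4; split=> [w|s s'|r|k' u k'N Hu].
- apply: cvgM; first exact: fst_cont.
  apply: cvgD; apply: cvgM; try exact: tent_cont.
    by apply: cvgB; [exact: snd_cont | exact: cvg_cst].
  by apply: cvgB; [exact: cvg_cst | exact: snd_cont].
- by rewrite /pair_slope !mul0r.
- by rewrite /pair_slope /= -[0]/(0%:R) !tent_nat !mulr0.
have Hu' : 0 <= 1 - u <= 1 by case/andP: Hu => ? ?; apply/andP; split; lra.
rewrite -addrA !pair_slopeE // !(glued_side_pair k' k4) subKr [(1 - u) * u]mulrC.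
case: eqP => [->|_]; case: eqP => //; lia.
Qed.

Variant surf_rel : R * R -> R * R -> Prop :=
| SurfCenter s s' : surf_rel (0, s) (0, s')
| SurfRefl w : surf_rel w w
| SurfSeam r : surf_rel (r, 0) (r, N%:R)
| SurfSeamV r : surf_rel (r, N%:R) (r, 0)
| SurfSide k u of (k < N)%N & 0 < u < 1 :
    surf_rel (1, k%:R + u) (1, (glued_side k)%:R + 1 - u)
| SurfVertex (j j' : nat) of (j <= N)%N & (j' <= N)%N : surf_rel (1, j%:R) (1, j'%:R).

Lemma surf_rel_eq a b : surf_rel a b -> surf a = surf b.
Proof.
case=> [s s'|//|r|r|k u kN /andP[u0 u1]|j j' jN j'N].
- exact: surf0.
- exact: surfN.
- exact/esym/surfN.
- by apply: surf_side; rewrite ?(ltW u0) ?(ltW u1).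
- by rewrite !surf_vertex.
Qed.

Lemma nat_frac s : 0 <= s <= N%:R ->
  exists k u, [/\ s = k%:R + u, 0 <= u < 1, (k <= N)%N & 0 < u -> (k < N)%N].
Proof.
case/andP=> s0 sN; have /andP[h1 h2] := truncn_itv s0.
exists (Num.truncn s), (s - (Num.truncn s)%:R); rewrite addrC subrK subr_ge0 h1 ltrBlDl -natr1 in h2 *.
split=> //; first by rewrite -(ler_nat R) (le_trans h1).
by rewrite subr_gt0 => lt; rewrite -(ltr_nat R) (lt_le_trans lt).
Qed.

Lemma first_side j : exists2 i, (i %% 4 < 2)%N & j = i \/ j = (i + 2)%N.
Proof.
clear g_gt0 g; have [lt|ge] := ltnP (j %% 4) 2; first by exists j; [|left].
by exists (j - 2)%N; [lia | right; lia].
Qed.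

(** The separating functions are the radius; off the boundary, [1 - r] times the Cartesian
    coordinates; on the boundary, the tents and slopes. As invariant functions descend, this yields
    both the description of the fibres of [surf] and the Hausdorff property. *)
Lemma surf_classify a b : rect a -> rect b ->
  (forall f, invariant_fun f -> f a = f b) -> surf_rel a b.
Proof.
move=> Ka Kb Hf; have E1 : a.1 = b.1.
  apply: (Hf fst); split=> // k u _ _; exact: fst_cont.
have [a1|a1] := eqVneq a.1 1; last first.
  have c1 : a.1 < 1 by rewrite lt_neqAle a1; case/andP: Ka => /andP[].
  have pE (pr : R * R -> R) : continuous pr -> pr (0, 0) = 0 \/ True -> pr (polar a) = pr (polar b).
    move=> cpr _; have : (1 - a.1) * pr (polar a) = (1 - b.1) * pr (polar b).
      apply: (Hf (fun w => (1 - w.1) * pr (polar w))); split=> [w|s s'|r|k u _ _].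
      - apply: cvgM; first by apply: cvgB; [exact: cvg_cst | exact: fst_cont].
        exact: continuous_compose polar_continuous cpr w.
      - by rewrite /polar /= clamp01_id ?lexx ?ler01 // !mul0r.
      - by rewrite /polar /= angle0 angleN cos2pi sin2pi cos0 sin0.
      - by rewrite /= subrr !mul0r.
    by rewrite -E1; apply: mulfI; rewrite subr_eq0 eq_sym.
  have : disk_pt a = disk_pt b.
    apply/val_inj; rewrite /= (surjective_pairing (polar a)) (surjective_pairing (polar b)).
    by congr (_, _); [apply: (pE fst) | apply: (pE snd)]; auto.
  case: a b Ka Kb E1 {a1 c1 Hf pE} => [r s] [r' s'] Ka Kb /= E; rewrite -{}E in Kb *.
  case/(disk_pt_eq Ka Kb) => _ [/= ->|/= ->|[/= -> ->]|[/= -> ->]]; by constructor.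
case: a b Ka Kb E1 a1 Hf => [r s] [r' s'] /andP[_ /= Hs] /andP[_ /= Hs'] <- -> Hf.
have [k [u [E0 Hu kN kN']]] := nat_frac Hs; have [k' [u' [E' Hu' k'N k'N']]] := nat_frac Hs'.
rewrite {}E0 {}E' in Hf *.
have Huw : 0 <= u <= 1 by case/andP: Hu => -> /ltW.
have Huw' : 0 <= u' <= 1 by case/andP: Hu' => -> /ltW.
have [u0|u0] := eqVneq u 0.
  have [u'0|u'0] := eqVneq u' 0.
    by rewrite u0 u'0 !addr0; constructor.
  have [i i4 Hi] := first_side k'; have := Hf _ (pair_tent_invariant i4).
  rewrite !pair_tentE // u0 mul0r if_same; case: Hi => ->; rewrite eqxx ?orbT => /esym/eqP;
    by rewrite mulf_eq0 (negbTE u'0) subr_eq0 gt_eqF //; case/andP: Hu'.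
have u00 : 0 < u by rewrite lt_neqAle eq_sym u0; case/andP: Hu.
have uu : 0 < u * (1 - u) by rewrite mulr_gt0 // subr_gt0; case/andP: Hu.
have [i i4 Hi] := first_side k; have := Hf _ (pair_tent_invariant i4).
have := Hf _ (pair_slope_invariant i4).
rewrite !pair_tentE // !pair_slopeE //.
have neq' : (i == i + 2)%N = false by rewrite -[X in X == _]addn0 eqn_add2l.
have neq : (i + 2 == i)%N = false by rewrite eq_sym.
have gi : glued_side i = (i + 2)%N by rewrite /glued_side i4.
have gi' : glued_side (i + 2) = i by rewrite -gi glued_sideK.
have ex : forall c v v', v * c = v' * c -> 0 < c -> v = v' :> R.
  by move=> c v v' + c0; apply: mulIf; rewrite gt_eqF.
have Hu1 : 0 < u < 1 by rewrite u00; case/andP: Hu.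
case: Hi kN' => -> /(_ u00) kN'; rewrite ?eqxx ?neq ?neq' ?orbT /= => F1.
- case: (eqVneq k' i) F1 => [->|_] /= F1 F2.
    by rewrite -F2 in F1; rewrite (ex _ _ _ F1 uu); constructor.
  case: (eqVneq k' (i + 2)%N) F1 F2 => [->|_] /= F1 F2; last by rewrite F2 ltxx in uu.
  rewrite -F2 in F1; have E := ex _ _ _ F1 uu.
  have -> : u' = 1 - u by lra.
  by rewrite addrA -gi; constructor.
- case: (eqVneq k' i) F1 => [->|_] /= F1 F2.
    rewrite -F2 in F1; have E := ex _ _ _ F1 uu; rewrite -E addrA.
    by have := SurfSide kN' Hu1; rewrite gi'.
  case: (eqVneq k' (i + 2)%N) F1 F2 => [->|_] /= F1 F2; last by rewrite F2 ltxx in uu.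
  rewrite -F2 in F1; have E := ex _ _ _ F1 uu.
  have -> : u' = u by lra.
  by constructor.
Qed.

Lemma surf_eqP a b : rect a -> rect b -> surf a = surf b -> surf_rel a b.
Proof.
move=> Ka Kb E; apply: surf_classify => // f [_ f0 fN fs].
exact: (surf_invariant f0 fN fs).
Qed.

Lemma surface_hausdorff : hausdorff_space X.
Proof.
apply: (@hausdorff_of_functions R) => y y' yy'.
have [a Ka Ea] := surf_surj y; have [b Kb Eb] := surf_surj y'.
have [f [cf f0 fN fs] fab] : exists2 f, invariant_fun f & f a != f b.
  apply: contrapT => H; move/eqP: yy'; apply; rewrite -Ea -Eb; apply: surf_rel_eq.
  apply: surf_classify => // f If; apply/eqP/negPn/negP => fab; apply: H; by exists f.
have [h ch hE] := surf_descend cf f0 fN fs.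
by exists h => //; rewrite -Ea -Eb !hE.
Qed.

(** A tube lemma: near the fibre of [y0] the hypothesis applies, points off the fibre are separated
    from it by the Hausdorff property, and the rectangle is compact. The parameter [t] serves for
    homotopies. *)
Lemma surf_near (T : topologicalType) (t0 : T) (y0 : X) (Phi : T -> R * R -> Prop) :
  (forall w, rect w -> surf w = y0 -> \forall t \near t0 & w' \near w, Phi t w') ->
  \forall t \near t0 & y \near y0, forall w, rect w -> surf w = y -> Phi t w.
Proof.
move=> H; have /compact_near_coveringP K := rect_compact.
suff near_rect : \forall ty \near (t0, y0),
    (rect : set (R * R)) `<=` (fun w => surf w = ty.2 -> Phi ty.1 w).
  by apply: filterS near_rect => -[t y] /= H' w Kw E; exact: H' w Kw E.
apply: (K _ (nbhs (t0, y0)) (fun ty w => surf w = ty.2 -> Phi ty.1 w)) => w Kw; have [E|E] := eqVneq (surf w) y0.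
  have [[A B] /= [At Bw] AB] := H w Kw E.
  exists (B, A `*` setT) => /=.
    by split=> //; exists (A, setT) => //; split=> //; exact: filterT.
  by move=> [w' [t y]] /= [Bw' [At' _]] _; exact: (AB (t, w')).
have := surface_hausdorff; rewrite open_hausdorff => /(_ _ _ E)[[A B] /= [Ay By]].
rewrite !inE /= in Ay By; case=> oA oB /eqP AB.
exists (surf @^-1` A, setT `*` B) => /=.
  split; first by apply: surf_continuous; exact: open_nbhs_nbhs.
  by exists (setT, B) => //; split=> /=; [exact: filterT | exact: open_nbhs_nbhs].
move=> [w' [t y]] /= [Aw' [_ By']] E'; exfalso.
by have : (A `&` B) y by [split=> //; rewrite -E']; rewrite AB.
Qed.

End polar_coordinates.

(** * Charts and tiles *)

Section glued_positions.
Variable g : nat.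
Hypothesis g_gt0 : (0 < g)%N.
Local Notation N := (4 * g)%N.

Definition glued_pos (j : 'Z_N) : 'Z_N := (glued_side j)%:R.
Local Notation phi := (next_side glued_pos).

Let N1 : (1 < N)%N. Proof. by lia. Qed.

Lemma val_pos k : (k < N)%N -> nat_of_ord (k%:R : 'Z_N) = k.
Proof. by move=> kN; rewrite val_Zp_nat // modn_small. Qed.

Lemma pos_lt (j : 'Z_N) : (j < N)%N.
Proof. by have := ltn_ord j; rewrite [X in (_ < X)%N -> _]Zp_cast. Qed.

Lemma pos_val (j : 'Z_N) : (nat_of_ord j)%:R = j. Proof. exact: natr_Zp. Qed.

Lemma glued_posE k : (k < N)%N -> glued_pos k%:R = (glued_side k)%:R.
Proof. by move=> kN; rewrite /glued_pos val_pos. Qed.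

Lemma glued_posK : involutive glued_pos.
Proof.
by move=> j; rewrite -{1}(pos_val j) !glued_posE ?glued_side_lt ?pos_lt // glued_sideK pos_val.
Qed.

Lemma next_posE k : (k < N)%N -> phi k%:R = (glued_side k).+1%:R.
Proof. by move=> kN; rewrite /next_side glued_posE // natr1. Qed.

Lemma posN : N%:R = 0 :> 'Z_N. Proof. exact: pchar_Zp. Qed.

(* The number of steps from the vertex 0 to the vertex j around their common
   image in the surface. *)
Definition vertex_rank j := (4 * (j %/ 4) + (4 - j %% 4) %% 4)%N.

Lemma vertex_rank_lt j : (j < N)%N -> (vertex_rank j < N)%N.
Proof. by rewrite /vertex_rank; lia. Qed.

Lemma vertex_rank_next j : (j < N)%N -> let j' := (glued_side j).+1 in
  (j' < N /\ vertex_rank j' = (vertex_rank j).+1)%N \/ (j' = N /\ (vertex_rank j).+1 = N)%N.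
Proof.
move=> jN /=; rewrite /glued_side /vertex_rank; case: ifP; lia.
Qed.

Lemma iter_vertex_rank j : (j < N)%N -> iter (vertex_rank j) phi 0 = j%:R.
Proof.
have four i : (i <= g)%N -> iter (4 * i) phi 0 = (4 * i)%:R.
  elim: i => [|i IH] ig; first by rewrite muln0.
  have -> : (4 * i.+1 = 4 + 4 * i)%N by lia.
  rewrite iterD IH; last exact: ltnW.
  rewrite /= next_posE; last by lia.
  have -> : (glued_side (4 * i)).+1 = (4 * i + 3)%N by rewrite /glued_side; case: ifP; lia.
  rewrite next_posE; last by lia.
  have -> : (glued_side (4 * i + 3)).+1 = (4 * i + 2)%N by rewrite /glued_side; case: ifP; lia.
  rewrite next_posE; last by lia.
  have -> : (glued_side (4 * i + 2)).+1 = (4 * i + 1)%N by rewrite /glued_side; case: ifP; lia.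
  rewrite next_posE; last by lia.
  by congr _%:R; rewrite /glued_side; case: ifP; lia.
move=> jN; rewrite /vertex_rank addnC iterD four; last by lia.
set i := (j %/ 4)%N; have [r rj ->] : exists2 r, (r < 4)%N & j = (4 * i + r)%N.
  by exists (j %% 4)%N; rewrite /i; lia.
have rE : ((4 * i + r) %% 4 = r)%N by lia.
have iN : (4 * i + 3 < N)%N by rewrite /i; lia.
have s1 : phi (4 * i)%:R = (4 * i + 3)%:R.
  by rewrite next_posE; [congr _%:R; rewrite /glued_side; case: ifP; lia | lia].
have s2 : phi (4 * i + 3)%:R = (4 * i + 2)%:R.
  by rewrite next_posE; [congr _%:R; rewrite /glued_side; case: ifP; lia | lia].
have s3 : phi (4 * i + 2)%:R = (4 * i + 1)%:R.
  by rewrite next_posE; [congr _%:R; rewrite /glued_side; case: ifP; lia | lia].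
rewrite rE; case: r rj {rE} => [|[|[|[|//]]]] _ /=; rewrite ?addn0 ?s1 ?s2 ?s3 //.
Qed.

Lemma iter_next_pos j : iter N phi j = j.
Proof.
rewrite -(pos_val j) -(iter_vertex_rank (pos_lt j)) -iterD addnC iterD; congr iter.
(* This is the vertex of rank N - 1; its side is glued to the last one, which ends at the vertex N,
   that is 0. *)
pose j0 := (4 * g.-1 + 1)%N; have j0N : (j0 < N)%N by rewrite /j0; lia.
have rE : (vertex_rank j0).+1 = N by rewrite /vertex_rank /j0; lia.
have E n : n = N -> iter n phi 0 = iter N phi 0 by move=> ->.
rewrite -(E _ rE) iterS iter_vertex_rank // next_posE // -posN; congr _%:R.
by rewrite /glued_side /j0; case: ifP; lia.
Qed.

End glued_positions.

(* The open disk, the surface without the rays to the vertices, and the surface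
   without the rays to the midpoints of the sides. *)
Variant chart := Inside | Edges | Vertices.

Section charts.
Variables (R : realType) (g : nat).
Hypothesis g_gt0 : (0 < g)%N.
Local Notation N := (4 * g)%N.
Local Notation X := (closed_orientable_surface R g).
Local Notation surf := (@surf R g).
Local Notation rect := (@rect R g).
Implicit Types (c d : chart) (w : R * R) (y : X).

Definition chart_dom c w : Prop :=
  match c with
  | Inside => w.1 < 1
  | Edges => 0 < w.1 /\ exists k : nat, k%:R < w.2 < k%:R + 1
  | Vertices => 0 < w.1 /\ exists j : nat, j%:R < w.2 + 2^-1 < j%:R + 1
  end.

Definition chart_index c w : nat :=
  match c with
  | Inside => 0%N
  | Edges => Num.truncn w.2
  | Vertices => Num.truncn (w.2 + 2^-1)
  end.

Lemma truncn_open (x : R) (k : nat) : k%:R < x < k%:R + 1 -> Num.truncn x = k.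
Proof. by case/andP=> h1 h2; apply: truncn_def; rewrite ltW // -natr1. Qed.

Lemma nat_gap (j k : nat) (u : R) : 0 < u < 1 -> (k%:R < j%:R + u < k%:R + 1) = (k == j).
Proof.
move=> /andP[u0 u1]; case: ltngtP => [kj|jk|->].
- have : k%:R + 1 <= j%:R :> R by rewrite natr1 ler_nat.
  by move=> H; apply/negbTE; rewrite negb_and -!leNgt; apply/orP; right; lra.
- have : j%:R + 1 <= k%:R :> R by rewrite natr1 ler_nat.
  by move=> H; apply/negbTE; rewrite negb_and -!leNgt; apply/orP; left; lra.
- by apply/andP; split; lra.
Qed.

Lemma nat_no_gap (j k : nat) : ((k%:R : R) < (j%:R : R) < (k%:R + 1 : R)) = false.
Proof. by rewrite natr1 !ltr_nat ltnS; case: ltnP => //; rewrite ltnNge => ->. Qed.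

Lemma chart_near c w : chart_dom c w ->
  \forall w' \near w, chart_dom c w' /\ chart_index c w' = chart_index c w.
Proof.
have fst_lt (b : R) : w.1 < b -> \forall w' \near w, w'.1 < b.
  by move=> wb; exact: (@cvg_fst _ _ (nbhs w.1) (nbhs w.2) _ _ (lt_nbhsl wb)).
have fst_gt (b : R) : b < w.1 -> \forall w' \near w, b < w'.1.
  by move=> wb; exact: (@cvg_fst _ _ (nbhs w.1) (nbhs w.2) _ _ (lt_nbhsr wb)).
have snd_lt (b : R) : w.2 < b -> \forall w' \near w, w'.2 < b.
  by move=> wb; exact: (@cvg_snd _ _ (nbhs w.1) (nbhs w.2) _ _ (lt_nbhsl wb)).
have snd_gt (b : R) : b < w.2 -> \forall w' \near w, b < w'.2.
  by move=> wb; exact: (@cvg_snd _ _ (nbhs w.1) (nbhs w.2) _ _ (lt_nbhsr wb)).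
case: c => /= [w1|[w1 [k /[dup] kw /andP[k1 k2]]]|[w1 [j /[dup] jw /andP[k1 k2]]]].
- by apply: filterS (fst_lt _ w1) => w'.
- apply: filterS3 (fst_gt _ w1) (snd_gt _ k1) (snd_lt _ k2) => w' h1 h2 h3.
  split; first by split=> //; exists k; rewrite h2 h3.
  by rewrite !(@truncn_open _ k) // h2 h3.
- have j1 : j%:R - 2^-1 < w.2 by lra.
  have j2 : w.2 < j%:R + 1 - 2^-1 by lra.
  apply: filterS3 (fst_gt _ w1) (snd_gt _ j1) (snd_lt _ j2) => w' h1 h2 h3.
  have {}h2 : j%:R < w'.2 + 2^-1 by lra.
  have {}h3 : w'.2 + 2^-1 < j%:R + 1 by lra.
  split; first by split=> //; exists j; rewrite h2 h3.
  by rewrite !(@truncn_open _ j) // h2 h3.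
Qed.

Lemma half_side (u : R) : 0 < u < 1 -> u != 2^-1 ->
  (0 < u < 2^-1) || (0 < 1 - u < 2^-1).
Proof.
move=> /andP[u0 u1] u2; case: (ltgtP u 2^-1) u2 => // h _; apply/orP; [left|right];
  apply/andP; split; lra.
Qed.

(* Near the vertices, the coordinate u along a side k is measured from the
   nearest end of the side. *)
Lemma vertices_low (k : nat) (u : R) : 0 <= u < 2^-1 ->
  k%:R < k%:R + u + 2^-1 < k%:R + 1.
Proof. by move=> /andP[? ?]; apply/andP; split; lra. Qed.

Lemma vertices_high (k : nat) (u : R) : 0 <= 1 - u < 2^-1 ->
  k.+1%:R < k%:R + u + 2^-1 < k.+1%:R + 1.
Proof. by rewrite -[k.+1%:R]natr1 => /andP[? ?]; apply/andP; split; lra. Qed.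

Lemma vertices_side (k : nat) (u : R) : 0 < u < 1 ->
  chart_dom Vertices (1, k%:R + u) -> (0 < u < 2^-1) || (0 < 1 - u < 2^-1).
Proof.
move=> Hu /= [_ [j Hj]]; apply: half_side => //; apply/eqP => E.
move: Hj; rewrite E -addrA (_ : 2^-1 + 2^-1 = 1); last by lra.
by rewrite [k%:R + 1]natr1 nat_no_gap.
Qed.

Lemma chart_dom_rel c w w' : surf_rel g w w' -> chart_dom c w -> chart_dom c w'.
Proof.
have half0 : 0 + 2^-1 = (0%N)%:R + 2^-1 :> R by [].
have h12 : 0 < (2^-1 : R) < 1 by apply/andP; split; lra.
have gN : 0%:R < (0 : R) + 2^-1 < 0%:R + 1 by rewrite half0 nat_gap.
have gN' : N%:R < (N%:R : R) + 2^-1 < N%:R + 1 by rewrite nat_gap.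
have no0 k : (k%:R < (0 : R) < k%:R + 1) = false by exact: (nat_no_gap 0).
case=> {w w'} [s s'|//|r|r|k u kN Hu|j j' jN j'N].
- by case: c => //= -[]; rewrite ltxx.
- case: c => //= -[r0 [k Hk]]; first by rewrite no0 in Hk.
  by split=> //; exists N.
- case: c => //= -[r0 [k Hk]]; first by rewrite nat_no_gap in Hk.
  by split=> //; exists 0%N.
- have Hu' : 0 < 1 - u < 1 by case/andP: Hu => ? ?; apply/andP; split; lra.
  rewrite -addrA; case: c => /=; first by rewrite ltxx.
    by move=> _; split; [exact: ltr01 | exists (glued_side k); rewrite nat_gap].
  move=> H; split; first exact: ltr01.
  have /orP[/andP[h1 h2]|/andP[h1 h2]] := vertices_side Hu H.
    by exists (glued_side k).+1; apply: vertices_high; rewrite subKr ltW.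
  by exists (glued_side k); apply: vertices_low; rewrite ltW.
- case: c => //=; last by move=> _; split; [exact: ltr01 | exists j'; rewrite nat_gap].
  by case=> _ [k]; rewrite nat_no_gap.
Qed.

(** Quantifying over all coordinates of the point makes openness a case of [surf_near]; by
    [chart_dom_rel] one set of coordinates decides. *)
Definition chart_set c : set X := [set y | forall w, rect w -> surf w = y -> chart_dom c w].

Lemma chart_setP c w : rect w -> chart_dom c w -> chart_set c (surf w).
Proof. by move=> Kw cw w' Kw' E; apply: chart_dom_rel cw; apply: surf_eqP. Qed.

Lemma surf_near1 y0 (P : R * R -> Prop) :
  (forall w, rect w -> surf w = y0 -> \forall w' \near w, P w') ->
  \forall y \near y0, forall w, rect w -> surf w = y -> P w.
Proof.
move=> H; have [|[A B] /= [A0 By] AB] := @surf_near R g g_gt0 R 0 y0 (fun _ => P).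
  move=> w Kw E; exists (setT, [set w' | P w']); last by move=> [t w'] [].
  by split; [exact: filterT | exact: H].
apply: filterS By => y By w Kw E.
by apply: (AB (0, y)) Kw E; split=> //; exact: nbhs_singleton.
Qed.

Lemma chart_set_open c y : chart_set c y -> nbhs y (chart_set c).
Proof.
move=> cy; apply: surf_near1 => w Kw E.
by apply: filterS (chart_near (cy w Kw E)) => w' [].
Qed.

Lemma chart_set_cover y : exists c, chart_set c y.
Proof.
have [[r s] Kw <-] := surf_surj g_gt0 y; have /andP[/andP[/= r0 r1] /= Hs] := Kw.
have [r1'|r1'] := ltP r 1; first by exists Inside; apply: chart_setP.
have rE : r = 1 by apply/eqP; rewrite eq_le r1 r1'.
have [k [u [sE /andP[u0 u1] _ _]]] := nat_frac Hs.
have [u00|u00] := eqVneq u 0.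
  exists Vertices; apply: chart_setP => //; rewrite /= rE; split; first exact: ltr01.
  by exists k; rewrite sE u00 addr0 nat_gap //; apply/andP; split; lra.
exists Edges; apply: chart_setP => //; rewrite /= rE; split; first exact: ltr01.
have u01 : 0 < u < 1 by rewrite u1 andbT lt_neqAle eq_sym u00 u0.
by exists k; rewrite sE nat_gap.
Qed.

(** * Sheets of the covering over the charts *)

Section sheets.
Variables (V : Type) (act : V -> 'Z_N -> V).
Hypothesis act_surface : surface_action (@glued_pos g) act.
Local Notation phi := (next_side (@glued_pos g)).

Lemma act_glued v k : (k < N)%N -> act (act v k%:R) (glued_side k)%:R = v.
Proof. by move=> kN; rewrite -glued_posE //; exact: act_surface.1. Qed.

Lemma act_inj j v v' : act v j = act v' j -> v = v'.
Proof. by move=> E; rewrite -(act_surface.1 v j) E act_surface.1. Qed.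

Lemma act_onto j v : exists v', act v' j = v.
Proof.
exists (act v (glued_pos j)).
by have := act_surface.1 v (glued_pos j); rewrite glued_posK.
Qed.

Lemma walk_inj n j v v' : walk (@glued_pos g) act n j v = walk (@glued_pos g) act n j v' -> v = v'.
Proof. by elim: n => //= n IH /act_inj. Qed.

Lemma walk_onto n j v : exists v', walk (@glued_pos g) act n j v' = v.
Proof.
elim: n v => [|n IH] v; first by exists v.
by have [v1 <-] := act_onto (iter n phi j) v; have [v2 <-] := IH v1; exists v2.
Qed.

Lemma walk_shift m j v : walk (@glued_pos g) act m.+1 j v =
  walk (@glued_pos g) act m (phi j) (act v j).
Proof. by elim: m => //= m ->; rewrite -iterSr. Qed.

(* The tile reached by turning around the vertex j of the tile v until this
   vertex is the vertex 0. *)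
Definition vertex_label (j : nat) v :=
  walk (@glued_pos g) act (N - vertex_rank (j %% N)) j%:R v.

Lemma vertex_label_next k v : (k < N)%N ->
  vertex_label k v = vertex_label (glued_side k).+1 (act v k%:R).
Proof.
move=> kN; rewrite /vertex_label modn_small //.
have rk := vertex_rank_lt g_gt0 kN.
have -> : (N - vertex_rank k = (N - (vertex_rank k).+1).+1)%N by rewrite subnSK.
rewrite walk_shift next_posE //.
case: (vertex_rank_next g_gt0 kN) => [[lt E]|[E E']].
  by rewrite modn_small // E.
have r0 : vertex_rank (N %% N) = 0%N by rewrite modnn.
by rewrite E E' subnn r0 subn0 posN // act_surface.2.
Qed.

(** The tiles that share an edge or a vertex must name it alike: an edge is named by the tile in
    which its position is 0 or 1 modulo 4, a vertex by the tile of which it is the vertex 0. *)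
Definition sheet c w v : V :=
  match c with
  | Inside => v
  | Edges => let k := chart_index Edges w in if (k %% 4 < 2)%N then v else act v k%:R
  | Vertices => vertex_label (chart_index Vertices w) v
  end.

Lemma sheet_inj c w v v' : sheet c w v = sheet c w v' -> v = v'.
Proof.
case: c => //=; last exact: walk_inj.
by case: ifP => // _; exact: act_inj.
Qed.

Lemma sheet_onto c w v : exists v', sheet c w v' = v.
Proof.
case: c => /=; first by exists v.
  case: (boolP (Num.truncn w.2 %% 4 < 2)%N) => _; [by exists v | exact: act_onto].
exact: walk_onto.
Qed.

Lemma sheet_side c k u v : (k < N)%N -> 0 < u < 1 -> chart_dom c (1, k%:R + u) ->
  sheet c (1, k%:R + u) v = sheet c (1, (glued_side k)%:R + 1 - u) (act v k%:R).
Proof.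
move=> kN Hu.
have Hu' : 0 < 1 - u < 1 by case/andP: Hu => ? ?; apply/andP; split; lra.
rewrite -addrA; case: c => /=; first by rewrite ltxx.
  move=> _; rewrite (@truncn_open (k%:R + u) k) ?nat_gap //.
  rewrite (@truncn_open ((glued_side k)%:R + (1 - u)) (glued_side k)) ?nat_gap //.
  rewrite /glued_side; case: (boolP (k %% 4 < 2)%N) => k4.
    have -> : ((k + 2) %% 4 < 2)%N = false by move: k4; clear; lia.
    by have := act_glued v kN; rewrite /glued_side k4.
  by have -> : ((k - 2) %% 4 < 2)%N by move: k4; clear; lia.
move=> H; have /orP[/andP[h1 h2]|/andP[h1 h2]] := vertices_side Hu H.
  rewrite (@truncn_open _ k); last by apply: vertices_low; rewrite ltW.
  rewrite (@truncn_open _ (glued_side k).+1); last by apply: vertices_high; rewrite subKr ltW.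
  exact: vertex_label_next.
rewrite (@truncn_open _ k.+1); last by apply: vertices_high; rewrite ltW.
rewrite (@truncn_open _ (glued_side k)); last by apply: vertices_low; rewrite ltW.
rewrite (@vertex_label_next (glued_side k)); last exact: glued_side_lt.
by rewrite glued_sideK act_glued.
Qed.

(** Off the centre and the vertices, equality in one chart determines [v'] from [v], as the same
    tile or the one across the side, whatever the chart. At the centre and at the vertices only one
    chart is available. *)
Lemma sheet_compat c d w w' v v' : surf_rel g w w' ->
  chart_dom c w -> chart_dom d w ->
  sheet c w v = sheet c w' v' -> sheet d w v = sheet d w' v'.
Proof.
have v0N v0 : vertex_label 0 v0 = vertex_label N v0.
  by rewrite /vertex_label modnn mod0n posN.
have t0 : Num.truncn ((0 : R) + 2^-1) = 0%N.
  by apply: truncn_open; apply/andP; split; lra.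
have tN : Num.truncn ((N%:R : R) + 2^-1) = N.
  by apply: truncn_open; apply/andP; split; lra.
have no0 k : (k%:R < (0 : R) < k%:R + 1) = false by exact: (nat_no_gap 0).
case=> {w w'} [s s'|w|r|r|k u kN Hu|j j' jN j'N].
- have I e : chart_dom e (0, s) -> e = Inside by case: e => //= -[]; rewrite ltxx.
  by move=> /I -> /I ->.
- by move=> _ _ /sheet_inj ->.
- have E e : chart_dom e (r, 0) -> forall v0, sheet e (r, N%:R) v0 = sheet e (r, 0) v0.
    case: e => //= [[_ [k]]|_ v0]; first by rewrite no0.
    by rewrite t0 tN -v0N.
  by move=> Dc Dd; rewrite !E // => /sheet_inj ->.
- have E e : chart_dom e (r, N%:R) -> forall v0, sheet e (r, N%:R) v0 = sheet e (r, 0) v0.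
    case: e => //= [[_ [k]]|_ v0]; first by rewrite nat_no_gap.
    by rewrite t0 tN -v0N.
  by move=> Dc Dd; rewrite !E // => /sheet_inj ->.
- by move=> Dc Dd; rewrite !sheet_side // => /sheet_inj <-.
- have D e : chart_dom e (1, j%:R) -> e = Vertices.
    by case: e => //=; [rewrite ltxx | case=> _ [k]; rewrite nat_no_gap].
  by move=> /D -> /D ->.
Qed.

Definition tiled := (V * {w | rect w})%type.
Definition tiled_pr (e : tiled) : X := surf (sval e.2).
Definition tiled_lab c (e : tiled) := sheet c (sval e.2) e.1.

Lemma tiled_surj c y v : chart_set c y -> exists2 e, tiled_pr e = y & tiled_lab c e = v.
Proof.
move=> _; have [w Kw E] := surf_surj g_gt0 y; have [v' E'] := sheet_onto c w v.
by exists (v', exist _ w Kw).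
Qed.

Lemma sheet_near c w : chart_dom c w -> \forall w' \near w, sheet c w' = sheet c w.
Proof.
move=> cw; apply: filterS (chart_near cw) => w' [_ E].
by apply/funext => v; case: c {cw} E => //= ->.
Qed.

Lemma tiled_loc c d y : chart_set c y -> chart_set d y -> exists2 W : set X, nbhs y W &
  forall e e', W (tiled_pr e) -> W (tiled_pr e') ->
    tiled_lab c e = tiled_lab c e' -> tiled_lab d e = tiled_lab d e'.
Proof.
move=> cy dy.
(* Over this neighbourhood each point has the sheet functions of some point of the fibre of [y], so
   the comparison takes place in that fibre. *)
exists [set y' | forall w, rect w -> surf w = y' -> exists w0,
  [/\ rect w0, surf w0 = y, sheet c w = sheet c w0 & sheet d w = sheet d w0]].
  apply: surf_near1 => w Kw E.
  apply: filterS2 (sheet_near (cy w Kw E)) (sheet_near (dy w Kw E)) => w' E1 E2.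
  by exists w.
move=> [v [w Kw]] [v' [w' Kw']] /= W W'; rewrite /tiled_lab /=.
have [w0 [K0 E0 -> ->]] := W w Kw erefl; have [w1 [K1 E1 -> ->]] := W' w' Kw' erefl.
by apply: sheet_compat; [apply: surf_eqP; rewrite ?E0 ?E1 | exact: cy | exact: dy].
Qed.

End sheets.
End charts.

(** * Contraction of the charts *)

Section contraction.
Variables (R : realType) (g : nat).
Hypothesis g_gt0 : (0 < g)%N.
Local Notation N := (4 * g)%N.
Local Notation X := (closed_orientable_surface R g).
Local Notation surf := (@surf R g).
Local Notation rect := (@rect R g).
Local Notation chart_set := (@chart_set R g).
Implicit Types (c : chart) (w : R * R) (y : X).

(** In the disk the angle is kept, so that points move along radii. *)
Definition chart_center c (k : nat) w : R * R :=
  match c with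
  | Inside => (0, w.2)
  | Edges => (1, k%:R + 2^-1)
  | Vertices => (1, k%:R)
  end.

Definition contract c (t : R) w : R * R :=
  let z := chart_center c (chart_index c w) w in
  ((1 - t) * w.1 + t * z.1, (1 - t) * w.2 + t * z.2).

Lemma contract0 c w : contract c 0 w = w.
Proof. by case: w => r s; rewrite /contract /= subr0 !mul1r !mul0r !addr0. Qed.

Lemma contract1 c w : contract c 1 w = chart_center c (chart_index c w) w.
Proof. by rewrite /contract subrr !mul0r !add0r !mul1r -surjective_pairing. Qed.

Lemma chart_index_le c w : rect w -> chart_dom c w ->
  rect (chart_center c (chart_index c w) w).
Proof.
case/andP=> /andP[r0 r1] /andP[s0 s1]; rewrite /rect.
case: c => /= [_|[_ [k Hk]]|[_ [k Hk]]]; first by rewrite lexx ler01 s0 s1.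
- rewrite (truncn_open Hk) ler01 lexx /=; apply/andP; split.
    by rewrite addr_ge0 // invr_ge0.
  have : (k < N)%N by rewrite -(ltr_nat R); case/andP: Hk => h _; exact: lt_le_trans s1.
  by rewrite -(ler_nat R) -natr1 => h; lra.
- rewrite (truncn_open Hk) ler01 lexx ler0n ler_nat /= -ltnS -(ltr_nat R) -natr1.
  by case/andP: Hk => h _; lra.
Qed.

(** A side is contracted in its own coordinate [u], towards [1/2] or the nearest end, and this
    commutes with [u -> 1 - u]. *)
Lemma contract_compat c t w w' : 0 <= t <= 1 -> surf_rel g w w' -> chart_dom c w ->
  surf (contract c t w) = surf (contract c t w').
Proof.
move=> Ht; have /andP[t0 t1] := Ht; have no0 k : (k%:R < (0 : R) < k%:R + 1) = false by exact: (@nat_no_gap R 0 k).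
have h1 (x : R) : (1 - t) * x + t * x = x by ring.
have h12 : 0 < (2^-1 : R) < 1 by apply/andP; split; lra.
have tr0 : Num.truncn ((0 : R) + 2^-1) = 0%N.
  by apply: truncn_open; apply/andP; split; lra.
have trN (k : nat) : Num.truncn ((k%:R : R) + 2^-1) = k.
  by apply: truncn_open; apply/andP; split; lra.
have bnd (u v : R) : 0 <= u <= 1 -> 0 <= v <= 1 -> 0 <= (1 - t) * u + t * v <= 1.
  by move=> /andP[u0 u1] /andP[v0 v1]; apply/andP; split; nra.
case=> {w w'} [s s'|//|r|r|k u kN Hu|j j' jN j'N].
- case: c => /= [_|[]|[]]; rewrite ?ltxx //.
  by rewrite /contract /= !mulr0 addr0; exact: surf0.
- case: c => /= [_|[_ [k]]|_]; rewrite /contract /= ?no0 //.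
    by rewrite !h1; exact: surfN.
  by rewrite tr0 trN !h1; exact: surfN.
- case: c => /= [_|[_ [k]]|_]; rewrite /contract /= ?nat_no_gap //.
    by rewrite !h1; exact/esym/surfN.
  by rewrite tr0 trN !h1; exact/esym/surfN.
- have Hu' : 0 < 1 - u < 1 by case/andP: Hu => ? ?; apply/andP; split; lra.
  have [u0 u1] := andP Hu.
  have side k' (v : R) x x' : 0 <= v <= 1 -> (k' < N)%N -> x = k'%:R + v ->
      x' = (glued_side k')%:R + 1 - v -> surf (1, x) = surf (1, x').
    by move=> Hv k'N -> ->; exact: surf_side.
  rewrite -addrA; case: c => /=; first by rewrite ltxx.
    move=> _; rewrite /contract /= !h1.
    rewrite (@truncn_open _ (k%:R + u) k) ?nat_gap //.
    rewrite (@truncn_open _ ((glued_side k)%:R + (1 - u)) (glued_side k)) ?nat_gap //.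
    apply: (side k ((1 - t) * u + t / 2)) => //; [by apply: bnd; apply/andP; split; lra | ring | by field].
  move=> H; rewrite /contract /= !h1.
  have /orP[/andP[a1 a2]|/andP[a1 a2]] := vertices_side Hu H.
    rewrite (@truncn_open _ (k%:R + u + 2^-1) k); last by apply: vertices_low; rewrite ltW.
    rewrite (@truncn_open _ ((glued_side k)%:R + (1 - u) + 2^-1) (glued_side k).+1); last by apply: vertices_high; rewrite subKr ltW.
    apply: (side k ((1 - t) * u + t * 0)) => //; [by apply: bnd; apply/andP; split; lra | ring | rewrite -natr1; ring].
  rewrite (@truncn_open _ (k%:R + u + 2^-1) k.+1); last by apply: vertices_high; rewrite ltW.
  rewrite (@truncn_open _ ((glued_side k)%:R + (1 - u) + 2^-1) (glued_side k)); last by apply: vertices_low; rewrite ltW.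
  apply: (side k ((1 - t) * u + t * 1)) => //; [by apply: bnd; apply/andP; split; lra | rewrite -natr1; ring | ring].
- case: c => /= [|[_ [k]]|_]; rewrite ?ltxx ?nat_no_gap // /contract /= !trN !h1.
  by rewrite !surf_vertex.
Qed.

Lemma contract_near c t w (A : set X) : chart_dom c w -> nbhs (surf (contract c t w)) A ->
  \forall t' \near t & w' \near w, A (surf (contract c t' w')).
Proof.
move=> cw; set k := chart_index c w.
pose H (z : R * (R * R)) := let z0 := chart_center c k z.2 in
  surf ((1 - z.1) * z.2.1 + z.1 * z0.1, (1 - z.1) * z.2.2 + z.1 * z0.2).
have c1 : continuous (fun z : R * (R * R) => z.1) by move=> z; exact: cvg_fst.
have c2 : continuous (fun z : R * (R * R) => z.2) by move=> z; exact: cvg_snd.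
have c21 : continuous (fun z : R * (R * R) => z.2.1).
  by apply: continuous_compose c2 _ => z; exact: cvg_fst.
have c22 : continuous (fun z : R * (R * R) => z.2.2).
  by apply: continuous_compose c2 _ => z; exact: cvg_snd.
have comb (f1 f2 : R * (R * R) -> R) : continuous f1 -> continuous f2 ->
    continuous (fun z : R * (R * R) => (1 - z.1) * f1 z + z.1 * f2 z : R).
  move=> cf1 cf2 z; apply: cvgD; apply: cvgM; try exact: cf1; try exact: cf2; try exact: c1.
  by apply: cvgB; [exact: cvg_cst | exact: c1].
have cc : continuous (fun z : R * (R * R) => chart_center c k z.2).
  clear H; move: (k) => k1; clear cw k; case: c => /=; try exact: continuous_cst.
  by apply: continuous_pair => //; exact: continuous_cst.
have cH : continuous H.
  apply: (@continuous_compose _ _ _ (fun z : R * (R * R) =>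
    ((1 - z.1) * z.2.1 + z.1 * (chart_center c k z.2).1,
     (1 - z.1) * z.2.2 + z.1 * (chart_center c k z.2).2)) surf); last exact: surf_continuous.
  apply: continuous_pair; apply: comb => //.
    by apply: continuous_compose cc _ => z; exact: cvg_fst.
  by apply: continuous_compose cc _ => z; exact: cvg_snd.
move=> At; have HA : \forall z \near (t, w), A (H z) by exact: (cH (t, w)).
have HI : \forall z \near (t, w), chart_index c z.2 = k.
  have wk : \forall w' \near w, chart_index c w' = k by apply: filterS (chart_near cw) => w' [].
  exact: (@cvg_snd _ _ (nbhs t) (nbhs w) _ _ wk).
by apply: filterS2 HA HI => -[t' w'] /=; rewrite /H /contract /= => h ->.
Qed.

Local Notation I := (unit_interval R).
Local Notation path x y := {path I from x to y in X}.

Lemma contract_continuous c w : continuous (contract c ^~ w).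
Proof.
have cl (a b : R) : continuous (fun t : R => (1 - t) * a + t * b).
  move=> t; apply: cvgD; apply: cvgM; try exact: cvg_cst; last exact: cvg_id.
  by apply: cvgB; [exact: cvg_cst | exact: cvg_id].
by apply: continuous_pair; exact: cl.
Qed.

Lemma contract_surf c t w w' : 0 <= t <= 1 -> rect w -> rect w' -> surf w = surf w' ->
  chart_dom c w -> surf (contract c t w) = surf (contract c t w').
Proof. by move=> Ht Kw Kw' E; apply: contract_compat => //; exact: surf_eqP. Qed.

(** The contraction gives a square with the path on one side, the constant at [z] opposite, and the
    tracks of the end points on the others. Coordinates along the path are chosen without
    continuity; that of [H] comes from [surf_near] and [contract_surf]. *)
Lemma contract_path c x y z (p : path x y) w w' (k : path x z) (k' : path y z) :
  (forall t, chart_set c (p t)) ->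
  (forall t v, rect v -> surf v = p t -> surf (contract c 1 v) = z) ->
  rect w -> surf w = x -> rect w' -> surf w' = y ->
  (forall t, k t = surf (contract c (val t) w)) ->
  (forall t, k' t = surf (contract c (val t) w')) ->
  p ~~ pcat k (prev k').
Proof.
move=> pc pz Kw Ew Kw' Ew' kE k'E.
pose rep (u : X) := s2val (cid2 (surf_surj g_gt0 u)).
have repK u : rect (rep u) := s2valP (cid2 (surf_surj g_gt0 u)).
have repE u : surf (rep u) = u := s2valP' (cid2 (surf_surj g_gt0 u)).
pose cl (t : R) : R := Num.max 0 (Num.min 1 t).
have cl01 t : 0 <= cl t <= 1 by apply: clamp_itv; exact: ler01.
pose H (st : R * R) := surf (contract c (cl st.1) (rep (p (to_unit st.2)))).
have HE t u v : rect v -> surf v = p (to_unit u) -> H (t, u) = surf (contract c (cl t) v).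
  by move=> Kv Ev; apply: contract_surf => //; [rewrite repE | apply: pc; [exact: repK | exact: repE]].
have cH : continuous H.
  move=> [t u] A At; have [|[B D] /= [Bt Du] BD] := @surf_near R g g_gt0 R (cl t)
      (p (to_unit u)) (fun t' v => A (surf (contract c t' v))).
    move=> v Kv Ev; apply: contract_near; last by rewrite -(HE t u v).
    exact: pc Kv Ev.
  have Bt' : nbhs t (cl @^-1` B) by exact: @clamp_continuous R 0 1 t _ Bt.
  have Du' : nbhs u ((fun u' => p (to_unit u')) @^-1` D).
    exact: @extended_path_continuous _ _ _ _ p u _ Du.
  exists (cl @^-1` B, (fun u' => p (to_unit u')) @^-1` D) => // -[t' u'] [/= Bt1 Du1].
  by apply: (BD (cl t', p (to_unit u'))); rewrite ?repE.
have cl_val (t : I) : cl (val t) = val t by apply: clamp_id; exact: unit_val_itv.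
have cl0 : cl 0 = 0 by apply: clamp_id; rewrite lexx ler01.
have cl1 : cl 1 = 1 by apply: clamp_id; rewrite lexx ler01.
have sq := @path_square R X H x y z z p k (cst_path z) k' cH.
have {}sq : p ~~ pcat k (pcat (cst_path z) (prev k')).
  apply: sq => t.
  - by rewrite /H /= cl0 contract0 repE to_unitK.
  - rewrite kE (HE _ _ w) // ?cl_val // path_to_unit0 //.
  - by rewrite /H /= cl1 (pz (to_unit (val t))).
  - rewrite k'E (HE _ _ w') // ?cl_val // path_to_unit1 //.
by apply: path_homotopic_trans sq _; rewrite pcat1p; exact: path_homotopic_refl.
Qed.

Lemma contract_near_center c y0 : chart_set c y0 -> exists z,
  \forall y \near y0, chart_set c y /\ forall w, rect w -> surf w = y -> surf (contract c 1 w) = z.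
Proof.
move=> cy0; have [w0 K0 E0] := surf_surj g_gt0 y0.
exists (surf (contract c 1 w0)); apply: filterS2 (chart_set_open g_gt0 cy0) _ => [y cy H|]; first by split; [exact: cy | exact: H].
apply: surf_near1 => // w Kw E; have cw := cy0 w Kw E.
have -> : surf (contract c 1 w0) = surf (contract c 1 w).
  by apply: contract_surf; rewrite ?lexx ?ler01 ?E //; exact: cy0.
case: c cy0 cw => cy0 cw; rewrite contract1.
- by apply: filterS (chart_near cw) => w' _; rewrite contract1; exact: surf0.
- by apply: filterS (chart_near cw) => w' [_ E']; rewrite contract1 E'.
- by apply: filterS (chart_near cw) => w' [_ E']; rewrite contract1 E'.
Qed.

End contraction.

(** * The side loops *)

Section loops.
Variables (R : realType) (g : nat).
Hypothesis g_gt0 : (0 < g)%N.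
Variable w0 : R * R.
Local Notation N := (4 * g)%N.
Local Notation X := (closed_orientable_surface R g).
Local Notation surf := (@surf R g).
Local Notation rect := (@rect R g).
Local Notation I := (unit_interval R).
Local Notation path x y := {path I from x to y in X}.
Local Notation o := (surf (0, 0)).
Local Notation G := (fundamental_group R (surf w0)).
Local Notation phi := (next_side (@glued_pos g)).
Implicit Types (w : R * R) (x y z : X).

Lemma radial_continuous w : continuous (fun t : R => surf (t * w.1, w.2)).
Proof.
apply: (@continuous_compose _ _ _ (fun t : R => (t * w.1, w.2)) surf); last exact: surf_continuous.
apply: continuous_pair; last exact: continuous_cst.
by move=> t; apply: cvgM; [exact: cvg_id | exact: cvg_cst].
Qed.

Lemma radial_0 w : surf (0 * w.1, w.2) = o. Proof. by rewrite mul0r; exact: surf0. Qed.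

Lemma radial_1 w x : surf w = x -> surf (1 * w.1, w.2) = x.
Proof. by rewrite mul1r -surjective_pairing. Qed.

Definition radial w x (E : surf w = x) : path o x :=
  real_path (@radial_continuous w) (radial_0 w) (radial_1 E).

(** The choice of [w] among the coordinates of [x] tells by which side or corner of the polygon the
    point is reached. *)
Definition spoke w x (E : surf w = x) : path (surf w0) x :=
  pcat (prev (radial (erefl (surf w0)))) (radial E).

Definition loop w w' x y (E : surf w = x) (p : path x y) (E' : surf w' = y) : G :=
  loop_class (pcat (spoke E) (pcat p (prev (spoke E')))).

(** Reaching [x] from one side and returning from another; for coordinates on two glued sides, this
    loop crosses the side once. *)
Definition turn w w' x (E : surf w = x) (E' : surf w' = x) : G := loop E (cst_path x) E'.

Lemma loop_homotopic_eq w w' x y (E : surf w = x) (p p' : path x y) (E' : surf w' = y) :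
  p ~~ p' -> loop E p E' = loop E p' E'.
Proof. by move=> pp'; apply/loop_classP; rewrite pp'; exact: path_homotopic_refl. Qed.

Lemma loop_mul w w' w'' x y z (E : surf w = x) (p : path x y) (E' : surf w' = y)
    (p' : path y z) (E'' : surf w'' = z) :
  (loop E p E' * loop E' p' E'')%g = loop E (pcat p p') E''.
Proof.
transitivity (loop_class (pcat (pcat (spoke E) (pcat p (prev (spoke E'))))
    (pcat (spoke E') (pcat p' (prev (spoke E''))))) : G); first exact: loop_class_concat.
apply/loop_classP; move: (spoke E) (spoke E') (spoke E'') => a b c.
by rewrite !pcatA pcatVK; exact: path_homotopic_refl.
Qed.

Lemma turn_mul w w' w'' x (E : surf w = x) (E' : surf w' = x) (E'' : surf w'' = x) :
  (turn E E' * turn E' E'')%g = turn E E''.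
Proof. by rewrite /turn loop_mul; apply: loop_homotopic_eq; exact: pcat1p. Qed.

Lemma turn_loop w w' w'' x y (E : surf w = x) (E' : surf w' = x) (p : path x y) (E'' : surf w'' = y) :
  (turn E E' * loop E' p E'')%g = loop E p E''.
Proof. by rewrite /turn loop_mul; apply: loop_homotopic_eq; exact: pcat1p. Qed.

Lemma loop_turn w w' w'' x y (E : surf w = x) (p : path x y) (E' : surf w' = y) (E'' : surf w'' = y) :
  (loop E p E' * turn E' E'')%g = loop E p E''.
Proof. by rewrite /turn loop_mul; apply: loop_homotopic_eq; exact: pcatp1. Qed.

Lemma turn_spoke w w' x (E : surf w = x) (E' : surf w' = x) :
  turn E E' = loop_class (pcat (spoke E) (prev (spoke E'))).
Proof. by apply/loop_classP; rewrite pcat1p; exact: path_homotopic_refl. Qed.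

Lemma turn_eq1 w w' x (E : surf w = x) (E' : surf w' = x) :
  (forall t, surf (t * w.1, w.2) = surf (t * w'.1, w'.2)) -> turn E E' = 1%g.
Proof.
move=> H; rewrite turn_spoke; apply/loop_classP.
have RR : radial E' ~~ radial E by apply: path_homotopic_ext => t; rewrite !real_pathE H.
by rewrite /spoke RR pcatpV; exact: path_homotopic_refl.
Qed.

Lemma turn_refl w x (E E' : surf w = x) : turn E E' = 1%g.
Proof. exact: turn_eq1. Qed.

Lemma turnV w w' x (E : surf w = x) (E' : surf w' = x) : (turn E E')^-1%g = turn E' E.
Proof. by apply: (mulgI (turn E E')); rewrite mulgV turn_mul turn_refl. Qed.

(** A path drawn in polar coordinates bounds, with the radii at its ends, a sector that shrinks to
    the centre. *)
Lemma loop_rect (f : R -> R * R) w w' x y (E : surf w = x) (p : path x y) (E' : surf w' = y) :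
  continuous f -> f 0 = w -> f 1 = w' -> (forall t, p t = surf (f (val t))) ->
  loop E p E' = 1%g.
Proof.
move=> cf f0 f1 pE; subst w w'; apply/loop_classP.
have cf1 : continuous (fun t => (f t).1) by apply: continuous_compose cf _ => z; exact: cvg_fst.
have cf2 : continuous (fun t => (f t).2) by apply: continuous_compose cf _ => z; exact: cvg_snd.
pose H (st : R * R) := surf (st.1 * (f st.2).1, (f st.2).2).
have cH : continuous H.
  apply: (@continuous_compose _ _ _ (fun st : R * R => (st.1 * (f st.2).1, (f st.2).2)) surf); last exact: surf_continuous.
  have c2 : continuous (fun z : R * R => z.2) by move=> z; exact: cvg_snd.
  apply: continuous_pair; last exact: continuous_compose c2 cf2.
  move=> z; apply: cvgM; first exact: cvg_fst.
  exact: (continuous_compose c2 cf1).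
have sq : cst_path o ~~ pcat (radial E) (pcat p (prev (radial E'))).
  apply: (@path_square R X H) => // t.
  - by rewrite /H /= mul0r; exact: surf0.
  - by rewrite pE /H /= mul1r -surjective_pairing.
rewrite /spoke; move: (radial E) (radial E') (radial (erefl (surf w0))) sq => r r' a sq.
transitivity (pcat (prev a) (pcat (pcat r (pcat p (prev r'))) (prev (prev a)))).
  by rewrite prev_cat !pcatA; exact: path_homotopic_refl.
by rewrite -sq pcat1p; exact: pcatpV.
Qed.

Lemma turn_side k u u' (a a' b b' : R) x y (E : surf (1, a) = x) (E' : surf (1, a') = x)
    (F : surf (1, b) = y) (F' : surf (1, b') = y) :
  (k < N)%N -> 0 <= u <= 1 -> 0 <= u' <= 1 ->
  a = k%:R + u -> a' = (glued_side k)%:R + 1 - u ->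
  b = k%:R + u' -> b' = (glued_side k)%:R + 1 - u' -> turn E E' = turn F F'.
Proof.
move=> kN /andP[u0 u1] /andP[u'0 u'1] aE a'E bE b'E.
pose f (t : R) : R * R := (1, k%:R + ((1 - t) * u + t * u')).
pose f' (t : R) : R * R := (1, (glued_side k)%:R + 1 - ((1 - t) * u + t * u')).
have cu : continuous (fun t : R => (1 - t) * u + t * u').
  move=> t; apply: cvgD; apply: cvgM; try exact: cvg_cst; last exact: cvg_id.
  by apply: cvgB; [exact: cvg_cst | exact: cvg_id].
have cf : continuous f.
  apply: continuous_pair; first exact: continuous_cst.
  by move=> t; apply: cvgD; [exact: cvg_cst | exact: cu].
have cf' : continuous f'.
  apply: continuous_pair; first exact: continuous_cst.
  by move=> t; apply: cvgB; [exact: cvg_cst | exact: cu].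
have cp : continuous (fun t => surf (f t)).
  by apply: (continuous_compose cf); exact: surf_continuous.
have f0 : f 0 = (1, a) by rewrite /f aE; congr (_, _); ring.
have f1 : f 1 = (1, b) by rewrite /f bE; congr (_, _); ring.
have f'0 : f' 0 = (1, a') by rewrite /f' a'E; congr (_, _); ring.
have f'1 : f' 1 = (1, b') by rewrite /f' b'E; congr (_, _); ring.
have e0 : surf (f 0) = x by rewrite f0.
have e1 : surf (f 1) = y by rewrite f1.
pose p : path x y := real_path cp e0 e1.
have L : loop E p F = 1%g by apply: (loop_rect (f := f)).
have L' : loop E' p F' = 1%g.
  apply: (loop_rect (f := f')) => // t; rewrite real_pathE; apply: surf_side => //.
  by have /andP[t0 t1] := unit_val_itv t; apply/andP; split; nra.
by rewrite -[LHS]mulg1 -L' turn_loop -(loop_turn E p F F') L mul1g.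
Qed.

Definition vertex_turn (j : 'Z_N) : G :=
  turn (erefl (surf (1, 0))) (surf_vertex R g_gt0 (ltnW (pos_lt g_gt0 j))).

Lemma vertex_turnE k (E : surf (1, k%:R) = surf (1, 0)) : (k <= N)%N ->
  turn (erefl (surf (1, 0))) E = vertex_turn k%:R.
Proof.
move=> kN; rewrite /vertex_turn; set E' := surf_vertex _ _ _.
rewrite -(turn_mul _ E' E) (_ : turn E' E = 1%g) ?mulg1 //; apply: turn_eq1 => t /=.
have [->|kN'] := eqVneq k N; last by rewrite val_pos // ltn_neqAle kN'.
by rewrite posN // -surfN.
Qed.

(** The vertex [j], where the side [j] starts, is glued to the vertex [phi j]: this is the turn
    across the side at that point. Written as a quotient, it makes the product around a vertex
    telescope. *)
Definition side_loop (j : 'Z_N) : G := ((vertex_turn j)^-1 * vertex_turn (phi j))%g.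

Lemma turn_vertex (j j' : nat) x (E : surf (1, j%:R) = x) (E' : surf (1, j'%:R) = x) :
  (j <= N)%N -> (j' <= N)%N ->
  turn E E' = ((vertex_turn j%:R)^-1 * vertex_turn j'%:R)%g.
Proof.
move=> jN j'N; have e : x = surf (1, 0) by rewrite -E surf_vertex.
move: E E'; rewrite e => E E'.
by rewrite -(vertex_turnE E) // -(vertex_turnE E') // turnV turn_mul.
Qed.

Lemma turn_sideE k u x (E : surf (1, k%:R + u) = x)
    (E' : surf (1, (glued_side k)%:R + 1 - u) = x) :
  (k < N)%N -> 0 <= u <= 1 -> turn E E' = side_loop k%:R.
Proof.
move=> kN Hu; have gkN := glued_side_lt kN.
have F : surf (1, k%:R) = surf (1, 0) by rewrite surf_vertex // ltnW.
have F' : surf (1, (glued_side k).+1%:R) = surf (1, 0) by rewrite surf_vertex.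
have I0 : 0 <= (0 : R) <= 1 by rewrite lexx ler01.
rewrite (turn_side E E' F F' kN Hu I0) ?addr0 ?subr0 ?natr1 // turn_vertex //; last exact: ltnW.
by rewrite /side_loop next_posE.
Qed.

(** The turn across a side is the same at its two ends; at the far end it is the inverse of the loop
    of the glued side. *)
Lemma side_loop_glued j : (side_loop j * side_loop (glued_pos j) = 1)%g.
Proof.
rewrite -(pos_val j); have := pos_lt g_gt0 j; move: (nat_of_ord j) => k kN.
have gkN := glued_side_lt kN; rewrite glued_posE //.
have E : surf (1, k%:R) = surf (1, 0) by rewrite surf_vertex // ltnW.
have E' : surf (1, (glued_side k).+1%:R) = surf (1, 0) by rewrite surf_vertex.
have F : surf (1, k.+1%:R) = surf (1, 0) by rewrite surf_vertex.
have F' : surf (1, (glued_side k)%:R) = surf (1, 0) by rewrite surf_vertex // ltnW.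
have I0 : 0 <= (0 : R) <= 1 by rewrite lexx ler01.
have I1 : 0 <= (1 : R) <= 1 by rewrite lexx ler01.
have H : turn E E' = turn F F'.
  by apply: (turn_side E E' F F' kN I0 I1); rewrite ?addr0 ?subr0 ?natr1 // -natr1 addrK.
rewrite !turn_vertex ?(ltnW kN) ?(ltnW gkN) // in H.
rewrite /side_loop !next_posE // glued_sideK H -mulgA (mulgA (vertex_turn _)).
by rewrite mulgV mul1g mulVg.
Qed.

Local Notation act := (fun h j => (h * side_loop j)%g).

Lemma walk_mul n j h h' :
  walk (@glued_pos g) act n j (h * h')%g = (h * walk (@glued_pos g) act n j h')%g.
Proof. by elim: n => //= n ->; rewrite -mulgA. Qed.

Lemma walk_vertex_turn n j :
  walk (@glued_pos g) act n j (vertex_turn j) = vertex_turn (iter n phi j).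
Proof. by elim: n => //= n ->; rewrite /side_loop mulgA mulgV mul1g. Qed.

Lemma walk_side_loop j : walk (@glued_pos g) act N j 1%g = 1%g.
Proof.
apply: (mulgI (vertex_turn j)); rewrite -walk_mul mulg1 walk_vertex_turn iter_next_pos //.
Qed.

Definition side_word (h : G) := exists js : seq 'Z_N, h = foldl act 1%g js.

Lemma foldl_act h js : foldl act h js = (h * foldl act 1 js)%g.
Proof.
elim/last_ind: js => [|js j IH]; first by rewrite mulg1.
by rewrite !foldl_rcons IH -mulgA.
Qed.

Lemma side_word_mul h h' : side_word h -> side_word h' -> side_word (h * h')%g.
Proof. by case=> js -> [js' ->]; exists (js ++ js'); rewrite foldl_cat [RHS]foldl_act. Qed.

Lemma side_word1 : side_word 1%g. Proof. by exists [::]. Qed.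

Lemma side_word_side j : side_word (side_loop j).
Proof. by exists [:: j]; rewrite /= mul1g. Qed.

(** All vertices form one cycle of [phi], so turning leads from [j] to 0 and then to [j']. *)
Lemma side_word_vertex j j' : side_word ((vertex_turn j)^-1 * vertex_turn j')%g.
Proof.
have W n : side_word ((vertex_turn j)^-1 * vertex_turn (iter n phi j))%g.
  elim: n => [|n IH]; first by rewrite mulVg; exact: side_word1.
  have := side_word_mul IH (side_word_side (iter n phi j)).
  by rewrite /side_loop -mulgA (mulgA (vertex_turn _)) mulgV mul1g.
have rk := vertex_rank_lt g_gt0 (pos_lt g_gt0 j).
have j0 : iter (N - vertex_rank j) phi j = 0.
  rewrite -[X in iter _ _ X](pos_val j) -(iter_vertex_rank g_gt0 (pos_lt g_gt0 j)) -iterD subnK.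
    exact: iter_next_pos.
  exact: ltnW.
have := W (vertex_rank j' + (N - vertex_rank j))%N.
by rewrite iterD j0 iter_vertex_rank ?pos_lt // pos_val.
Qed.

Lemma side_word_turn w w' x (E : surf w = x) (E' : surf w' = x) :
  rect w -> rect w' -> side_word (turn E E').
Proof.
move=> Kw Kw'; have rel : surf_rel g w w' by apply: surf_eqP => //; rewrite E.
case: rel E E' {Kw Kw'} => {w w'} [s s'|w|r|r|k u kN /andP[u0 u1]|j j' jN j'N] E E'.
- by rewrite turn_eq1 => [|t]; [exact: side_word1 | rewrite mulr0; exact: surf0].
- by rewrite turn_refl; exact: side_word1.
- by rewrite turn_eq1 => [|t]; [exact: side_word1 | exact: surfN].
- by rewrite turn_eq1 => [|t]; [exact: side_word1 | rewrite surfN].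
- by rewrite turn_sideE // ?(ltW u0) ?(ltW u1) //; exact: side_word_side.
- by rewrite turn_vertex //; exact: side_word_vertex.
Qed.

End loops.

(** * Subdivision of paths and generation by the side crossings *)

Section segments.
Context {R : realType} {X : topologicalType} {x y : X}.
Local Notation I := (unit_interval R).
Local Notation path x y := {path I from x to y in X}.
Variable p : path x y.
Implicit Types a b c : R.

Definition along a := p (to_unit a).

Lemma affine_continuous a b : continuous (fun u : R => (1 - u) * a + u * b).
Proof.
move=> t; apply: cvgD; apply: cvgM; try exact: cvg_cst; last exact: cvg_id.
by apply: cvgB; [exact: cvg_cst | exact: cvg_id].
Qed.

Lemma segment_continuous a b : continuous (fun u : R => along ((1 - u) * a + u * b)).
Proof. exact: continuous_compose (@affine_continuous a b) (@extended_path_continuous _ _ _ _ p). Qed.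

Lemma segment_0 a b : along ((1 - 0) * a + 0 * b) = along a.
Proof. by rewrite subr0 mul1r mul0r addr0. Qed.

Lemma segment_1 a b : along ((1 - 1) * a + 1 * b) = along b.
Proof. by rewrite subrr mul1r mul0r add0r. Qed.

Definition segment a b : path (along a) (along b) :=
  real_path (@segment_continuous a b) (segment_0 a b) (segment_1 a b).

Lemma segment_cat a b c : pcat (segment a b) (segment b c) ~~ segment a c.
Proof.
apply: (@path_homotopic_param _ _ _ _ _ _ p _ _ (fun u => if u <= 2^-1
  then (1 - 2 * u) * a + (2 * u) * b else (1 - (2 * u - 1)) * b + (2 * u - 1) * c)
  (fun u => (1 - u) * a + u * c)).
- apply: paste_continuous; first exact: continuous_idfun.
  + apply: (@continuous_compose _ _ _ (fun u : R => 2 * u) (fun u : R => (1 - u) * a + u * b)).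
      exact/mull_continuous/id_real_continuous.
    exact: affine_continuous.
  + apply: (@continuous_compose _ _ _ (fun u : R => 2 * u - 1) (fun u : R => (1 - u) * b + u * c)).
      exact/subr_continuous/mull_continuous/id_real_continuous.
    exact: affine_continuous.
  + by move=> u ->; rewrite divff ?pnatr_eq0 // !subrr !subr0 !mul0r !mul1r add0r addr0.
- exact: affine_continuous.
- by rewrite invr_ge0 ler0n !mulr0 !subr0 !mul1r !mul0r.
- by case: leP => [?|_]; [exfalso; lra | rewrite mulr1 subrr mul0r; congr (_ + _); lra].
- move=> t; rewrite [LHS]path_concatE; have /andP[t0 t1] := unit_val_itv t.
  by case: leP => h; rewrite real_pathE to_unitE //; apply/andP; split; lra.
- by move=> t; rewrite real_pathE.
Qed.

End segments.

Section generation.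
Variables (R : realType) (g : nat).
Hypothesis g_gt0 : (0 < g)%N.
Variable w0 : R * R.
Local Notation N := (4 * g)%N.
Local Notation X := (closed_orientable_surface R g).
Local Notation surf := (@surf R g).
Local Notation rect := (@rect R g).
Local Notation I := (unit_interval R).
Local Notation path x y := {path I from x to y in X}.
Local Notation G := (fundamental_group R (surf w0)).
Local Notation side_word := (@side_word R g g_gt0 w0).
Local Notation loop := (@loop R g w0 _ _ _ _).

Lemma loop_cast w w' x x' y y' (E : surf w = x) (p : path x y) (E' : surf w' = y)
    (F : surf w = x') (p' : path x' y') (F' : surf w' = y') :
  (forall t, p t = p' t) -> loop E p E' = loop F p' F'.
Proof.
subst x y x' y'; move=> pp'; apply: loop_homotopic_eq; exact: path_homotopic_ext.
Qed.

Lemma loop_class_loop (p : path (surf w0) (surf w0)) :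
  loop (erefl (surf w0)) p (erefl (surf w0)) = loop_class p.
Proof.
apply/loop_classP; have S : spoke w0 (erefl (surf w0)) ~~ cst_path _ by exact: pcatVp.
by rewrite S pcat1p -{2}(pcatp1 p) -(pcatpV (cst_path _)) pcat1p; exact: path_homotopic_refl.
Qed.

(** The path contracts to the tracks of its two ends, whose loops are trivial because they are drawn
    in the rectangle. What remains is a turn at the contracted point. *)
Lemma side_word_chart c x y z (p : path x y) w w' (E : surf w = x) (E' : surf w' = y) :
  rect w -> rect w' -> (forall t, chart_set c (p t)) ->
  (forall t v, rect v -> surf v = p t -> surf (contract c 1 v) = z) ->
  side_word (loop E p E').
Proof.
move=> Kw Kw' pc pz.
have cc v : continuous (fun t => surf (contract c t v)).
  apply: (@continuous_compose _ _ _ (contract c ^~ v) surf); last exact: surf_continuous.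
  exact: contract_continuous.
have cw : chart_dom c w by apply: (pc zero) => //; rewrite path_zero.
have cw' : chart_dom c w' by apply: (pc one) => //; rewrite path_one.
have E0 : surf (contract c 0 w) = x by rewrite contract0.
have E0' : surf (contract c 0 w') = y by rewrite contract0.
have E1 : surf (contract c 1 w) = z by apply: (pz zero) => //; rewrite path_zero.
have E1' : surf (contract c 1 w') = z by apply: (pz one) => //; rewrite path_one.
pose k : path x z := real_path (cc w) E0 E1.
pose k' : path y z := real_path (cc w') E0' E1'.
have pk : p ~~ pcat k (prev k') by apply: (@contract_path R g g_gt0 c x y z p w w' k k' pc pz).
have L : loop E k E1 = 1%g.
  by apply: (@loop_rect R g w0 (contract c ^~ w)); [exact: contract_continuous | rewrite contract0 | |].
have L' : loop E1' (prev k') E' = 1%g.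
  apply: (@loop_rect R g w0 (fun t => contract c (1 - t) w')).
  - apply: (@continuous_compose _ _ _ (fun t : R => 1 - t) (contract c ^~ w')).
      exact/subl_continuous/id_real_continuous.
    exact: contract_continuous.
  - by rewrite subr0.
  - by rewrite subrr contract0.
  - move=> t; transitivity (k' (to_unit (1 - val t))); first by [].
    rewrite /k' real_pathE to_unitE //.
    by have /andP[t0 t1] := unit_val_itv t; apply/andP; split; lra.
rewrite (loop_homotopic_eq w0 E E' pk) -(loop_mul w0 E k E1) L mul1g.
rewrite -(turn_loop w0 E1 E1') L' mulg1.
by apply: side_word_turn; rewrite contract1; exact: chart_index_le.
Qed.

Lemma side_word_all (h : G) : rect w0 -> side_word h.
Proof.
move=> Kw0; pose p : path (surf w0) (surf w0) := repr (h : {eq_quot (loop_homotopic_equiv R (surf w0))}).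
have -> : h = loop_class p by rewrite /loop_class reprK.
have E0 : surf w0 = along p 0 by rewrite /along path_to_unit0.
have E1 : surf w0 = along p 1 by rewrite /along path_to_unit1.
(* The ends of a subdivision may be given any coordinates; quantifying over all of them makes the
   property locally constant in [t], the segments being defined in both directions. *)
pose good t := forall w (E : surf w = along p t), rect w -> side_word (loop E0 (segment p 0 t) E).
have step t0 t : (exists c z, forall u, 0 <= u <= 1 -> let v := along p ((1 - u) * t0 + u * t) in
    chart_set c v /\ forall w, rect w -> surf w = v -> surf (contract c 1 w) = z) -> good t0 -> good t.
  move=> [c [z cz]] g0 w E Kw.
  have [w1 K1 E1'] := surf_surj g_gt0 (along p t0).
  rewrite -(loop_homotopic_eq w0 E0 E (segment_cat p 0 t0 t)) -(loop_mul w0 E0 _ E1').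
  apply: side_word_mul; first exact: g0.
  apply: (side_word_chart (c := c) (z := z)) => // [u|u v Kv Ev].
    by rewrite real_pathE; have [] := cz _ (unit_val_itv u).
  by have [_ H] := cz _ (unit_val_itv u); apply: H => //; rewrite Ev real_pathE.
have good0 : good 0.
  move=> w E Kw; rewrite (@loop_homotopic_eq R g w0 _ _ _ _ E0 _ (cst_path _) E); first exact: side_word_turn.
  by apply: path_homotopic_ext => u; rewrite real_pathE !mulr0 addr0.
have good1 : good 1.
  apply: (@locally_constant_line R good _ 0 1 good0) => t0.
  have [c cy0] := chart_set_cover g_gt0 (along p t0).
  have [z Oz] := contract_near_center g_gt0 cy0.
  have : \forall t \near t0, chart_set c (along p t) /\
      forall w, rect w -> surf w = along p t -> surf (contract c 1 w) = z.
    exact: @extended_path_continuous _ _ _ _ p t0 _ Oz.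
  case/nbhs_ballP => d /= d0 Bd; apply/nbhs_ballP; exists d => //= t.
  rewrite /ball /= => td; split; apply: step; exists c, z => u /andP[u0 u1]; apply: Bd => /=.
  - rewrite -ball_normE /=.
    have -> : t0 - ((1 - u) * t + u * t0) = (1 - u) * (t0 - t) by ring.
    rewrite normrM (ger0_norm (_ : 0 <= 1 - u)) ?subr_ge0 //.
    by have := normr_ge0 (t0 - t); nra.
  - rewrite -ball_normE /=.
    have -> : t0 - ((1 - u) * t0 + u * t) = u * (t0 - t) by ring.
    rewrite normrM (ger0_norm u0).
    by have := normr_ge0 (t0 - t); nra.
have := good1 _ E1 Kw0; rewrite -loop_class_loop (@loop_cast _ _ _ _ _ _ E0 _ E1 (erefl _) p (erefl _)) //.
by move=> u; rewrite real_pathE mulr0 add0r mulr1 /along to_unitK.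
Qed.

End generation.

(** * Lifting loops to the tiles *)

Section tile_monodromy.
Variables (R : realType) (g : nat).
Hypothesis g_gt0 : (0 < g)%N.
Local Notation N := (4 * g)%N.
Local Notation X := (closed_orientable_surface R g).
Local Notation surf := (@surf R g).
Local Notation rect := (@rect R g).
Local Notation I := (unit_interval R).
Local Notation path x y := {path I from x to y in X}.
Variables (V : Type) (act : V -> 'Z_N -> V).
Hypothesis act_surface : surface_action (@glued_pos g) act.
Local Notation chart_set := (@chart_set R g).
Local Notation tiled_lab := (@tiled_lab R g V act).
Local Notation sheet_eq := (sheet_eq (@tiled_pr R g V) chart_set tiled_lab).
Local Notation transports := (transports (@tiled_pr R g V) chart_set tiled_lab).

Definition tile (v : V) w (Kw : rect w) : tiled R g V := (v, exist _ w Kw).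

Let compat := @tiled_loc R g g_gt0 V act act_surface.

Lemma tile_eq v w w' (Kw : rect w) (Kw' : rect w') : w = w' -> sheet_eq (tile v Kw) (tile v Kw').
Proof.
by move=> E; subst w'; rewrite (bool_irrelevance Kw Kw'); exact: sheet_eq_refl.
Qed.

(** Staying in the same tile is a lift, since [sheet] depends on the coordinates only through the
    chart index, which is locally constant. *)
Lemma transports_rect (f : R -> R * R) x y (p : path x y) v w w' (Kw : rect w) (Kw' : rect w') :
  continuous f -> (forall t, 0 <= t <= 1 -> rect (f t)) -> f 0 = w -> f 1 = w' ->
  (forall t, p t = surf (f (val t))) -> transports p (tile v Kw) (tile v Kw').
Proof.
move=> cf Kf f0 f1 pE.
pose cl (t : R) : R := Num.max 0 (Num.min 1 t).
have cl01 t : 0 <= cl t <= 1 by apply: clamp_itv; exact: ler01.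
exists (fun t => tile v (Kf _ (cl01 t))); split; last 2 first.
- by apply: tile_eq; rewrite -f0 /cl clamp_id // lexx ler01.
- by apply: tile_eq; rewrite -f1 /cl clamp_id // lexx ler01.
have pE' t : p (to_unit t) = surf (f (cl t)) by rewrite pE.
split=> [t|c t Uc]; first by rewrite pE'.
have cw : chart_dom c (f (cl t)) by apply: Uc; [exact: Kf | rewrite pE'].
have cfc : continuous (fun t => f (cl t)).
  by apply: (@continuous_compose _ _ _ cl f) => //; exact: clamp_continuous.
have H : \forall t' \near t, sheet act c (f (cl t')) = sheet act c (f (cl t)).
  exact: cfc t _ (sheet_near act cw).
apply: filterS H => t' E.
by rewrite /tiled_lab /= E.
Qed.

Variables (w0 : R * R) (Kw0 : rect w0).

Lemma rect_radial t w : 0 <= t <= 1 -> rect w -> rect (t * w.1, w.2).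
Proof.
move=> /andP[t0 t1] /andP[/andP[r0 r1] Hs]; rewrite /rect /= Hs andbT.
by rewrite mulr_ge0 // mulr_ile1.
Qed.

Lemma transports_radial v w x (E : surf w = x) (Kw : rect w)
    (K0 : rect (0, w.2)) : transports (radial E) (tile v K0) (tile v Kw).
Proof.
apply: (@transports_rect (fun t => (t * w.1, w.2))) => //.
- apply: continuous_pair; last exact: continuous_cst.
  by move=> t; apply: cvgM; [exact: cvg_id | exact: cvg_cst].
- by move=> t Ht; exact: rect_radial.
- by rewrite mul0r.
- by rewrite mul1r -surjective_pairing.
Qed.

Lemma rect0 w : rect w -> rect (0, w.2).
Proof. by case/andP=> _ H; rewrite /rect /= H lexx ler01. Qed.

Lemma transports_spoke v w x (E : surf w = x) (Kw : rect w) :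
  transports (spoke w0 E) (tile v Kw0) (tile v Kw).
Proof.
rewrite /spoke; apply: (transports_cat (e2 := tile v (rect0 Kw0))).
  exact/transports_rev/transports_radial.
apply: transports_sheet (transports_radial v E Kw (rect0 Kw)); last exact: sheet_eq_refl.
apply: (sheet_eq1 compat (c := Inside)) => //; first exact: surf0.
by apply: chart_setP => //; [exact: rect0 | exact: ltr01].
Qed.

Lemma transports_turn v v' w w' x (E : surf w = x) (E' : surf w' = x) (Kw : rect w) (Kw' : rect w') :
  sheet_eq (tile v Kw) (tile v' Kw') ->
  transports (pcat (spoke w0 E) (prev (spoke w0 E'))) (tile v Kw0) (tile v' Kw0).
Proof.
move=> S; apply: (transports_cat (e2 := tile v Kw)).
  exact: transports_spoke.
apply: transports_rev; apply: transports_sheet (transports_spoke v' E' Kw'); first exact: sheet_eq_refl.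
exact: sheet_eq_sym.
Qed.

Local Notation G := (fundamental_group R (surf w0)).

(** The loop is realized as a turn at the midpoint of the side, where the chart [Edges] gives [v]
    and [act v j] the same label. *)
Lemma side_loop_transports j : exists2 p : path (surf w0) (surf w0),
  loop_class p = side_loop g_gt0 w0 j & forall v, transports p (tile v Kw0) (tile (act v j) Kw0).
Proof.
rewrite -(pos_val j); have := pos_lt g_gt0 j; move: (nat_of_ord j) => k kN.
have h12 : 0 < (2^-1 : R) < 1 by apply/andP; split; lra.
have h12' : 0 <= (2^-1 : R) <= 1 by apply/andP; split; lra.
have E : surf (1, k%:R + 2^-1) = surf (1, k%:R + 2^-1) by [].
have E' : surf (1, (glued_side k)%:R + 1 - 2^-1) = surf (1, k%:R + 2^-1).
  by rewrite -surf_side.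
have Kk (i : nat) : (i < N)%N -> rect (1, i%:R + 2^-1).
  rewrite -(ler_nat R) -natr1 /rect /= ler01 lexx => iN; have := ler0n R i.
  by move=> i0; apply/andP; split; lra.
have Kw := Kk k kN; have Kw' : rect (1, (glued_side k)%:R + 1 - 2^-1).
  have -> : (glued_side k)%:R + 1 - 2^-1 = (glued_side k)%:R + 2^-1 :> R by field.
  exact/Kk/glued_side_lt.
exists (pcat (spoke w0 E) (prev (spoke w0 E'))).
  by rewrite -(turn_sideE g_gt0 w0 E E' kN h12') turn_spoke.
move=> v; apply: (transports_turn E E' (Kw := Kw) (Kw' := Kw')).
have cd : chart_dom Edges (1 : R, k%:R + 2^-1).
  by split; [exact: ltr01 | exists k; rewrite nat_gap].
apply: (sheet_eq1 compat (c := Edges)) => //; first exact: chart_setP.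
exact: sheet_side.
Qed.

Lemma tile_monodromy (v0 : V) : exists e : G -> V,
  forall h j, e (h * side_loop g_gt0 w0 j)%g = act (e h) j.
Proof.
have [c0 Uc0] := chart_set_cover g_gt0 (surf w0).
have lifted (p : path (surf w0) (surf w0)) : exists v, transports p (tile v0 Kw0) (tile v Kw0).
  have [e' T] := transports_ex (@chart_set_open R g g_gt0) (chart_set_cover g_gt0)
    (tiled_surj g_gt0 act_surface) compat p (erefl : tiled_pr (tile v0 Kw0) = surf w0).
  have [_ pe'] := transports_pr T.
  (* The lift ends over the base point, possibly at other coordinates than [w0]; this finds the tile
     for which the end is at [w0]. *)
  have [v E] := sheet_onto g_gt0 act_surface c0 w0 (tiled_lab c0 e').
  exists v; apply: transports_sheet T; first exact: sheet_eq_refl.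
  by apply: (sheet_eq1 compat (c := c0)); rewrite ?pe'.
pose rp (h : G) : path (surf w0) (surf w0) := repr (h : {eq_quot (loop_homotopic_equiv R (surf w0))}).
have rpK h : loop_class (rp h) = h by exact: reprK.
pose e h := proj1_sig (cid (lifted (rp h))).
have eT h : transports (rp h) (tile v0 Kw0) (tile (e h) Kw0) := proj2_sig (cid (lifted (rp h))).
exists e => h j; have [l lE lT] := side_loop_transports j.
have T : transports (pcat (rp h) l) (tile v0 Kw0) (tile (act (e h) j) Kw0).
  exact: transports_cat (eT h) (lT _).
have H : rp (h * side_loop g_gt0 w0 j)%g ~~ pcat (rp h) l.
  by apply/loop_classP; rewrite rpK -loop_class_concat rpK lE.
have [_ /(_ c0 Uc0)] := transports_homotopic (@chart_set_open R g g_gt0) (chart_set_cover g_gt0)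
    (tiled_surj g_gt0 act_surface) compat H (eT _) T.
exact: sheet_inj.
Qed.

End tile_monodromy.

Theorem mainTheorem2 (R : realType) (g : nat) (g_ge2 : (2 <= g)%N)
    (x0 : closed_orientable_surface R g) :
  admits_strongly_aperiodic_sft (fundamental_group R x0).
Proof.
have g_gt0 : (0 < g)%N by exact: ltnW.
(* The base point is arbitrary: its polar coordinates fix the radius from which all spokes start. *)
have [w0 Kw0 <-] := surf_surj g_gt0 x0.
apply: (@strongly_aperiodic_sft_of_presentation R (4 * g) (@glued_pos g) _ _ _ _
  (side_loop g_gt0 w0)).
- by rewrite (leq_pmul2l (m := 4) (n1 := 2)).
- exact: glued_posK.
- exact: iter_next_pos.
- exact: side_loop_glued.
- exact: walk_side_loop.
- by move=> h; exact: side_word_all.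
- by move=> V act v0 act_surface; exact: tile_monodromy.
Qed.
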